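(* Let $\boldsymbol\gamma$ be an infinite path in a Rauzy diagram $\mathcal R$, starting at a vertex $\Pi$. Assume there exist - an increasing sequence of finite subsets $A_1\subset A_2\subset\dots\subset\mathbb N$ with $\bigcup_n A_n=\mathbb N$; - a factorisation $\boldsymbol\gamma=\zeta_1\cdot\zeta_2\cdots$ into finite paths such that, for every $n\ge1$, the matrix $M_n=M^{\zeta_n}$ is strictly $A_n$-supported and $\zeta_n$ reveals at least $n$ intervals in each tail; - a constant $C$ with $\sup_n D_{A_n}(M_n)<C$. Then there is a unique IET associated with $\boldsymbol\gamma$ (that is, a unique $\lambda\in\Delta$ such that $T_{(\Pi,\lambda)}$ is associated with $\boldsymbol\gamma$), and it is uniquely ergodic.
   Context: **Simplex.** $\mathcal A$ is a countably infinite alphabet identified with $\mathbb N$ by a fixed bijection; $\Delta=\{\lambda\in\mathbb R_{>0}^{\mathbb N}:\sum_i\lambda_i=1\}$. **Grouped permutations.** A (grouped) permutation $\Pi=(\mathcal P,\tau,\pi)$ on $\mathcal A$ consists of: a finite partition $\mathcal P$ of $\mathcal A$ into $d\ge 2$ groups, each of cardinality $1$ (a single interval) or infinite (a tail interval, or tail); a map $\tau:\mathcal P\to\{\leftarrow,\bullet,\rightarrow\}$ equal to $\bullet$ exactly on single intervals, a tail being right-sided if $\tau=\leftarrow$ and left-sided if $\tau=\rightarrow$; a pair $\pi=(\pi_t,\pi_b)$ of bijections $\mathcal P\to\{1,\dots,d\}$ (top and bottom order from left to right). Each tail carries an enumeration $\alpha_1,\alpha_2,\dots$ of its labels from the outermost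 label $\alpha_1$ inwards. $\Pi$ is proper if at least one of $\pi_t^{-1}(1),\pi_b^{-1}(1)$ and at least one of $\pi_t^{-1}(d),\pi_b^{-1}(d)$ is a single interval; irreducible if $\pi_t^{-1}(\{1,\dots,n\})\ne\pi_b^{-1}(\{1,\dots,n\})$ for every $1\le n<d$. **The IET $T_{(\Pi,\lambda)}$.** For $\lambda\in\Delta$, partition $[0,1]$ up to a countable set into open top intervals $I^t_\alpha$, and into open bottom intervals $I^b_\alpha$, of lengths $\lambda_\alpha$: groups are contiguous and placed from left to right in the order $\pi_t$ (top), $\pi_b$ (bottom); on top the intervals of a left-sided tail appear left to right as $\alpha_1,\alpha_2,\dots$ and those of a right-sided tail appear right to left as $\alpha_1,\alpha_2,\dots$; on the bottom the order inside each tail is reversed. $T_{(\Pi,\lambda)}$ translates each $I^t_\alpha$ onto $I^b_\alpha$ (values on the countable complement are irrelevant). It is uniquely ergodic if it has a unique invariant Borel probability measure on $[0,1]$. **Revealing.** Revealing a tail $\mathcal T$ of $\Pi$ with outermost label $\alpha$ replaces $\mathcal T$ in $\mathcal P$ by the tail $\mathcal T\setminus\{\alpha\}$ (same direction, regarded as the same tail) and the single interval $\{\alpha\}$, where $\{\alpha\}$ is placed next to $\mathcal T\setminus\{\alpha\}$ on the side where $\alpha$ was: for a left-sided tail immediately to the left on top and to the right on the bottom, for a right-sided tail immediately to the right on top and to the left on the bottom. **Rauzy diagrams.** Let $\Pi$ be proper and irreducible, and let $\mathcal A_t=\pi_t^{-1}(d)$, $\mathcal A_b=\pi_b^{-1}(d)$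 (the playing groups; they are never both tails). $R_t(\Pi)$ (top wins; winner $\mathcal A_t$, loser $\mathcal A_b$): if $\mathcal A_t$ is a tail, reveal it; if $\mathcal A_t$ is a single interval, move the group $\mathcal A_b$ in the bottom order to the position immediately to the right of $\mathcal A_t$, leaving the rest unchanged. $R_b(\Pi)$ (bottom wins; winner $\mathcal A_b$, loser $\mathcal A_t$) is defined with the roles of top and bottom exchanged. A Rauzy diagram is a connected component of the directed graph whose vertices are the proper and irreducible permutations on $\mathcal A$, with edges $\Pi\to R_t(\Pi)$ and $\Pi\to R_b(\Pi)$; each edge carries its winner and loser. **Matrices.** To an edge $e$ associate the $\mathcal A\times\mathcal A$ matrix $M^e=\mathrm{Id}$ if a tail wins along $e$, and $M^e=\mathrm{Id}+E_{w,\mathcal L}$ if the single interval $\{w\}$ wins against the group $\mathcal L$, where $E_{w,\mathcal L}$ has entries $1$ in row $w$ and columns in $\mathcal L$, and $0$ elsewhere. For a finite path $\gamma=e_1\cdots e_n$, $M^\gamma=M^{e_1}\cdots M^{e_n}$. The map $\hat M:\Delta\to\Delta$ is $\hat M\lambda=M\lambda/\|M\lambda\|_1$, and $\Delta^\gamma=\hat M^\gamma\Delta$. **IETs associated with a path.** For an infinite path $\boldsymbol\gamma$ starting at $\Pi$ with prefixes $\gamma_n$ of length $n$, put $\Delta^{\boldsymbol\gamma,\infty}=\bigcap_{n\ge0}\Delta^{\gamma_n}$. The IETs associated with $\boldsymbol\gamma$ are the $T_{(\Pi,\lambda)}$ with $\lambda\in\Delta^{\boldsymbol\gamma,\infty}$.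 **Hypotheses.** For $A\subset\mathbb N$ finite, $M$ is $A$-supported if its rows outside $A$ coincide with those of the identity, and strictly $A$-supported if moreover all entries in rows indexed by $A$ are positive. The $A$-diameter is $$D_A(M)=\log\sup_{i,j\in A,\ k,l\in\mathbb N}\frac{M_{ik}M_{jl}}{M_{il}M_{jk}}.$$ ''$\zeta_n$ reveals at least $n$ intervals in each tail'' means that along $\zeta_n$ at least $n$ intervals of each tail of its starting permutation are turned into single intervals, and their labels belong to $A_n$. *)

(* Defs.v *)
From HB Require Import structures.
From Stdlib Require Export Relation_Operators.
From mathcomp Require Export all_boot all_order all_algebra.
From mathcomp Require Export all_classical all_reals all_analysis.

Set Implicit Arguments.
Unset Strict Implicit.
Unset Printing Implicit Defensive.

Export Order.TTheory GRing.Theory Num.Theory numFieldNormedType.Exports.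

Local Open Scope classical_set_scope.
Local Open Scope ring_scope.

(** * Grouped permutations on the alphabet [nat] *)

(* A left-sided tail has tau = "->" and a right-sided one tau = "<-". *)
Inductive direction := LeftSided | RightSided.

(* [Tail d e] carries the enumeration [e 0, e 1, ...] of its labels, from the
   outermost one inwards; the map tau is read off the constructors. *)
Inductive group := Single of nat | Tail of direction & (nat -> nat).

HB.instance Definition _ := gen_eqMixin group.

Definition labels (g : group) : set nat :=
  match g with Single a => [set a] | Tail _ e => range e end.

Definition is_single (g : group) : bool :=
  if g is Single _ then true else false.

Inductive side := Top | Bot.

Definition opp (s : side) : side :=
  match s with Top => Bot | Bot => Top end.

(* The bijections pi_t, pi_b from the set of groups to {1, ..., d} are given by
   the lists of the groups from left to right: the group of index [i] in
   [top_order] (counting from 0) is pi_t^-1(i + 1), and likewise for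
   [bot_order] and pi_b. *)
Record gperm := GPerm { top_order : seq group; bot_order : seq group }.

Definition order_on (P : gperm) (s : side) : seq group :=
  match s with Top => top_order P | Bot => bot_order P end.

Definition set_order (s : side) (l : seq group) (P : gperm) : gperm :=
  match s with
  | Top => GPerm l (bot_order P)
  | Bot => GPerm (top_order P) l
  end.

Definition is_gperm (P : gperm) : Prop :=
  [/\ (2 <= size (top_order P))%N,
      uniq (top_order P),
      perm_eq (top_order P) (bot_order P),
      (forall d e, Tail d e \in top_order P -> injective e)
    & (forall a, exists! g, g \in top_order P /\ labels g a)].

(* The default value [Single 0] is irrelevant: the orders are nonempty. *)
Definition leftmost (P : gperm) (s : side) : group :=
  head (Single 0) (order_on P s).

Definition rightmost (P : gperm) (s : side) : group :=
  last (Single 0) (order_on P s).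

Definition is_proper (P : gperm) : Prop :=
  (is_single (leftmost P Top) || is_single (leftmost P Bot)) /\
  (is_single (rightmost P Top) || is_single (rightmost P Bot)).

Definition is_irreducible (P : gperm) : Prop :=
  forall n, (1 <= n < size (top_order P))%N ->
    ~ (take n (top_order P) =i take n (bot_order P)).

Definition vertex (P : gperm) : Prop :=
  [/\ is_gperm P, is_proper P & is_irreducible P].

(* On side [s], is the outermost label of a tail of direction [d] its leftmost
   one? *)
Definition outermost_left (s : side) (d : direction) : bool :=
  match s, d with
  | Top, LeftSided | Bot, RightSided => true
  | _, _ => false
  end.

(** * Rauzy diagrams *)

Definition reveal_in (s : side) (T : group) (l : seq group) : seq group :=
  match T with
  | Single _ => l
  | Tail d e =>
      let T' := Tail d (fun n => e n.+1) in
      let a := Single (e 0%N) in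
      flatten [seq if g == T then
                     if outermost_left s d then [:: a; T'] else [:: T'; a]
                   else [:: g] | g <- l]
  end.

Definition reveal (T : group) (P : gperm) : gperm :=
  GPerm (reveal_in Top T (top_order P)) (reveal_in Bot T (bot_order P)).

Definition move_after (W L : group) (l : seq group) : seq group :=
  let l' := rem L l in
  let i := (index W l').+1 in
  take i l' ++ L :: drop i l'.

(* The edges [R_t] and [R_b] are [rauzy Top] and [rauzy Bot]. *)
Definition winner (s : side) (P : gperm) : group := rightmost P s.
Definition loser (s : side) (P : gperm) : group := rightmost P (opp s).

Definition rauzy (s : side) (P : gperm) : gperm :=
  match winner s P with
  | Tail _ _ => reveal (winner s P) P
  | Single _ =>
      set_order (opp s)
        (move_after (winner s P) (loser s P) (order_on P (opp s))) P
  end.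

Definition rauzy_edge (P Q : gperm) : Prop :=
  [/\ vertex P, vertex Q & exists s, Q = rauzy s P].

(* Components are taken in the underlying undirected graph. *)
Definition rauzy_diagram (D : set gperm) : Prop :=
  exists2 P, vertex P & D = [set Q | clos_refl_sym_trans gperm rauzy_edge P Q].

(* An edge is determined by its starting vertex and its winning side. *)
Record infinite_path := InfinitePath {
  vtx : nat -> gperm;
  won : nat -> side
}.

Definition path_in (D : set gperm) (P : gperm) (gamma : infinite_path) : Prop :=
  vtx gamma 0%N = P /\
  forall n, D (vtx gamma n) /\ vtx gamma n.+1 = rauzy (won gamma n) (vtx gamma n).

(** * Infinite matrices and simplices *)

Definition simplex (R : realType) : set (nat -> R) :=
  [set lam | (forall i, 0 < lam i) /\ series lam @ \oo --> (1 : R)].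

Definition rsum (R : realType) (u : nat -> R) : R := limn (series u).

Definition imatrix (R : realType) := nat -> nat -> R.

Definition id_imx (R : realType) : imatrix R := fun i k => (i == k)%:R.

(* Path matrices have finitely supported columns and bounded row entries, so
   that the series below converge when they are applied to them and to summable
   vectors. *)
Definition mul_imx (R : realType) (M N : imatrix R) : imatrix R :=
  fun i k => rsum (fun j => M i j * N j k).

Definition mul_imv (R : realType) (M : imatrix R) (v : nat -> R) : nat -> R :=
  fun i => rsum (fun k => M i k * v k).

Definition norm1 (R : realType) (v : nat -> R) : R :=
  rsum (fun i => `|v i|).

Definition hat (R : realType) (M : imatrix R) (v : nat -> R) : nat -> R :=
  fun i => mul_imv M v i / norm1 (mul_imv M v).

Definition edge_imx (R : realType) (s : side) (P : gperm) : imatrix R :=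
  fun i k =>
    match winner s P with
    | Tail _ _ => (i == k)%:R
    | Single w =>
        (i == k)%:R + ((i == w) && `[< labels (loser s P) k >])%:R
    end.
Arguments edge_imx R s P : clear implicits.

(* The matrix of the finite path formed by the edges of index m, ..., n - 1. *)
Definition path_imx (R : realType) (gamma : infinite_path) (m n : nat) :
    imatrix R :=
  foldr (@mul_imx R) (@id_imx R)
    [seq edge_imx R (won gamma k) (vtx gamma k) | k <- index_iota m n].
Arguments path_imx R gamma m n : clear implicits.

Definition path_simplex (R : realType) (gamma : infinite_path) (m n : nat) :
    set (nat -> R) :=
  hat (path_imx R gamma m n) @` @simplex R.
Arguments path_simplex R gamma m n : clear implicits.

Definition limit_simplex (R : realType) (gamma : infinite_path) :
    set (nat -> R) :=
  \bigcap_n path_simplex R gamma 0 n.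
Arguments limit_simplex R gamma : clear implicits.

Definition supported (R : realType) (A : set nat) (M : imatrix R) : Prop :=
  forall i k, ~ A i -> M i k = id_imx R i k.

Definition strictly_supported (R : realType) (A : set nat) (M : imatrix R) :
    Prop :=
  supported A M /\ forall i k, A i -> 0 < M i k.

(* [lne] extends the logarithm to the extended reals, with
   [lne +oo = +oo]. *)
Definition diameter (R : realType) (A : set nat) (M : imatrix R) : \bar R :=
  lne (ereal_sup [set x | exists i j k l,
    [/\ A i, A j & x = (M i k * M j l / (M i l * M j k))%:E]]).

(* The labels of [T] that turn into single intervals along the edges of index
   m, ..., n - 1: an edge won by a tail reveals the outermost label that this
   tail has at that time. *)
Definition revealed (gamma : infinite_path) (m n : nat) (T : group) : set nat :=
  [set a | labels T a /\ exists k d e, [/\ (m <= k < n)%N,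
     winner (won gamma k) (vtx gamma k) = Tail d e & e 0%N = a]].

Definition reveals (gamma : infinite_path) (m n : nat) (N : nat) (A : set nat) :
    Prop :=
  forall T, T \in top_order (vtx gamma m) -> ~~ is_single T ->
    (`I_N #<= revealed gamma m n T `&` A)%card.

(** * Interval exchange transformations *)

Definition group_index (s : side) (P : gperm) (a : nat) : nat :=
  find (fun g => `[< labels g a >]) (order_on P s).

(* On side [s], the interval of label [c] lies to the left of that of [a]. *)
Definition precedes (s : side) (P : gperm) (c a : nat) : Prop :=
  (group_index s P c < group_index s P a)%N \/
  exists d e i j, [/\ Tail d e \in order_on P s, c = e i, a = e j
    & if outermost_left s d then (i < j)%N else (j < i)%N].

(* As intervals are contiguous up to a countable set, the left endpoint of an
   interval is the total length of the intervals to its left. *)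
Definition left_end (R : realType) (s : side) (P : gperm) (lam : nat -> R)
    (a : nat) : R :=
  rsum (fun c => if `[< precedes s P c a >] then lam c else 0).

Definition subinterval (R : realType) (s : side) (P : gperm) (lam : nat -> R)
    (a : nat) : set R :=
  `]left_end s P lam a, left_end s P lam a + lam a[%classic.

Definition iet_dom (R : realType) (P : gperm) (lam : nat -> R) : set R :=
  \bigcup_a subinterval Top P lam a.

(* The value outside [iet_dom] is a junk value, which is never used. *)
Definition iet (R : realType) (P : gperm) (lam : nat -> R) (x : R) : R :=
  get [set y | exists2 a, subinterval Top P lam a x
                & y = x - left_end Top P lam a + left_end Bot P lam a].

(* Preimages are those of the partial map with domain [iet_dom]; with [B] the
   whole line, this forces the countable complement of [iet_dom] in [0, 1],
   where the values of the transformation are irrelevant, to be negligible. *)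
Definition invariant_probability (R : realType) (P : gperm) (lam : nat -> R)
    (mu : probability (measurableTypeR R) R) : Prop :=
  mu `[0, 1]%classic = 1%E /\
  forall B : set (measurableTypeR R), measurable B ->
    mu (iet_dom P lam `&` iet P lam @^-1` B) = mu B.

(* Measures are compared on Borel sets, as their values elsewhere are
   unspecified. *)
Definition uniquely_ergodic (R : realType) (P : gperm) (lam : nat -> R) : Prop :=
  exists2 mu : probability (measurableTypeR R) R,
    invariant_probability P lam mu
  & forall nu : probability (measurableTypeR R) R,
      invariant_probability P lam nu ->
      forall B : set (measurableTypeR R), measurable B -> nu B = mu B.

(* Main.v *)
(* Contraction. Let M_n be the matrix of the n-th factor and r_n(k) the sum of
   the k-th column of M_1 ... M_n. If, for some nonnegative row vector phi, the
   quotients (phi M_1 ... M_n)_k / r_n(k) lie in an interval of length delta,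
   then the bound on D_{A_{n+1}}(M_{n+1}) puts those at stage n + 1 in an
   interval of length theta delta with theta < 1 fixed, provided that r_n(k) is
   bounded by a fixed multiple of the sum of r_n over A_{n+1} for every k outside
   A_{n+1}. For k in a tail this holds because A_{n+1} contains a label of the
   same tail, whose column sum is the same. Otherwise k is a single interval
   that never wins before the end of the (n+1)-st factor, hence behaves as a
   marked point: its tower consists of an initial part and of pieces of at most
   four towers over groups that do win or are tails. The contraction gives, for
   every starting time, a unique limit direction, which is a positive
   probability vector by tightness.

   Unique ergodicity. The distribution function F of an invariant probability
   semiconjugates T_(Pi,lambda) to T_(Pi,mu) with mu_a the mass of I_a, and this
   persists along the Rauzy induction. Uniqueness of the limit direction forces
   mu = lambda at every stage, so F fixes the endpoints of all the intervals, and
   sup |F - id| on the n-th induction interval does not exceed the same supremum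
   on the next one, which is at most the length of that interval and tends to 0. *)
From HB Require Import structures.
Require Import Defs.
From mathcomp Require Import zify ring lra measurable_realfun.
Set Implicit Arguments.
Unset Strict Implicit.
Unset Printing Implicit Defensive.
Local Open Scope classical_set_scope.
Local Open Scope ring_scope.

(** * Permutations *)

(** The obstacle is that M_{n+1} is positive only in the rows of A_{n+1}; its other rows are those
    of the identity, so the usual contraction of positive matrices does not apply. A column k
    outside A_{n+1} keeps its old entry next to the mixture of the rows in A_{n+1}. Bounding the old
    column sum by five times the sum over A_{n+1} makes the mixture at least one sixth of the new
    column sum, whence theta = 1 - 1 / (6 K) with K = max (1, e^C).

    For a marked point this bound is endangered only when it loses repeatedly to one winner, all
    groups losing in between being marked points as well. Such a winner would win every later edge,
    and no tail could be revealed in the next factor.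

    Tightness comes from uniformity: the estimates hold for all rows 0 <= phi <= 1 at once, so the
    directions converge in total variation.

    A priori F may have jumps, and a losing tail need not have a first interval. Near the left end
    of the losing group, F is therefore controlled by monotonicity and by intervals that start
    arbitrarily close to that end. *)

Definition grouping (l : seq group) : Prop :=
  [/\ uniq l, (forall d e, Tail d e \in l -> injective e)
    & forall a, exists! g, g \in l /\ labels g a].

Lemma grouping_eq l g h a : grouping l -> g \in l -> h \in l ->
  labels g a -> labels h a -> g = h.
Proof.
move=> [_ _ /(_ a)[k [_ kl]]] gl hl ga ha.
by rewrite -(kl g (conj gl ga)) -(kl h (conj hl ha)).
Qed.

Lemma grouping_ex l a : grouping l -> exists2 g, g \in l & labels g a.
Proof. by move=> [_ _ /(_ a)[k [[kl ka] _]]]; exists k. Qed.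

Lemma perm_grouping l l' : perm_eq l l' -> grouping l -> grouping l'.
Proof.
move=> ll' [lu li lx]; have m := perm_mem ll'; split.
- by rewrite -(perm_uniq ll').
- by move=> d e; rewrite -m => /li.
- move=> a; have [g [[gl ga] gu]] := lx a; exists g; split; first by rewrite -m.
  by move=> h; rewrite -m => /gu.
Qed.

Lemma labels_ex g : exists a, labels g a.
Proof. by case: g => [a|d e]; [exists a | exists (e 0%N), 0%N]. Qed.

Lemma oppK : involutive opp. Proof. by case. Qed.

Section Vertex.
Variables (P : gperm) (hP : vertex P).

Lemma order_perm s s' : perm_eq (order_on P s) (order_on P s').
Proof.
have [[_ _ pP _ _] _ _] := hP.
by case: s; case: s' => //=; rewrite perm_sym.
Qed.

Lemma order_mem s s' : order_on P s =i order_on P s'.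
Proof. exact/perm_mem/order_perm. Qed.

Lemma order_grouping s : grouping (order_on P s).
Proof.
have [[_ uP _ iP xP] _ _] := hP.
by apply: (perm_grouping (order_perm Top s)).
Qed.

Lemma order_size s : (2 <= size (order_on P s))%N.
Proof.
have [[sP _ _ _ _] _ _] := hP.
by rewrite (perm_size (order_perm s Top)).
Qed.

Lemma rightmost_rcons s : exists p, order_on P s = rcons p (rightmost P s).
Proof.
have := order_size s; rewrite /rightmost.
by case/lastP: (order_on P s) => // p x _; exists p; rewrite last_rcons.
Qed.

Lemma rightmost_mem s s' : rightmost P s \in order_on P s'.
Proof.
rewrite (order_mem _ s); have [p ->] := rightmost_rcons s.
by rewrite mem_rcons inE eqxx.
Qed.

(** If both orders ended with the same group, their first d - 1 groups would coincide as sets, which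
    irreducibility forbids. *)
Lemma winner_neq_loser s : winner s P != loser s P.
Proof.
rewrite /winner /loser; apply/eqP => E.
have [_ _ /(_ (size (top_order P)).-1)] := hP.
have := order_size Top => /= s2; case; first by lia.
have tb : rightmost P Top = rightmost P Bot by case: s E.
have [p pE] := rightmost_rcons Top; have [q qE] := rightmost_rcons Bot.
have pq := order_perm Top Bot.
move: (perm_size pq); rewrite /= in pE qE pq *.
rewrite pE qE !size_rcons => -[spq] /=.
have tk (r : seq group) x : take (size r) (rcons r x) = r by rewrite -cats1 take_size_cat.
rewrite tk spq tk.
apply: perm_mem; have := perm_cat2r [:: rightmost P Bot] p q => <-.
by rewrite !cats1 -{1}tb -pE -qE.
Qed.

Lemma single_label_notin_loser s w : winner s P = Single w ->
  ~ labels (loser s P) w.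
Proof.
move=> E lw; have /eqP := winner_neq_loser s; apply; rewrite E.
apply: (@grouping_eq _ _ _ w (order_grouping s)) => //; rewrite -?E;
  exact: rightmost_mem.
Qed.

Lemma loser_split s : exists q1 q2,
  order_on P (opp s) = q1 ++ winner s P :: rcons q2 (loser s P).
Proof.
have [q qE] := rightmost_rcons (opp s).
have : winner s P \in order_on P (opp s) by exact: rightmost_mem.
rewrite qE mem_rcons inE (negPf (winner_neq_loser s)) /=.
by case/splitPr=> q1 q2; exists q1, q2; rewrite rcons_cat.
Qed.

Lemma rauzy_single_same s w : winner s P = Single w ->
  order_on (rauzy s P) s = order_on P s.
Proof. by rewrite /rauzy => ->; case: s. Qed.

Lemma rauzy_single_opp s w q1 q2 : winner s P = Single w ->
  order_on P (opp s) = q1 ++ Single w :: rcons q2 (loser s P) ->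
  order_on (rauzy s P) (opp s) = q1 ++ Single w :: loser s P :: q2.
Proof.
move=> E qE; have [qu _ _] := order_grouping (opp s).
have -> : order_on (rauzy s P) (opp s) =
    move_after (winner s P) (loser s P) (order_on P (opp s)).
  by rewrite /rauzy E; case: (s).
rewrite /move_after E qE.
have Lq : loser s P \notin q1 ++ Single w :: q2.
  move: qu; rewrite qE -rcons_cons -rcons_cat rcons_uniq.
  by case/andP.
have -> : rem (loser s P) (q1 ++ Single w :: rcons q2 (loser s P)) =
   q1 ++ Single w :: q2.
  rewrite -rcons_cons -rcons_cat remE.
  have -> : index (loser s P) (rcons (q1 ++ Single w :: q2) (loser s P)) =
     size (q1 ++ Single w :: q2).
    by rewrite -cats1 index_cat (negPf Lq) /= eqxx addn0.
  rewrite -cats1 take_size_cat // [drop _ _]drop_oversize ?cats0 //.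
  by rewrite !size_cat /=; lia.
have wq : Single w \notin q1.
  move: qu; rewrite qE cat_uniq /= => /and3P[_ + _].
  by case/norP.
rewrite index_cat (negPf wq) /= eqxx addn0 -(cat_rcons _ q1 q2).
have -> : (size q1).+1 = size (rcons q1 (Single w)) by rewrite size_rcons.
by rewrite take_size_cat // drop_size_cat // cat_rcons.
Qed.

Lemma reveal_in_cat s d e l1 l2 : uniq (l1 ++ Tail d e :: l2) ->
  reveal_in s (Tail d e) (l1 ++ Tail d e :: l2) =
  l1 ++ (if outermost_left s d then
    [:: Single (e 0%N); Tail d (fun n => e n.+1)] else
    [:: Tail d (fun n => e n.+1); Single (e 0%N)]) ++ l2.
Proof.
rewrite cat_uniq /= => /and4P[_ /norP[T1 _] T2 _].
have H l : Tail d e \notin l -> flatten [seq if g == Tail d e then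
         if outermost_left s d then
    [:: Single (e 0%N); Tail d (fun n => e n.+1)] else
    [:: Tail d (fun n => e n.+1); Single (e 0%N)]
       else [:: g] | g <- l] = l.
  elim: l => //= g l IH; rewrite inE negb_or eq_sym => /andP[/negPf-> /IH].
  by move=> ->.
by rewrite /reveal_in map_cat flatten_cat H //= eqxx H.
Qed.

Lemma rauzy_tail s s' d e l1 l2 : winner s P = Tail d e ->
  order_on P s' = l1 ++ Tail d e :: l2 ->
  order_on (rauzy s P) s' = l1 ++ (if outermost_left s' d then
    [:: Single (e 0%N); Tail d (fun n => e n.+1)] else
    [:: Tail d (fun n => e n.+1); Single (e 0%N)]) ++ l2.
Proof.
move=> E lE; have [u _ _] := order_grouping s'.
have -> : order_on (rauzy s P) s' = reveal_in s' (Tail d e) (order_on P s').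
  by rewrite /rauzy E; case: (s').
by rewrite lE reveal_in_cat // -lE.
Qed.

(** Finitely many single intervals carry finitely many labels, whereas the labels exhaust [nat]. *)
Lemma exists_tail s : exists d e, Tail d e \in order_on P s.
Proof.
apply: contrapT => nT.
have : exists m, forall a, Single a \in order_on P s -> (a < m)%N.
  elim: (order_on P s) => [|g l [m IH]]; first by exists 0%N.
  exists (maxn m (if g is Single b then b.+1 else 0%N)) => a.
  rewrite inE => /orP[/eqP <-|/IH]; lia.
case=> m hm; have [g gl gm] := grouping_ex m (order_grouping s).
case: g gl gm => [a al am|d e dl _]; last by apply: nT; exists d, e.
by have := hm _ al; rewrite am ltnn.
Qed.

End Vertex.

Lemma path_vertex D P gamma n : rauzy_diagram D -> path_in D P gamma ->
  vertex (vtx gamma n).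
Proof.
move=> [P0 vP0 ->] [_ /(_ n)[+ _]] => /= H.
(* An equivalence, unlike an implication, passes through the symmetric steps of the closure. *)
have : vertex P0 <-> vertex (vtx gamma n).
  elim: H => [x y [vx vy _] //|//|x y _ [] //|x y z _ [h1 h2] _ [h3 h4]].
  by split=> [/h1/h3//|/h4/h2].
by case=> h _; exact: h.
Qed.

(** * Column sums of path matrices *)

Section Dual.
Context {R : realType}.
Implicit Types (phi : nat -> R) (P : gperm) (s : side).

(* The row vector [phi] times the matrix of the edge. *)
Definition edge_row s P phi : nat -> R :=
  match winner s P with
  | Tail _ _ => phi
  | Single w => fun j => phi j + (if `[< labels (loser s P) j >] then phi w else 0)
  end.

(** The row [phi] times the matrix of the edges m, ..., n - 1. For the constant row 1 these are the
    column sums, that is, the heights of the towers over the intervals at time n. *)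
Fixpoint path_row (gamma : infinite_path) m n phi : nat -> R :=
  if n is n'.+1 then
    if (m <= n')%N then
      edge_row (won gamma n') (vtx gamma n') (path_row gamma m n' phi)
    else phi
  else phi.

Lemma edge_row_le s P phi : (forall j, 0 <= phi j) ->
  forall j, phi j <= edge_row s P phi j.
Proof.
move=> h j; rewrite /edge_row; case: (winner s P) => // w.
by case: ifP => _; rewrite ?addr0 ?lerDl.
Qed.

Lemma edge_row_ge0 s P phi : (forall j, 0 <= phi j) ->
  forall j, 0 <= edge_row s P phi j.
Proof. by move=> h j; apply: (le_trans (h j)); exact: edge_row_le. Qed.

Lemma path_row_id gamma m n phi : (n <= m)%N -> path_row gamma m n phi = phi.
Proof. by case: n => //= n nm; rewrite leqNgt nm. Qed.

Lemma path_rowS gamma m n phi : (m <= n)%N -> path_row gamma m n.+1 phi =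
  edge_row (won gamma n) (vtx gamma n) (path_row gamma m n phi).
Proof. by move=> /= ->. Qed.

Lemma path_row_ge0 gamma m n phi : (forall j, 0 <= phi j) ->
  forall j, 0 <= path_row gamma m n phi j.
Proof.
move=> h; elim: n => //= n IH j; case: ifP => // _.
exact: edge_row_ge0.
Qed.

Lemma path_row_mono gamma m n n' phi : (forall j, 0 <= phi j) -> (n <= n')%N ->
  forall j, path_row gamma m n phi j <= path_row gamma m n' phi j.
Proof.
move=> h + j; elim: n' => [|n' IH]; first by rewrite leqn0 => /eqP->.
rewrite leq_eqVlt => /predU1P[->//|]; rewrite ltnS => /IH /le_trans; apply.
have [nm|nm] := leqP m n'.
  by rewrite path_rowS //; apply: edge_row_le => i; exact: path_row_ge0.
by rewrite !path_row_id // ltnW.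
Qed.

Lemma path_row_cat gamma m n p phi : (m <= n <= p)%N ->
  path_row gamma m p phi = path_row gamma n p (path_row gamma m n phi).
Proof.
case/andP=> mn; elim: p => [|p IH].
  by rewrite leqn0 => /eqP->.
rewrite leq_eqVlt => /predU1P[->|]; first by rewrite [RHS]path_row_id.
rewrite ltnS => np; rewrite !path_rowS ?(leq_trans mn) //.
by rewrite IH.
Qed.

Lemma path_row_le gamma m n phi phi' : (forall j, phi j <= phi' j) ->
  forall j, path_row gamma m n phi j <= path_row gamma m n phi' j.
Proof.
move=> h; elim: n => //= n IH j; case: ifP => // _; rewrite /edge_row.
case: (winner _ _) => // w; rewrite lerD //.
by case: ifP.
Qed.

(** Integrality turns a positive matrix entry into one that is at least 1, the lower bound used in
    the contraction. *)
Lemma path_row_nat gamma m n phi : (forall j, exists a, phi j = a%:R) ->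
  forall j, exists a, path_row gamma m n phi j = a%:R.
Proof.
move=> h; elim: n => //= n IH j; case: ifP => // _; rewrite /edge_row.
case: (winner _ _) => // w; have [a ->] := IH j; have [b ->] := IH w.
by case: ifP => _; [exists (a + b)%N; rewrite natrD | exists a; rewrite addr0].
Qed.

End Dual.

(** * Groups along an edge and along a path *)

Section RauzyStep.
Variables (P : gperm) (hP : vertex P) (s : side).

Lemma rauzy_mem g s' : vertex (rauzy s P) -> g \in order_on (rauzy s P) s' ->
  exists2 g', g' \in order_on P s' & labels g `<=` labels g'.
Proof.
move=> hQ gQ; case E : (winner s P) => [w|d e].
  exists g => //; move: gQ; rewrite !(@order_mem _ _ s' s) //.
  by rewrite (rauzy_single_same E).
have : Tail d e \in order_on P s' by rewrite -E; exact: rightmost_mem.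
case/splitPr E' : _ / => [l1 l2].
move: gQ; rewrite (rauzy_tail hP E E').
have A : (g == Single (e 0%N)) || (g == Tail d (fun n => e n.+1)) ->
   exists2 g', g' \in l1 ++ Tail d e :: l2 & labels g `<=` labels g'.
  move=> h; exists (Tail d e); first by rewrite mem_cat inE eqxx orbT.
  case/orP: h => /eqP -> a /=; first by move=> ->; exists 0%N.
  by move=> [i _ <-]; exists i.+1.
have B : g \in l1 ++ l2 -> exists2 g', g' \in l1 ++ Tail d e :: l2 & labels g `<=` labels g'.
  by move=> h; exists g => //; move: h; rewrite !mem_cat inE => /orP[->//|->]; rewrite !orbT.
rewrite !mem_cat => /or3P[h|h|h].
- by apply: B; rewrite mem_cat h.
- by apply: A; move: h; case: ifP => _; rewrite !inE // orbC.
- by apply: B; rewrite mem_cat h orbT.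
Qed.

Lemma rauzy_tail_persists d e s' : Tail d e \in order_on P s' ->
  exists2 e', Tail d e' \in order_on (rauzy s P) s' & range e' `<=` range e.
Proof.
move=> Tin; case E : (winner s P) => [w|d' e'].
  exists e => //; have [ss'|ss'] : s' = s \/ s' = opp s.
    by case: (s) (s') => -[]; auto.
    by rewrite ss' (rauzy_single_same E) (order_mem hP _ s').
  rewrite ss'.
  have [q1 [q2 q]] := loser_split hP s.
  rewrite E in q; rewrite (rauzy_single_opp hP E q).
  move: Tin; rewrite (order_mem hP _ (opp s)) q.
  by rewrite !mem_cat !inE mem_rcons !inE.
have : Tail d' e' \in order_on P s' by rewrite -E; exact: rightmost_mem.
case/splitPr E' : _ / => [l1 l2]; rewrite (rauzy_tail hP E E').
move: Tin; rewrite E' mem_cat inE orbCA => /orP[/eqP[-> ->]|h].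
  exists (fun n => e' n.+1); last by move=> a [i _ <-]; exists i.+1.
  by rewrite !mem_cat; case: ifP; rewrite !inE !eqxx ?orbT.
by exists e => //; rewrite !mem_cat orbCA h orbT.
Qed.

End RauzyStep.

Section Path.
Context {R : realType}.
Variables (gamma : infinite_path) (hv : forall n, vertex (vtx gamma n)).
Hypothesis hs : forall n, vtx gamma n.+1 = rauzy (won gamma n) (vtx gamma n).

Lemma tail_persists t n d e s : (t <= n)%N -> Tail d e \in order_on (vtx gamma t) s ->
  exists2 e', Tail d e' \in order_on (vtx gamma n) s & range e' `<=` range e.
Proof.
move=> + te; elim: n => [|n IH]; first by rewrite leqn0 => /eqP<-; exists e.
rewrite leq_eqVlt => /predU1P[<-|]; first by exists e.
rewrite ltnS => /IH [e' e'n e'e].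
have [e2 e2n e2e] := rauzy_tail_persists (hv n) (won gamma n) e'n.
by exists e2; [rewrite hs | apply: subset_trans e'e].
Qed.

(** Groups only shrink along a path: two labels of one group at time n were in one group at every
    earlier time. They have lost together, so their column sums received the same additions. *)
Lemma path_row1_group m n s g a b : g \in order_on (vtx gamma n) s ->
  labels g a -> labels g b ->
  path_row gamma m n (fun=> 1 : R) a = path_row gamma m n (fun=> 1) b.
Proof.
elim: n g => //= n IH g gn ga gb; case: ifP => // mn.
have [g' g'n gg'] : exists2 g', g' \in order_on (vtx gamma n) s & labels g `<=` labels g'.
  by rewrite hs in gn; apply: rauzy_mem gn => //; rewrite -hs.
rewrite /edge_row; have E := IH _ g'n (gg' _ ga) (gg' _ gb).
case: (winner _ _) => // w; rewrite E.
suff -> : `[< labels (loser (won gamma n) (vtx gamma n)) a >] =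
  `[< labels (loser (won gamma n) (vtx gamma n)) b >] by [].
have H c c' : labels g' c -> labels g' c' -> 
  labels (loser (won gamma n) (vtx gamma n)) c -> labels (loser (won gamma n) (vtx gamma n)) c'.
  move=> c1 c2 c3; rewrite (grouping_eq (order_grouping (hv n) s) _ g'n c3 c1) //.
  exact: rightmost_mem.
by apply/asboolP/asboolP; apply: H; exact: gg'.
Qed.

End Path.

(** * Letters that never win *)

Section Losers.
Variable K : set nat.

Definition losing (g : group) : bool :=
  if g is Single a then `[< K a >] else false.

Arguments losing : simpl never.

(** A group is kept when it is not a single interval with label in [K]. The argument [h] is the kept
    group inherited from further left, so that this function and [kept_before] can be evaluated on
    concatenations. *)
Definition last_kept (h : option group) (l : seq group) : option group :=
  foldl (fun h g => if losing g then h else Some g) h l.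

Fixpoint kept_before (h : option group) (l : seq group) (k : nat) :
    option group :=
  if l is g :: l' then
    if g == Single k then h
    else kept_before (if losing g then h else Some g) l' k
  else h.

Lemma last_kept_cat h l1 l2 :
  last_kept h (l1 ++ l2) = last_kept (last_kept h l1) l2.
Proof. exact: foldl_cat. Qed.

Lemma last_kept_rcons h l g :
  last_kept h (rcons l g) = if losing g then last_kept h l else Some g.
Proof. by rewrite -cats1 last_kept_cat. Qed.

Lemma kept_before_cat h l1 l2 k : kept_before h (l1 ++ l2) k =
  if Single k \in l1 then kept_before h l1 k
  else kept_before (last_kept h l1) l2 k.
Proof.
elim: l1 h => //= g l1 IH h; rewrite inE [Single k == g]eq_sym.
by case: eqP.
Qed.

Lemma kept_before_notin h l k : Single k \notin l ->
  kept_before h l k = last_kept h l.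
Proof.
elim: l h => //= g l IH h; rewrite inE negb_or eq_sym => /andP[/negPf-> /IH].
exact.
Qed.

Lemma last_kept_dep l : all losing l /\ (forall h, last_kept h l = h) \/
  exists2 g, g \in l & forall h, last_kept h l = Some g.
Proof.
elim: l => [|g l [[al IH]|[g' g'l IH]]]; first by left.
- case E : (losing g).
    by left; split=> [|h] /=; rewrite E.
  by right; exists g; [rewrite in_cons eqxx | move=> h /=; rewrite E].
- by right; exists g' => [|h]; rewrite ?in_cons ?g'l ?orbT //=.
Qed.

Lemma kept_before_dep l k : (forall h, kept_before h l k = h) \/
  exists2 g, g \in l & forall h, kept_before h l k = Some g.
Proof.
elim: l => [|g l IH]; first by left.
have [E|nE] := eqVneq g (Single k).
  by left=> h /=; rewrite E eqxx.
case E : (losing g).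
  case: IH => [IH|[g' g'l IH]]; [left=> h|right; exists g' => [|h]];
    by rewrite ?in_cons ?g'l ?orbT //= (negPf nE) E.
right; case: IH => [IH|[g' g'l IH]].
  by exists g => [|h]; rewrite ?in_cons ?eqxx //= (negPf nE) E.
by exists g' => [|h]; rewrite ?in_cons ?g'l ?orbT //= (negPf nE) E.
Qed.

Lemma kept_beforeP h l k g : kept_before h l k = Some g ->
  h = Some g \/ g \in l /\ ~~ losing g.
Proof.
elim: l h => [|g' l IH] h /=; first by left.
case: eqP => _; first by left.
case E : (losing g') => /IH [|[gl gK]]; rewrite ?in_cons ?gl ?orbT; auto.
by move=> [<-]; rewrite eqxx E; right.
Qed.

Lemma last_keptP l g : last_kept None l = Some g -> g \in l /\ ~~ losing g.
Proof.
elim/last_ind: l => //= l g' IH; rewrite last_kept_rcons mem_rcons in_cons.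
case E : (losing g') => h; first by have [-> ->] := IH h; rewrite orbT.
by move: h => [<-]; rewrite eqxx E.
Qed.

Section Bound.
Context {R : realType}.
Implicit Types r : nat -> R.

Definition outer (g : group) : nat :=
  match g with Single a => a | Tail _ e => e 0%N end.

Definition weight r (o : option group) : R :=
  if o is Some g then r (outer g) else 0.

(* [f] bounds the time that the tower over the losing letter [k] spends beyond
   side [s]; the second case occurs while a loss of [k] has not yet been
   followed by a loss of its kept neighbour or of the winner. *)
Definition excess P r s k (f : R) : Prop :=
  f <= weight r (kept_before None (order_on P s) k) \/
  exists w, [/\ rightmost P (opp s) = Single w, ~ K w,
    kept_before None (order_on P s) k = Some (Single w)
    & f <= r w + weight r (last_kept None (order_on P s))].

(** The invariant of the induction along the path: the tower over [k] has a part of height at most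
    [c], dating from the start or from the reveal of [k], and one excess for each side. *)
Definition controlled P r (c : R) : Prop :=
  forall k, K k -> Single k \in order_on P Top ->
  exists f : side -> R, r k <= c + f Top + f Bot /\
    forall s, excess P r s k (f s).

(** As long as no letter of [K] wins, [w] wins every edge from here on: the letters of [q2] lose to
    it in turn, and no tail is revealed. *)
Definition stuck P : Prop :=
  exists s w q1 q2, [/\ rightmost P s = Single w,
    order_on P (opp s) = q1 ++ Single w :: q2, q2 != [::] & all losing q2].

Lemma weight_ge0 r o : (forall j, 0 <= r j) -> 0 <= weight r o.
Proof. by case: o => //= g. Qed.

Lemma weight_le r r' o : (forall j, r j <= r' j) -> weight r o <= weight r' o.
Proof. by case: o => //= g. Qed.

End Bound.

Section Step.
Context {R : realType}.
Variables (P : gperm) (s : side).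
Hypotheses (hP : vertex P) (hQ : vertex (rauzy s P)).
Hypothesis hK : forall a, K a -> winner s P <> Single a.
Hypothesis hstuck : ~ stuck P.
Variables (r : nat -> R) (c : R).
Hypothesis r0 : forall j, 0 <= r j.
Hypothesis rgroup : forall g a b, g \in order_on P Top ->
  labels g a -> labels g b -> r a = r b.
Hypothesis hc : forall d e, winner s P = Tail d e -> r (e 0%N) <= c.
Hypothesis hcon : controlled P r c.

Let Q := rauzy s P.
Let r' := edge_row s P r.

Lemma edge_row_ler j : r j <= r' j.
Proof. exact: edge_row_le. Qed.

(** Column sums do not change, and both pieces of the revealed tail have the column sum of the tail,
    so neighbours keep their weight; the new single interval itself is bounded by [c]. *)
Lemma controlled_tail d e : winner s P = Tail d e -> controlled Q r' c.
Proof.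
move=> E k Kk kQ.
have r'E : r' = r by rewrite /r' /edge_row E.
have [ke|ke] := eqVneq k (e 0%N).
  exists (fun=> 0); rewrite !addr0 r'E ke; split; first exact: hc E.
  by move=> s'; left; exact: weight_ge0.
have [p pE] := rightmost_rcons hP s.
rewrite -/(winner s P) E -cats1 in pE.
have [u _ _] := order_grouping hP s.
have Tin : Tail d e \in order_on P (opp s) by rewrite -E; exact: rightmost_mem.
case/splitPr oE : _ / Tin => [l1 l2].
have kP : Single k \in order_on P Top.
  have : Single k \in order_on Q s by rewrite (order_mem hQ _ Top).
  rewrite (rauzy_tail hP E pE) (order_mem hP _ s) pE !mem_cat.
  case: ifP => _; rewrite !inE /= orbF.
    by case/or3P => [->//|/eqP[kE]|/eqP//]; rewrite kE eqxx in ke.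
  by case/or3P => [->//|/eqP//|/eqP[kE]]; rewrite kE eqxx in ke.
have re : r (e 1%N) = r (e 0%N).
  apply: (@rgroup (Tail d e)) => /=; [|by exists 1%N|by exists 0%N].
  by rewrite -E; exact: (rightmost_mem hP s Top).
(* If [e 0] is losing, the kept piece is the shortened tail, whose outer label [e 1] has the same
   column sum. *)
have wE h s' : weight r (last_kept h (if outermost_left s' d then
     [:: Single (e 0%N); Tail d (fun n => e n.+1)] else
    [:: Tail d (fun n => e n.+1); Single (e 0%N)])) = r (e 0%N).
  by case: ifP => _ //=; case: (losing _).
have kB s' : Single k \in (if outermost_left s' d then
     [:: Single (e 0%N); Tail d (fun n => e n.+1)] else
    [:: Tail d (fun n => e n.+1); Single (e 0%N)]) = false.
  have ka : (Single k == Single (e 0%N)) = false.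
    by apply/eqP => -[kE]; rewrite kE eqxx in ke.
  have kT : (Single k == Tail d (fun n => e n.+1)) = false by apply/eqP.
  by case: ifP => _; rewrite !inE ka kT.
have [f [rf ff]] := hcon Kk kP.
exists f; rewrite r'E; split=> // s'.
have [->|->] : s' = s \/ s' = opp s by case: (s) (s') => -[]; auto.
- have kp : Single k \in p.
    by move: kP; rewrite (order_mem hP _ s) pE mem_cat inE => /orP[//|/eqP].
  have := ff s; rewrite /excess (rauzy_tail hP E pE) pE !kept_before_cat kp.
  case=> [h|[w [h1 h2 h3 h4]]]; [by left|right; exists w; split=> //].
    move: h1; rewrite /rightmost (rauzy_tail hP E oE) oE !last_cat /=.
    by case: (l2) => //= x l; rewrite last_cat.
  by move: h4; rewrite !last_kept_cat /= wE.
- have := ff (opp s); rewrite /excess (rauzy_tail hP E oE) oE !kept_before_cat.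
  rewrite oppK; case=> [h|[w []]]; last by rewrite -/(winner s P) E.
  left; move: h; case: ifP => // kl1.
  rewrite kB /=; case: eqP => // _.
  by have [h|[g gl h]] := kept_before_dep l2 k; rewrite !h //= wE.
Qed.

(** When [k] loses, it lands next to [w] and gains [r w], which puts the excess on the losing side
    into its second form. The loss of a kept group brings it back to the first form: either the
    neighbour of [k] itself loses and its column sum grows by the missing term, or the loser enters
    between [w] and [k], its new column sum being the whole second bound. *)
Lemma controlled_single w : winner s P = Single w -> controlled Q r' c.
Proof.
move=> E k Kk kQ.
have nKw : ~ K w by move=> Kw; exact: hK E.
have nlw : losing (Single w) = false by apply/asboolP.
have r'E j : r' j = r j + (if `[< labels (loser s P) j >] then r w else 0).
  by rewrite /r' /edge_row E.
have [p pE] := rightmost_rcons hP s.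
rewrite -/(winner s P) E in pE.
have [q1 [q2 oE]] := loser_split hP s; rewrite E in oE.
have sE := rauzy_single_same E; have o'E := rauzy_single_opp hP E oE.
have [u _ _] := order_grouping hP (opp s).
have kP : Single k \in order_on P Top.
  by move: kQ; rewrite (order_mem hQ _ s) sE (order_mem hP _ Top).
have kw : Single k != Single w by apply/eqP => -[kE]; rewrite kE in Kk.
have [wq1 wq2 Lq2] : [/\ Single w \notin q1, Single w \notin q2 &
    loser s P \notin q1 ++ q2].
  move: u; rewrite oE -rcons_cons -rcons_cat rcons_uniq cat_uniq /=.
  move=> /andP[+ /and3P[_ /norP[-> _] /andP[-> _]]].
  by rewrite !mem_cat inE !negb_or => /and3P[-> _ ->].
have rw : rightmost P s = Single w by [].
have rw' : rightmost Q s = Single w by rewrite /rightmost sE.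
have [f [rf ff]] := hcon Kk kP.
case lL : (losing (loser s P)).
- have [k0 LE] : exists k0, loser s P = Single k0.
    by case: (loser s P) lL => // k0 _; exists k0.
  have Kk0 : K k0 by move: lL; rewrite LE => /asboolP.
  have exs g : excess P r s k g -> excess Q r' s k g.
    rewrite /excess sE => -[h|[w' [h1 h2 _ _]]].
      by left; apply: (le_trans h); apply: weight_le; exact: edge_row_ler.
    by move: h1; rewrite -/(loser s P) LE => -[h1]; rewrite -h1 in h2.
  have [kk0|kk0] := eqVneq k k0.
  + have Lk : loser s P = Single k by rewrite kk0.
    have r'k : r' k = r k + r w by rewrite r'E Lk /= asboolT.
    have hopp : excess Q r' (opp s) k (f (opp s) + r w).
      right; exists w; rewrite oppK rw' o'E; split=> //.
        rewrite kept_before_cat -Lk; have := Lq2; rewrite mem_cat.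
        case/norP => /negPf -> _; rewrite /= nlw eq_sym Lk (negPf kw).
        by rewrite eqxx.
      rewrite last_kept_cat /= nlw lL addrC lerD ?edge_row_ler //.
      have := ff (opp s); rewrite /excess oE kept_before_cat -Lk.
      have := Lq2; rewrite mem_cat => /norP[/negPf -> Lq2'].
      rewrite /= nlw eq_sym Lk (negPf kw) -cats1 kept_before_cat -Lk.
      rewrite (negPf Lq2') Lk /= eqxx.
      case=> [h|[w' [hw _ h _]]].
        by apply: (le_trans h); apply: weight_le; exact: edge_row_ler.
      (* Here [k] would lose to [w] again with [w] still its kept neighbour; then only losing
         letters stand to the right of [w], and the permutation is stuck. *)
      have [[al _]|[g gq hg]] := last_kept_dep q2; last first.
        move: hw h; rewrite oppK rw hg => -[<-] [gE].
        by move: wq2; rewrite -gE gq.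
      case: hstuck; exists s, w, q1, (rcons q2 (loser s P)); split=> //.
        by case: (q2).
      by rewrite all_rcons lL.
    exists (fun s' => if s' is Top then (if s is Top then f Top else f Top + r w)
       else (if s is Top then f Bot + r w else f Bot)).
    rewrite r'k; split; first by case: (s); lra.
    have := exs _ (ff s).
    by move: hopp; case: (s) => h1 h2; case.
  + exists f; have r'k : r' k = r k.
      by rewrite r'E LE /= asboolF ?addr0 //; apply/eqP.
    rewrite r'k; split=> // s'.
    have [->|->] : s' = s \/ s' = opp s by case: (s) (s') => -[]; auto.
      exact: exs.
    have := ff (opp s); rewrite /excess oppK rw rw' oE o'E !last_kept_cat.
    rewrite !kept_before_cat /= nlw eq_sym (negPf kw) lL last_kept_rcons lL.
    have -> : loser s P == Single k = false.
      by rewrite LE; apply/eqP => -[] /esym/eqP; rewrite (negPf kk0).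
    have -> : kept_before (Some (Single w)) (rcons q2 (loser s P)) k =
        kept_before (Some (Single w)) q2 k.
      rewrite -cats1 kept_before_cat; case: ifP => // kq2.
      rewrite /= LE (_ : (_ == _) = false).
        by rewrite -LE lL kept_before_notin ?kq2.
      by apply/eqP => -[] /esym/eqP; rewrite (negPf kk0).
    case=> [h|[w' [h1 h2 h3 h4]]]; [left|right; exists w'; split=> //].
      by apply: (le_trans h); apply: weight_le; exact: edge_row_ler.
    apply: (le_trans h4); apply: lerD; first exact: edge_row_ler.
    by apply: weight_le; exact: edge_row_ler.
- have kL : ~ labels (loser s P) k.
    move=> lk; suff LE : loser s P = Single k by move: lL; rewrite LE /losing asboolT.
    apply: (@grouping_eq _ _ _ k (order_grouping hP Top)) => //.
    exact: (rightmost_mem hP (opp s) Top).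
  have r'k : r' k = r k by rewrite r'E asboolF // addr0.
  have r'L : r' (outer (loser s P)) = r (outer (loser s P)) + r w.
    rewrite r'E asboolT //.
    by case: (loser s P) => [a|d e] //=; exists 0%N.
  exists f; rewrite r'k; split=> // s'.
  have [->|->] : s' = s \/ s' = opp s by case: (s) (s') => -[]; auto.
  + have := ff s; rewrite /excess sE => -[h|[w' [h1 h2 h3 h4]]]; left.
      by apply: (le_trans h); apply: weight_le; exact: edge_row_ler.
    (* The neighbour [w'] is the loser: its column sum grows by [r w], the weight of the last kept
       group on this side. *)
    move: h1; rewrite -/(loser s P) => h1; rewrite h3 /weight -h1 r'L h1 /=.
    apply: (le_trans h4); rewrite pE last_kept_rcons nlw /=.
    by [].
  + have kqL : Single k \in rcons q2 (loser s P) = (Single k \in q2).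
      rewrite mem_rcons inE; case: eqP => // h; case: kL; rewrite -h //.
    have := ff (opp s); rewrite /excess oppK rw rw' oE o'E.
    rewrite !kept_before_cat; case: ifP => kq1.
      case=> [h|[w' [h1 h2 h3 h4]]]; left.
        by apply: (le_trans h); apply: weight_le; exact: edge_row_ler.
      by have [//|[]] := kept_beforeP h3; move: h1 => [<-]; rewrite (negPf wq1).
    rewrite /= nlw eq_sym (negPf kw) lL.
    have -> : loser s P == Single k = false.
      by apply/eqP => h; apply: kL; rewrite h.
    have kq2 : Single k \in q2.
      move: kP; rewrite (order_mem hP _ (opp s)) oE mem_cat kq1 in_cons.
      by rewrite (negPf kw) kqL.
    rewrite -rcons_cons -rcons_cat last_kept_rcons lL -cats1 kept_before_cat kq2.
    move=> hf; left; move: hf.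
    (* If nothing kept lies between [w] and [k], the loser, now directly to the right of [w],
       replaces [w] as the kept neighbour of [k]. *)
    have [h|[g gq h]] := kept_before_dep q2 k; rewrite !h /= ?r'L.
      case=> [h1|[w' [[<-] h2 _ h4]]]; last by rewrite addrC.
      by apply: (le_trans h1); rewrite lerDr.
    case=> [h1|[w' [[<-] h2 [gE] h4]]].
      by apply: (le_trans h1); exact: edge_row_ler.
    by move: wq2; rewrite -gE gq.
Qed.

End Step.
End Losers.

(** * Stuck permutations *)

Section Stuck.
Variables (K : set nat) (gamma : infinite_path).
Hypothesis hv : forall n, vertex (vtx gamma n).
Hypothesis hs : forall n, vtx gamma n.+1 = rauzy (won gamma n) (vtx gamma n).

(** The competitor of [w] is the last group of [q2], a letter of [K], which may not win. *)
Lemma stuck_winner s q1 w q2 P s' : vertex P -> rightmost P s = Single w ->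
  order_on P (opp s) = q1 ++ Single w :: q2 -> q2 != [::] ->
  all (losing K) q2 -> (forall a, K a -> winner s' P <> Single a) -> s' = s.
Proof.
move=> vP wE oE q20 q2K nK; apply: contrapT => ns.
have s's : s' = opp s by case: (s) (s') ns => -[].
move: nK; rewrite s's /winner /rightmost oE last_cat /=.
case/lastP: q2 q20 q2K {oE} => // q2 g _.
rewrite all_rcons last_rcons => /andP[+ _].
by case: g => [a|//] /asboolP Ka /(_ a Ka).
Qed.

(** The step only rotates [q2]: its last group moves to its front. *)
Lemma stuck_step t : (forall a, K a -> winner (won gamma t) (vtx gamma t) <> Single a) ->
  stuck K (vtx gamma t) -> stuck K (vtx gamma t.+1).
Proof.
move=> nK [s [w [q1 [q2 [wE oE q20 q2K]]]]].
have sE := stuck_winner (hv t) wE oE q20 q2K nK.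
have wE' : winner (won gamma t) (vtx gamma t) = Single w by rewrite sE.
case/lastP: q2 q20 q2K oE => // q2 g _ q2K oE.
have gE : g = loser (won gamma t) (vtx gamma t).
  by rewrite /loser sE /rightmost oE last_cat /= last_rcons.
rewrite gE -sE in oE.
exists s, w, q1, (g :: q2); rewrite hs; split=> //.
- by rewrite /rightmost -sE (rauzy_single_same wE') sE.
- by rewrite -sE (rauzy_single_opp (hv t) wE' oE) gE.
- by move: q2K; rewrite all_rcons.
Qed.

Lemma not_stuck t u N d e : (t <= u < N)%N ->
  (forall v a, (v < N)%N -> K a -> winner (won gamma v) (vtx gamma v) <> Single a) ->
  winner (won gamma u) (vtx gamma u) = Tail d e -> ~ stuck K (vtx gamma t).
Proof.
move=> /andP[tu uN] nK uE st.
have : stuck K (vtx gamma u).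
  elim: u tu uN {uE} => [|u IH]; first by rewrite leqn0 => /eqP<-.
  rewrite leq_eqVlt => /predU1P[<- //|]; rewrite ltnS => tu uN.
  apply: stuck_step; last exact/IH/ltnW.
  by move=> a; apply: nK; exact: ltnW.
move=> [s [w [q1 [q2 [wE oE q20 q2K]]]]].
have := stuck_winner (hv u) wE oE q20 q2K (fun a => @nK u a uN).
by move=> sE; move: uE; rewrite sE /winner wE.
Qed.

End Stuck.

Lemma reveals_ex gamma m n N A T : reveals gamma m n N.+1 A ->
  T \in top_order (vtx gamma m) -> ~~ is_single T ->
  exists2 a, revealed gamma m n T a & A a.
Proof.
move=> h Tin Ts; apply: contrapT => nex; have := h T Tin Ts.
have -> : revealed gamma m n T `&` A = set0.
  by rewrite -subset0 => a [ra Aa]; apply: nex; exists a.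
by rewrite card_le0 => /eqP; rewrite -subset0 => /(_ 0%N); apply.
Qed.

(** * Column sums bounded by those over a set of labels *)

Section Comparison.
Context {R : realType}.
Variables (gamma : infinite_path) (A : set nat) (m n N : nat) (c : R).
Hypothesis hv : forall n, vertex (vtx gamma n).
Hypothesis hs : forall n, vtx gamma n.+1 = rauzy (won gamma n) (vtx gamma n).
Hypothesis hmn : (m <= n)%N.
Hypothesis hK : forall v a, (v < N)%N -> ~ A a ->
  winner (won gamma v) (vtx gamma v) <> Single a.
Hypothesis hrev : reveals gamma n N 1 A.
Let r t := path_row gamma m t (fun=> 1 : R).
Hypothesis hc : forall a, A a -> r n a <= c.

Let r_ge0 t j : 0 <= r t j.
Proof. by apply: path_row_ge0. Qed.

Let tail_le d e a : Tail d e \in order_on (vtx gamma n) Top -> range e a -> r n a <= c.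
Proof.
move=> Tin ea.
(* A revealed label of the tail lies in [A], and all labels of the tail share its column sum. *)
have [b [eb _] Ab] := reveals_ex hrev Tin erefl.
rewrite /r (@path_row1_group R _ hv hs m n Top _ _ _ Tin ea eb).
exact: hc.
Qed.

Lemma revealing_edge : exists u d e, (n <= u < N)%N /\
   winner (won gamma u) (vtx gamma u) = Tail d e.
Proof.
have [d [e Tin]] := exists_tail (hv n) Top.
by have [b [_ [u [d' [e' [uN E _]]]]] _] := reveals_ex hrev Tin erefl; exists u, d', e'.
Qed.

Let c_ge1 : 1 <= c.
Proof.
have [d [e Tin]] := exists_tail (hv n) Top.
apply: le_trans (tail_le Tin (ex_intro2 _ _ 0%N I erefl)).
have := @path_row_mono R gamma m m n (fun=> 1).
by rewrite path_row_id //; apply.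
Qed.

(** No permutation met before time n is stuck, since a tail wins some edge between n and N while
    labels outside [A] never win before N. *)
Lemma controlled_path t : (m <= t <= n)%N -> controlled (~` A) (vtx gamma t) (r t) c.
Proof.
elim: t => [|t IH].
  rewrite leqn0 => /andP[/eqP m0 _] k _ _; exists (fun=> 0); rewrite !addr0.
  by split=> [//|s]; left; exact: weight_ge0.
move=> /andP[+ tn]; rewrite leq_eqVlt => /predU1P[mt|].
  move=> k _ _; exists (fun=> 0); rewrite !addr0.
  split; last by move=> s; left; exact: weight_ge0.
  by rewrite /r path_row_id ?mt.
rewrite ltnS => mt; have {}IH := IH _; rewrite mt ltnW // in IH.
have [u [d [e [/andP[nu uN] uE]]]] := revealing_edge.
have tN : (t < N)%N by lia.
have nst : ~ stuck (~` A) (vtx gamma t).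
  by apply: (@not_stuck _ _ hv hs t u N d e) => //; lia.
rewrite /r path_rowS // hs; have hQ : vertex (rauzy (won gamma t) (vtx gamma t)).
  by rewrite -hs.
have rg g a b : g \in order_on (vtx gamma t) Top -> labels g a -> labels g b ->
  r t a = r t b by exact: path_row1_group.
case E : (winner (won gamma t) (vtx gamma t)) => [w|d' e'].
  exact: (controlled_single (hv t) hQ (fun a => @hK t a tN) nst (r_ge0 t) (IH isT) E).
apply: (controlled_tail (hv t) hQ (r_ge0 t) rg _ (IH isT) E).
move=> d2 e2 E2.
have Tin : Tail d2 e2 \in order_on (vtx gamma t) Top.
  by rewrite -E2; exact: (rightmost_mem (hv t) _ Top).
(* The tail still has labels at time n, where their column sum is at most [c]; column sums never
   decrease. *)
have [e3 e3n e3e] := tail_persists hv hs (ltnW tn) Tin.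
have e3a : labels (Tail d2 e3) (e3 0%N) by exists 0%N.
rewrite (rg _ _ (e3 0%N) Tin) //; last 2 first.
- by exists 0%N.
- exact: e3e.
apply: le_trans (tail_le e3n e3a).
by apply: path_row_mono => //; exact: ltnW.
Qed.

(* One [c] for the initial tower, two for the excess on each side. *)
Lemma path_row1_le a : r n a <= 5 * c.
Proof.
have c1 := c_ge1.
have [Aa|nAa] := pselect (A a); first by apply: (le_trans (hc Aa)); lra.
have [g gn ga] := grouping_ex a (order_grouping (hv n) Top).
case: g gn ga => [b|d e] gn ga; last by apply: (le_trans (tail_le gn ga)); lra.
rewrite /= in ga; rewrite -ga in gn.
have [f [rf ff]] := controlled_path (t := n) ltac:(lia) nAa gn.
have wc s h : h \in order_on (vtx gamma n) s -> ~~ losing (~` A) h ->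
    weight (r n) (Some h) <= c.
  case: h => [b'|d e] hin hA.
    by apply: hc; apply: contrapT => nA; move: hA; rewrite /losing asboolT.
  rewrite (order_mem (hv n) s Top) in hin.
  by apply: (tail_le hin); exists 0%N.
have kc s k : weight (r n) (kept_before (~` A) None (order_on (vtx gamma n) s) k) <= c.
  case E : kept_before => [h|]; last by rewrite /=; lra.
  by have [//|[hin hA]] := kept_beforeP E; exact: (wc s h hin hA).
have lc s : weight (r n) (last_kept (~` A) None (order_on (vtx gamma n) s)) <= c.
  case E : last_kept => [h|]; last by rewrite /=; lra.
  by have [hin hA] := last_keptP E; exact: (wc s h hin hA).
have fc s : f s <= 2 * c.
  have [h|[w [_ wA _ h]]] := ff s; first by have := kc s a; lra.
  have wc' : r n w <= c by apply: hc; exact: contrapT.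
  by have := lc s; lra.
by have := fc Top; have := fc Bot; lra.
Qed.

End Comparison.

(** * Summable sequences *)

Section Sums.
Context {R : realType}.
Implicit Types u v : nat -> R.

Definition summable u := cvgn (series u).

Lemma summable_sum u s : series u @ \oo --> s -> summable u /\ rsum u = s.
Proof. by move=> h; split; [exact: cvgP h | exact: cvg_lim h]. Qed.

Lemma summable_fin u N : (forall j, (N <= j)%N -> u j = 0) ->
  summable u /\ rsum u = \sum_(0 <= j < N) u j.
Proof.
move=> h; apply: summable_sum; apply: cvg_near_cst.
exists N => // n /= Nn; rewrite /series /= (@big_cat_nat _ _ _ N) //=.
have -> : \sum_(N <= i < n) u i = 0.
  by rewrite big_nat_cond big1 // => i /andP[/andP[/h]].
by rewrite addr0.
Qed.

Lemma summable_le u v : (forall j, 0 <= u j <= v j) -> summable v -> summable u.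
Proof.
move=> h; apply: series_le_cvg => n; have /andP[] := h n => //.
exact: le_trans.
Qed.

Lemma summableD u v : summable u -> summable v -> summable (fun j => u j + v j).
Proof. exact: is_cvg_seriesD. Qed.

Lemma summableZ c u : summable u -> summable (fun j => c * u j).
Proof. exact: is_cvg_seriesZ. Qed.

Lemma rsumD u v : summable u -> summable v ->
  rsum (fun j => u j + v j) = rsum u + rsum v.
Proof. by move=> hu hv; rewrite /rsum -[RHS](lim_seriesD hu hv). Qed.

Lemma rsumZ c u : summable u -> rsum (fun j => c * u j) = c * rsum u.
Proof. by move=> hu; rewrite /rsum -[RHS](lim_seriesZ c hu). Qed.

Lemma ler_rsum u v : (forall j, u j <= v j) -> summable u -> summable v ->
  rsum u <= rsum v.
Proof. by move=> h hu hv; apply: lim_series_le. Qed.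

Lemma rsum_ge0 u : (forall j, 0 <= u j) -> summable u -> 0 <= rsum u.
Proof.
move=> h hu; have [s0 r0] := @summable_fin (fun=> 0) 0 (fun _ _ => erefl).
by move: r0; rewrite big_nil => <-; exact: ler_rsum.
Qed.

Lemma partial_sum_le u (s : seq nat) : uniq s -> (forall j, 0 <= u j) ->
  summable u -> \sum_(j <- s) u j <= rsum u.
Proof.
move=> us u0 su; pose f j := if j \in s then u j else 0.
have [N hN] : exists N, forall j, j \in s -> (j < N)%N.
  elim: s {us f} => [|x s [N IH]]; first by exists 0%N.
  by exists (maxn N x.+1) => j; rewrite inE => /predU1P[->|/IH]; lia.
have fN j : (N <= j)%N -> f j = 0.
  by move=> Nj; rewrite /f; case: ifP => // /hN; rewrite ltnNge Nj.
have [sf rf] := summable_fin fN.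
have -> : \sum_(j <- s) u j = rsum f.
  rewrite rf /f -big_mkcond /= -[RHS]big_filter; apply: perm_big.
  apply: uniq_perm => //; first by rewrite filter_uniq // iota_uniq.
  move=> j; rewrite mem_filter mem_index_iota /=.
  by case: (boolP (j \in s)) => //= /hN ->.
by apply: ler_rsum => // j; rewrite /f; case: ifP.
Qed.

Lemma term_le_rsum u i : (forall j, 0 <= u j) -> summable u -> u i <= rsum u.
Proof.
move=> u0 su; have := @partial_sum_le u [:: i] isT u0 su.
by rewrite big_seq1.
Qed.

Lemma rsum_single i c : summable (fun j => if j == i then c else 0) /\
  rsum (fun j => if j == i then c else 0) = c.
Proof.
have h j : (i.+1 <= j)%N -> (if j == i then c else 0) = 0.
  by case: eqP => // ->; rewrite ltnn.
have [s r] := summable_fin h.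
split=> //; rewrite r (@big_cat_nat _ _ _ i) //= big_nat1 eqxx.
rewrite big_nat_cond big1 ?add0r // => j /andP[/andP[_ ji] _].
by case: eqP ji => // ->; rewrite ltnn.
Qed.

Lemma eq_rsum u v : u =1 v -> rsum u = rsum v.
Proof. by move=> /funext ->. Qed.

End Sums.

(** * Path matrices acting on vectors *)

Section Columns.
Context {R : realType}.
Implicit Types (v phi : nat -> R) (P : gperm) (s : side).

(** Columns are taken in the positive cone of l^1 and rows in that of l^oo, so that their pairings
    converge. *)
Definition pos_summable v := (forall j, 0 <= v j) /\ summable v.

Definition bounded phi := (forall j, 0 <= phi j) /\
  exists B, forall j, phi j <= B.

(* The matrix of the edge times the column vector [v]. *)
Definition edge_col s P v : nat -> R :=
  match winner s P with
  | Tail _ _ => v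
  | Single w => fun i => v i +
      (if i == w then rsum (fun l => if `[< labels (loser s P) l >] then v l else 0)
       else 0)
  end.

Lemma pos_summable_mul v phi : pos_summable v -> bounded phi ->
  pos_summable (fun j => phi j * v j).
Proof.
move=> [v0 sv] [p0 [B hB]]; split=> [j|]; first exact: mulr_ge0.
apply: (@summable_le _ _ (fun j => B * v j)); last exact: summableZ.
by move=> j; rewrite mulr_ge0 //= ler_wpM2r.
Qed.

Lemma pos_summable_if (b : nat -> bool) v : pos_summable v ->
  pos_summable (fun j => if b j then v j else 0).
Proof.
move=> [v0 sv]; split=> [j|]; first by case: ifP.
by apply: summable_le sv => j; case: ifP; rewrite ?v0 lexx.
Qed.

Lemma edge_col_summable s P v : pos_summable v -> pos_summable (edge_col s P v).
Proof.
move=> hv; rewrite /edge_col; case: (winner s P) => // w; split=> [j|].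
  have [v0 _] := hv; rewrite addr_ge0 //; case: ifP => // _.
  by have [] := @pos_summable_if (fun l => `[< labels (loser s P) l >]) v hv;
    exact: rsum_ge0.
by set S := rsum _; have [h _] := rsum_single w S; apply: summableD h; case: hv.
Qed.

Lemma edge_row_bounded s P phi : bounded phi -> bounded (edge_row s P phi).
Proof.
move=> [p0 [B hB]]; split; first exact: edge_row_ge0.
exists (B + B) => j; rewrite /edge_row; case: (winner s P) => [w|d e].
  by apply: lerD => //; case: ifP => // _; exact: le_trans (hB j).
by apply: (le_trans (hB j)); rewrite lerDl; exact: le_trans (hB j).
Qed.

(** The matrix differs from the identity at most in the row [w]: when a single interval wins, both
    sides exceed the pairing of [phi] and [v] by [phi w] times the sum of [v] over the losing
    group. *)
Lemma edge_duality s P v phi : pos_summable v -> bounded phi ->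
  rsum (fun j => phi j * edge_col s P v j) = rsum (fun j => edge_row s P phi j * v j).
Proof.
move=> hv hp; rewrite /edge_col /edge_row; case: (winner s P) => // w.
set b := fun j => `[< labels (loser s P) j >].
have hb := pos_summable_if b hv.
set S := rsum (fun l => if b l then v l else 0).
have [s1 r1] := rsum_single w (phi w * S).
transitivity (rsum (fun j => phi j * v j) + phi w * S).
  rewrite -r1 -rsumD //; last by case: (pos_summable_mul hv hp).
  by apply: eq_rsum => j; rewrite mulrDr; case: eqP => [->|] //; rewrite mulr0.
rewrite -rsumZ; last by case: hb.
rewrite -rsumD; first last.
- by apply: summableZ; case: hb.
- by case: (pos_summable_mul hv hp).
by apply: eq_rsum => j; rewrite mulrDl /b; case: ifP => _; rewrite ?mulr0 ?mul0r.
Qed.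

Lemma mul_edge s P v : pos_summable v -> mul_imv (edge_imx R s P) v = edge_col s P v.
Proof.
move=> hv; apply/funext => i; rewrite /mul_imv /edge_imx /edge_col.
have [s1 r1] := rsum_single i (v i).
have iE k : (i == k)%:R * v k = if k == i then v i else 0.
  by rewrite eq_sym; case: eqP => [->|]; rewrite ?mul1r ?mul0r.
case: (winner s P) => [w|d e]; last first.
  by rewrite -r1; apply: eq_rsum => k; exact: iE.
set b := fun j => `[< labels (loser s P) j >].
have [_ hb] := pos_summable_if b hv.
case: (i == w) => /=; last first.
  by rewrite addr0 -r1; apply: eq_rsum => k; rewrite addr0 iE.
rewrite -r1 -rsumD //; apply: eq_rsum => k; rewrite mulrDl iE /b.
by case: `[< _ >]; rewrite ?mul1r ?mul0r.
Qed.

Section Path.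
Variable gamma : infinite_path.

Definition path_col m n v : nat -> R :=
  foldr (fun k => edge_col (won gamma k) (vtx gamma k)) v (index_iota m n).

Lemma path_col_id m n v : (n <= m)%N -> path_col m n v = v.
Proof. by move=> nm; rewrite /path_col /index_iota (eqP nm). Qed.

Lemma index_iota_cons m n : (m < n)%N -> index_iota m n = m :: index_iota m.+1 n.
Proof. by move=> mn; rewrite /index_iota -[(n - m)%N]prednK ?subn_gt0 // subnS. Qed.

Lemma path_colS m n v : (m < n)%N ->
  path_col m n v = edge_col (won gamma m) (vtx gamma m) (path_col m.+1 n v).
Proof. by move=> mn; rewrite /path_col index_iota_cons. Qed.

Lemma path_col_cat m n p v : (m <= n <= p)%N ->
  path_col m p v = path_col m n (path_col n p v).
Proof.
move=> /andP[mn np]; rewrite /path_col -foldr_cat /index_iota.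
have -> : (p - m = (n - m) + (p - n))%N by lia.
by rewrite iotaD subnKC.
Qed.

Lemma path_col_summable m n v : pos_summable v -> pos_summable (path_col m n v).
Proof.
move=> hv; rewrite /path_col; elim: (index_iota m n) => //= k l.
exact: edge_col_summable.
Qed.

Lemma path_row_bounded m n phi : bounded phi -> bounded (path_row gamma m n phi).
Proof.
move=> hp; elim: n => //= n IH; case: ifP => // _.
exact: edge_row_bounded.
Qed.

Lemma path_rowSl m n phi : (m < n)%N -> path_row gamma m n phi =
  path_row gamma m.+1 n (edge_row (won gamma m) (vtx gamma m) phi).
Proof.
move=> mn; rewrite (@path_row_cat R gamma m m.+1 n) ?leqnSn //.
by rewrite path_rowS // (@path_row_id _ gamma m m).
Qed.

Lemma path_duality m n v phi : pos_summable v -> bounded phi ->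
  rsum (fun j => phi j * path_col m n v j) =
  rsum (fun j => path_row gamma m n phi j * v j).
Proof.
(* Columns are peeled at the first edge, so the row stays general and absorbs that edge by
   [path_rowSl]. *)
move=> hv; elim: {n}(n - m)%N {-2}m {-2}n (erefl (n - m)%N) phi => [|k IH] m' n nm phi hp.
  by rewrite path_col_id ?path_row_id //; lia.
rewrite path_colS; last lia.
rewrite edge_duality //; last exact: path_col_summable.
rewrite IH; [|lia|exact: edge_row_bounded].
by rewrite -path_rowSl //; lia.
Qed.

Lemma bounded1 (b : nat -> bool) : bounded (fun j => (b j)%:R : R).
Proof. by split=> [j|]; [rewrite ler0n|exists 1 => j; case: (b j)]. Qed.

Lemma path_col_row m n v i : pos_summable v ->
  path_col m n v i = rsum (fun j => path_row gamma m n (fun j => (j == i)%:R) j * v j).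
Proof.
move=> hv; rewrite -path_duality //; last exact: bounded1.
have [_ r] := rsum_single i (path_col m n v i); rewrite -[LHS]r.
by apply: eq_rsum => j; case: eqP => [->|]; rewrite ?mul1r ?mul0r.
Qed.

(** Evaluating the product on a basis column turns each factor into [edge_col]; duality then gives
    the basis row [i] carried along the path. *)
Lemma path_imxE m n i k : path_imx R gamma m n i k =
  path_row gamma m n (fun j => (j == i)%:R) k.
Proof.
pose e j : R := (j == k)%:R.
have he : pos_summable e.
  split=> [j|]; first by rewrite ler0n.
  have [h _] := rsum_single k (1 : R).
  suff -> : e = (fun j => if j == k then 1 else 0) by [].
  by apply/funext => j; rewrite /e; case: eqP.
transitivity (path_col m n e i).
  rewrite /path_imx /path_col; elim: (index_iota m n) i => [|m' l IH] i /=.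
    by rewrite /id_imx /e.
  rewrite /mul_imx -mul_edge; last first.
    by elim: (l) => //= ? ? h; exact: edge_col_summable.
  by apply: eq_rsum => j; rewrite IH.
rewrite path_col_row //.
have [_ r] := rsum_single k (path_row gamma m n (fun j => (j == i)%:R : R) k).
rewrite -[RHS]r; apply: eq_rsum => j; rewrite /e.
by case: eqP => [->|]; rewrite ?mulr1 ?mulr0.
Qed.

Lemma mul_path m n v : pos_summable v -> mul_imv (path_imx R gamma m n) v = path_col m n v.
Proof.
move=> hv; apply/funext => i; rewrite path_col_row // /mul_imv.
by apply: eq_rsum => k; rewrite path_imxE.
Qed.

End Path.
End Columns.

Section EdgeScale.
Context {R : realType}.

Lemma pos_summableZ (c : R) v : 0 <= c -> pos_summable v -> pos_summable (fun i => c * v i).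
Proof. by move=> c0 [v0 sv]; split=> [i|]; [exact: mulr_ge0 | exact: summableZ]. Qed.

Lemma edge_colZ s P (c : R) v : pos_summable v ->
  edge_col s P (fun i => c * v i) = fun i => c * edge_col s P v i.
Proof.
move=> hv; rewrite /edge_col; case: (winner s P) => // w.
apply/funext => i; rewrite mulrDr; case: eqP => _; last by rewrite mulr0.
rewrite -rsumZ; last by have [] := pos_summable_if (fun l => `[< labels (loser s P) l >]) hv.
by congr (_ + _); apply: eq_rsum => l; case: ifP; rewrite ?mulr0.
Qed.

Lemma path_colZ gamma m n (c : R) v : 0 <= c -> pos_summable v ->
  path_col gamma m n (fun i => c * v i) = fun i => c * path_col gamma m n v i.
Proof.
move=> c0 hv; rewrite /path_col; elim: (index_iota m n) => //= k l ->.
rewrite edge_colZ //; elim: (l) => //= ? ? h; exact: edge_col_summable.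
Qed.

Lemma edge_col_ge s P (v : nat -> R) i : pos_summable v -> v i <= edge_col s P v i.
Proof.
move=> hv; rewrite /edge_col; case: (winner s P) => // w.
rewrite lerDl; case: ifP => // _.
have [h1 h2] := pos_summable_if (fun l => `[< labels (loser s P) l >]) hv.
exact: rsum_ge0.
Qed.

Lemma path_col_ge gamma m n (v : nat -> R) i : pos_summable v ->
  v i <= path_col gamma m n v i.
Proof.
move=> hv; rewrite /path_col; elim: (index_iota m n) => //= k l IH.
apply: (le_trans IH); apply: edge_col_ge.
elim: (l) => //= ? ? h; exact: edge_col_summable.
Qed.

Lemma rsum_path_col_ge gamma m n (v : nat -> R) : pos_summable v ->
  rsum v <= rsum (path_col gamma m n v).
Proof.
move=> hv; apply: ler_rsum => [i||]; first exact: path_col_ge.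
  by case: hv.
by have [] := path_col_summable gamma m n hv.
Qed.

Lemma seq_path_col gamma (lam : nat -> nat -> R) k n :
  (forall k, lam k = edge_col (won gamma k) (vtx gamma k) (lam k.+1)) ->
  (k <= n)%N -> lam k = path_col gamma k n (lam n).
Proof.
move=> h; elim: n => [|n IH]; first by rewrite leqn0 => /eqP->; rewrite path_col_id.
rewrite leq_eqVlt => /predU1P[->|]; first by rewrite path_col_id.
rewrite ltnS => kn; rewrite (IH kn) (@path_col_cat R gamma k n n.+1) ?kn ?leqnSn //.
by rewrite (path_colS _ _ (ltnSn n)) (@path_col_id R _ n.+1) // -h.
Qed.

Lemma rsum_path_col gamma m n (v : nat -> R) : pos_summable v ->
  rsum (path_col gamma m n v) = rsum (fun j => path_row gamma m n (fun=> 1) j * v j).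
Proof.
move=> h; rewrite -path_duality //; last by split=> //; exists 1.
by apply: eq_rsum => j; rewrite mul1r.
Qed.

End EdgeScale.

(** * Contraction *)

Section Algebra.
Context {R : realType}.
Variables (s : seq nat) (M : nat -> nat -> R) (K : R) (r : nat -> R).
Hypothesis M1 : forall i k, i \in s -> 1 <= M i k.
Hypothesis K1 : 1 <= K.
Hypothesis hM : forall i j k l, i \in s -> j \in s ->
  M i k * M j l <= K * (M i l * M j k).
Hypothesis r1 : forall j, 1 <= r j.
Hypothesis rs : forall k, r k <= 5 * \sum_(i <- s) r i.

Definition mix (u : nat -> R) k := \sum_(i <- s) u i * M i k.

(** The row [u] times the matrix with rows [M i] for [i] in [s] and identity rows elsewhere. *)
Definition push (u : nat -> R) k := mix u k + (if k \in s then 0 else u k).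

Lemma mix_ge k : \sum_(i <- s) r i <= mix r k.
Proof.
rewrite big_seq /mix [leRHS]big_seq; apply: ler_sum => i hi.
by rewrite ler_peMr ?M1 //; exact: le_trans (r1 i).
Qed.

Lemma mix_gt0 k : 0 < mix r k.
Proof. by have := mix_ge k; have := rs k; have := r1 k; lra. Qed.

Lemma mix_ratio u k l : (forall i, 0 <= u i) ->
  mix u k * mix r l <= K * (mix u l * mix r k).
Proof.
move=> u0; rewrite /mix !big_distrlr /= mulr_sumr big_seq [leRHS]big_seq.
apply: ler_sum => i hi; rewrite mulr_sumr big_seq [leRHS]big_seq.
apply: ler_sum => j hj; have := hM k l hi hj => h.
rewrite (_ : u i * M i k * (r j * M j l) = (u i * r j) * (M i k * M j l)); last ring.
rewrite (_ : K * _ = (u i * r j) * (K * (M i l * M j k))); last ring.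
by apply: ler_wpM2l => //; rewrite mulr_ge0 // ?u0 //; exact: le_trans (r1 j).
Qed.

(** The ratio bound passes from the entries to their mixtures, and column 0 serves as reference. The
    6 is 1 + 5: a mixture of [r] is at least the sum of [r] over [s], and an unmixed entry at most 5
    times that sum. *)
Lemma push_lower u k : (forall i, 0 <= u i) ->
  mix u 0 / mix r 0 / (6 * K) * push r k <= push u k.
Proof.
move=> u0; have W0 := mix_gt0 0; have Wk := mix_gt0 k.
have K0 : 0 < 6 * K by have := K1; lra.
have U0 : 0 <= mix u 0.
  rewrite /mix big_seq; apply: sumr_ge0 => i hi; apply: mulr_ge0; first exact: u0.
  exact: le_trans (M1 _ hi).
have p6 : push r k <= 6 * mix r k.
  rewrite /push; case: ifP => _; first by lra.
  by have := rs k; have := mix_ge k; lra.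
have pu : mix u k <= push u k.
  by rewrite /push lerDl; case: ifP.
apply: le_trans pu; have := mix_ratio 0 k u0 => h.
have k0 : 0 < K by have := K1; lra.
apply: (@le_trans _ _ (mix u 0 / mix r 0 / (6 * K) * (6 * mix r k))).
  by apply: ler_wpM2l => //; rewrite !divr_ge0 // ltW.
rewrite (_ : _ * _ = mix u 0 * mix r k / (K * mix r 0)); last first.
  by field; rewrite !gt_eqF.
by rewrite ler_pdivrMr ?mulr_gt0 // (le_trans h) // mulrCA.
Qed.

(** The lower bound applies to both gaps, [psi - alpha r] and [beta r - psi]. At column 0 their
    mixtures add up to [(beta - alpha) * mix r 0], so the two gains total [(beta - alpha) / (6 * K)]
    however they are shared. *)
Lemma contraction psi alpha beta : (forall k, alpha * r k <= psi k <= beta * r k) ->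
  exists alpha' beta', beta' - alpha' = (1 - (6 * K)^-1) * (beta - alpha) /\
  forall k, alpha' * push r k <= push psi k <= beta' * push r k.
Proof.
move=> h; pose u i := psi i - alpha * r i; pose w i := beta * r i - psi i.
have u0 i : 0 <= u i by have /andP[] := h i; rewrite /u subr_ge0.
have w0 i : 0 <= w i by have /andP[] := h i; rewrite /w subr_ge0.
have mu k : mix u k = mix psi k - alpha * mix r k.
  rewrite /mix mulr_sumr -sumrB; apply: eq_bigr => i _; rewrite /u; ring.
have mw k : mix w k = beta * mix r k - mix psi k.
  rewrite /mix mulr_sumr -sumrB; apply: eq_bigr => i _; rewrite /w; ring.
have K0 : 6 * K != 0 by have := K1 => ?; rewrite gt_eqF //; lra.
have W0 : mix r 0 != 0 by rewrite gt_eqF // mix_gt0.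
exists (alpha + mix u 0 / mix r 0 / (6 * K)), (beta - mix w 0 / mix r 0 / (6 * K)).
split; first by rewrite mu mw; field; rewrite W0 gt_eqF //; have := K1; lra.
move=> k; have lu := push_lower k u0; have lw := push_lower k w0.
have -> : push psi k = push u k + alpha * push r k.
  by rewrite /push mu; case: ifP => _; rewrite /u; ring.
apply/andP; split; first by rewrite mulrDl addrC lerD2r.
have -> : push u k + alpha * push r k = beta * push r k - push w k.
  by rewrite /push mu mw; case: ifP => _; rewrite /u /w; ring.
by rewrite mulrBl lerD2l lerN2.
Qed.

End Algebra.

(** * Limits of probability vectors *)

Section Limit.
Context {R : realType}.

Lemma dist_lim_le (u : nat -> R) a l e : u @ \oo --> l ->
  (\forall n \near \oo, `|a - u n| <= e) -> `|a - l| <= e.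
Proof.
move=> ul h; apply: (ler_cvg_to _ (cvg_cst e) h).
by apply: cvg_norm; apply: cvgB => //; exact: cvg_cst.
Qed.

Lemma rsum_cvg (u : nat -> R) : summable u -> series u @ \oo --> rsum u.
Proof. by []. Qed.

Variables (x : nat -> nat -> R) (eps : nat -> R).
Hypothesis hx : forall j, pos_summable (x j).
Hypothesis x1 : forall j, rsum (x j) = 1.
Hypothesis eps0 : eps @ \oo --> (0 : R).
Hypothesis close : forall phi, (forall i, 0 <= phi i <= 1) ->
  forall j j', (j <= j')%N ->
  `|rsum (fun i => phi i * x j i) - rsum (fun i => phi i * x j' i)| <= eps j.

Lemma close_term i j j' : (j <= j')%N -> `|x j i - x j' i| <= eps j.
Proof.
move=> jj; have h k : 0 <= ((k == i)%:R : R) <= 1 by case: eqP; rewrite ?ler01 ?lexx.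
have := close h jj.
have E k : rsum (fun i0 => (i0 == i)%:R * x k i0) = x k i.
  have [_ r] := rsum_single i (x k i); rewrite -[RHS]r.
  by apply: eq_rsum => l; case: eqP => [->|]; rewrite ?mul1r ?mul0r.
by rewrite !E.
Qed.

Lemma limit_term i : x^~ i @ \oo --> limn (x^~ i).
Proof.
apply: (iffLR (cauchy_cvgP _)); apply: (iffLR (cauchy_ballP _)).
move=> e e0; have [N _ hN] : \forall n \near \oo, `|eps n| < e / 2.
  by move/cvgrPdist_lt : eps0 => /(_ (e / 2)); rewrite divr_gt0 //;
    move=> /(_ isT); apply: filterS => n; rewrite sub0r normrN.
have eN := hN N (leqnn N).
near_simpl; exists ([set n | (N <= n)%N], [set n | (N <= n)%N]).
  by split; exists N.
move=> [a b] /= [Na Nb]; rewrite /ball /=.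
have h1 := close_term i Na; have h2 := close_term i Nb.
have eN' : eps N < e / 2 by apply: le_lt_trans eN; exact: ler_norm.
rewrite distrC in h1.
have := ler_normD (x a i - x N i) (x N i - x b i).
rewrite addrA subrK => h3; apply: (le_lt_trans h3).
by rewrite [e]splitr ltrD // (le_lt_trans _ eN').
Qed.

Definition limit_vector i := limn (x^~ i).

Lemma limit_vector_ge0 i : 0 <= limit_vector i.
Proof.
apply: (ler_cvg_to (cvg_cst 0) (limit_term (i := i))).
by apply: nearW => j; have [] := hx j.
Qed.

Lemma limit_series phi N :
  (fun j => series (fun i => phi i * x j i) N) @ \oo -->
  series (fun i => phi i * limit_vector i) N.
Proof.
elim: N => [|N IH]; rewrite /series /=.
  by under eq_fun do rewrite big_nil; rewrite big_nil; exact: cvg_cst.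
under eq_fun do rewrite big_nat_recr //=; rewrite big_nat_recr //=.
by apply: cvgD => //; apply: cvgM; [exact: cvg_cst | exact: limit_term].
Qed.

(** Cutting the test row off at [N] leaves a finite sum, whose limit is termwise; as the bound does
    not depend on [N], no mass escapes to infinity. *)
Lemma limit_series_close phi j N : (forall i, 0 <= phi i <= 1) ->
  `|series (fun i => phi i * x j i) N - series (fun i => phi i * limit_vector i) N|
    <= eps j.
Proof.
move=> hp; apply: (dist_lim_le (limit_series (phi := phi) (N := N))).
exists j => // j' /= jj'.
pose psi i := if (i < N)%N then phi i else 0.
have hpsi i : 0 <= psi i <= 1 by rewrite /psi; case: ifP => // _; rewrite lexx ler01.
have E k : rsum (fun i => psi i * x k i) = series (fun i => phi i * x k i) N.
  have h l : (N <= l)%N -> psi l * x k l = 0 by rewrite /psi ltnNge => ->; rewrite mul0r.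
  have [_ ->] := summable_fin h; rewrite /series /=.
  by apply: eq_big_nat => l /andP[_ lN]; rewrite /psi lN.
by rewrite -!E; exact: close.
Qed.

Lemma limit_summable : pos_summable limit_vector.
Proof.
split; first exact: limit_vector_ge0.
apply: nondecreasing_is_cvgn.
  apply: nondecreasing_series => i _ _; exact: limit_vector_ge0.
exists (1 + eps 0%N) => _ [N _ <-].
have h (i : nat) : 0 <= (1 : R) <= 1 by rewrite ler01 lexx.
have := @limit_series_close (fun=> 1) 0 N h.
have -> : (fun i => 1 * limit_vector i) = limit_vector.
  by apply/funext => i; rewrite mul1r.
have -> : (fun i => 1 * x 0%N i) = x 0%N by apply/funext => i; rewrite mul1r.
have := @partial_sum_le R (x 0%N) (index_iota 0 N) (iota_uniq _ _).
move=> /(_ (hx 0%N).1 (hx 0%N).2); rewrite x1 -/(series (x 0%N) N) => h1.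
by rewrite ler_norml /series /= => /andP[h2 _]; clear h; lra.
Qed.

Lemma limit_close phi j : (forall i, 0 <= phi i <= 1) ->
  `|rsum (fun i => phi i * x j i) - rsum (fun i => phi i * limit_vector i)| <= eps j.
Proof.
move=> hp; have bp : bounded phi.
  by split=> [i|]; [|exists 1 => i]; have /andP[] := hp i.
have [_ s1] := pos_summable_mul (hx j) bp.
have [_ s2] := pos_summable_mul limit_summable bp.
have c : (fun N => `|series (fun i => phi i * x j i) N -
    series (fun i => phi i * limit_vector i) N|) @ \oo -->
    `|rsum (fun i => phi i * x j i) - rsum (fun i => phi i * limit_vector i)|.
  by apply: cvg_norm; apply: cvgB; exact: rsum_cvg.
apply: (ler_cvg_to c (cvg_cst (eps j))).
by apply: nearW => N; exact: limit_series_close.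
Qed.

Lemma limit_cvg phi : bounded phi ->
  (fun j => rsum (fun i => phi i * x j i)) @ \oo --> rsum (fun i => phi i * limit_vector i).
Proof.
move=> bp; have [p0 [B hB]] := bp.
(* One more than the bound, to divide by a positive number even if [phi] vanishes. *)
pose b := B + 1; have b0 : 0 < b by rewrite ltr_wpDl // (le_trans (p0 0%N)).
pose psi i := phi i / b.
have hpsi i : 0 <= psi i <= 1.
  rewrite /psi divr_ge0 ?(ltW b0) //= ler_pdivrMr // mul1r (le_trans (hB i)) //.
  by rewrite lerDl.
have E v : pos_summable v -> rsum (fun i => phi i * v i) = b * rsum (fun i => psi i * v i).
  move=> hv; rewrite -rsumZ.
    by apply: eq_rsum => i; rewrite /psi; field; rewrite gt_eqF.
  have bpsi : bounded psi.
    by split=> [i|]; [|exists 1 => i]; have /andP[] := hpsi i.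
  by have [] := pos_summable_mul hv bpsi.
under eq_fun do rewrite E //.
rewrite E; last exact: limit_summable.
apply: cvgM; first exact: cvg_cst.
apply/cvgrPdist_le => e e0.
move/cvgrPdist_le : eps0 => /(_ e e0); apply: filterS => j.
rewrite sub0r normrN => h; rewrite distrC.
by apply: (le_trans (limit_close j hpsi)); apply: le_trans h; exact: ler_norm.
Qed.

Lemma limit_sum : rsum limit_vector = 1.
Proof.
have := @limit_cvg (fun=> 1).
have -> : (fun j => rsum (fun i => 1 * x j i)) = fun=> 1.
  apply/funext => j; transitivity (rsum (x j)); last exact: x1.
  by apply: eq_rsum => i; rewrite mul1r.
have -> : rsum (fun i => 1 * limit_vector i) = rsum limit_vector.
  by apply: eq_rsum => i; rewrite mul1r.
move=> h; have {h} : (fun=> 1 : R) @ \oo --> rsum limit_vector.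
  by apply: h; split=> //; exists 1.
by move=> /(cvg_lim (@Rhausdorff R)) <-; rewrite lim_cst.
Qed.

End Limit.

(** * The order of the intervals *)

Definition within (s : side) (g : group) (c a : nat) : Prop :=
  if g is Tail d e then
    exists i j, [/\ c = e i, a = e j & if outermost_left s d then (i < j)%N else (j < i)%N]
  else False.

Section Order.
Implicit Types (s : side) (P : gperm).

Definition position (l : seq group) (a : nat) : nat :=
  find (fun g => `[< labels g a >]) l.

Lemma precedesE s P c a : precedes s P c a <->
  (position (order_on P s) c < position (order_on P s) a)%N \/
  exists2 g, g \in order_on P s & within s g c a.
Proof.
split=> -[h|]; [by left| |by left|].
  by move=> [d [e [i [j [h1 h2 h3 h4]]]]]; right; exists (Tail d e) => //; exists i, j.
move=> [[b|d e] // gl [i [j [h1 h2 h3]]]]; right.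
by exists d, e, i, j.
Qed.

Lemma position_split l1 g l2 a : grouping (l1 ++ g :: l2) -> labels g a ->
  position (l1 ++ g :: l2) a = size l1.
Proof.
move=> hl ga; rewrite /position find_cat.
have -> : has (fun g => `[< labels g a >]) l1 = false.
  apply/hasP => -[h hl1 /asboolP ha].
  have hE : h = g by apply: (grouping_eq hl _ _ ha ga); rewrite !mem_cat ?hl1 ?inE ?eqxx ?orbT.
  move: hl => [+ _ _]; rewrite cat_uniq /= => /and3P[_ /norP[]].
  by rewrite -hE hl1.
by rewrite /= asboolT // addn0.
Qed.

Lemma position_eq l c a : grouping l -> position l c = position l a ->
  exists2 g, g \in l & labels g c /\ labels g a.
Proof.
move=> hl; have [g gl gc] := grouping_ex c hl; have [h hl' ha] := grouping_ex a hl.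
have [l1 [l2 E]] : exists l1 l2, l = l1 ++ g :: l2.
  by case/splitPr: gl => l1 l2; exists l1, l2.
have pc : position l c = size l1 by rewrite E position_split // -E.
rewrite pc => pa; exists g => //; split=> //.
have hh : has (fun g => `[< labels g a >]) l.
  by apply/hasP; exists h => //; apply/asboolP.
have := nth_find g hh; rewrite -/(position l a) -pa {1}E nth_cat ltnn subnn /=.
by move/asboolP.
Qed.

Lemma within_labels s g c a : within s g c a -> labels g c /\ labels g a.
Proof. by case: g => // d e [i [j [-> -> _]]]; split; [exists i | exists j]. Qed.

Section Vertex.
Variables (P : gperm) (hP : vertex P).

Let hg s := order_grouping hP s.

Lemma precedes_position s c a : precedes s P c a ->
  (position (order_on P s) c <= position (order_on P s) a)%N.
Proof.
move=> /precedesE[|[g gl /within_labels[gc ga]]]; first exact: ltnW.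
move: gl (hg s) => /splitPr[l1 l2] hl.
by rewrite (position_split hl gc) (position_split hl ga).
Qed.

Lemma precedes_irr s a : ~ precedes s P a a.
Proof.
move=> /precedesE[|[g gl]]; first by rewrite ltnn.
case: g gl => // d e Te [i [j [-> eij]]].
have [_ inj _] := hg s; rewrite (inj _ _ Te _ _ eij).
by case: ifP; rewrite ltnn.
Qed.

Lemma precedes_trans s b a c : precedes s P a b -> precedes s P b c -> precedes s P a c.
Proof.
move=> ab bc; have pab := precedes_position ab; have pbc := precedes_position bc.
move: ab bc => /precedesE[h1|[g gl gw]] /precedesE[h2|[g' gl' gw']]; apply/precedesE;
  try (by left; lia).
right; exists g => //.
have [_ gb] := within_labels gw; have [gb' _] := within_labels gw'.
have E := grouping_eq (hg s) gl gl' gb gb'; rewrite -{}E in gw'.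
case: g gl {gl' gb gb'} gw gw' => // d e Te [i [j [-> -> h]]] [i' [k [eji -> h']]].
have [_ inj _] := hg s; exists i, k; split=> //.
by have := inj _ _ Te _ _ eji; move: h h'; case: ifP => _; lia.
Qed.

Lemma precedes_total s c a : c <> a -> precedes s P c a \/ precedes s P a c.
Proof.
move=> ca; have [lt|gt|E] := ltngtP (position (order_on P s) c) (position (order_on P s) a).
- by left; left.
- by right; left.
have [g gl [gc ga]] := position_eq (hg s) E.
case: g gl gc ga => [b|d e] gl; first by move=> /= cb ab; case: ca; rewrite cb ab.
move=> [i _ ec] [j _ ea].
have ij : i != j by apply/eqP => ij; apply: ca; rewrite -ec -ea ij.
have [ol|ol] : outermost_left s d \/ outermost_left s d = false by case: outermost_left; auto.
- have [h|h] : (i < j)%N \/ (j < i)%N by lia.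
  + by left; right; exists d, e, i, j; split=> //; rewrite ol.
  + by right; right; exists d, e, j, i; split=> //; rewrite ol.
- have [h|h] : (i < j)%N \/ (j < i)%N by lia.
  + by right; right; exists d, e, j, i; split=> //; rewrite ol.
  + by left; right; exists d, e, i, j; split=> //; rewrite ol.
Qed.

Lemma precedes_asym s c a : precedes s P c a -> ~ precedes s P a c.
Proof. by move=> h1 h2; apply: (@precedes_irr s c); exact: precedes_trans h2. Qed.

Lemma precedes_tail s d e i j : Tail d e \in order_on P s ->
  (precedes s P (e i) (e j) <-> if outermost_left s d then (i < j)%N else (j < i)%N).
Proof.
move=> LP; have [_ inj _] := hg s; have ie := inj _ _ LP.
split=> [/precedesE[|[g gl gw]]|h]; last first.
- by right; exists d, e, i, j.
- have [ga _] := within_labels gw.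
  have gE : g = Tail d e by apply: (grouping_eq (hg s) gl LP ga); exists i.
  by move: gw; rewrite gE => -[i' [j' [/ie-> /ie->]]].
have [l1 [l2 lE]] : exists l1 l2, order_on P s = l1 ++ Tail d e :: l2.
  by case/splitPr: LP => l1 l2; exists l1, l2.
have hl := hg s; rewrite lE in hl *.
have pE k : position (l1 ++ Tail d e :: l2) (e k) = size l1.
  by apply: position_split => //; exists k.
by rewrite !pE ltnn.
Qed.

End Vertex.

Section Step.
Variables (P : gperm) (s : side).
Hypotheses (hP : vertex P) (hQ : vertex (rauzy s P)).
Let Q := rauzy s P.

Section SingleWinner.
Variable w : nat.
Hypothesis hw : winner s P = Single w.
Let L := loser s P.

Lemma single_precedes_same c a : precedes s Q c a <-> precedes s P c a.
Proof. by rewrite !precedesE (rauzy_single_same hw). Qed.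

Lemma precedes_winner c : c <> w -> precedes s P c w.
Proof.
move=> cw; have [p pE] := rightmost_rcons hP s; have hl := order_grouping hP s.
rewrite -/(winner s P) hw -cats1 in pE; rewrite pE in hl.
apply/precedesE; left; rewrite pE (@position_split _ _ _ w hl) //.
rewrite /position find_cat; case: ifP => [|/negP h]; first by rewrite has_find.
have [g gl gc] := grouping_ex c hl.
case: h; apply/hasP; exists g; last exact/asboolP.
by move: gl; rewrite mem_cat inE => /orP[//|/eqP gE]; case: cw; rewrite gE in gc.
Qed.

Lemma winner_not_precedes a : ~ precedes s P w a.
Proof.
have [->|/eqP aw] := eqVneq a w; first exact: precedes_irr.
exact: (precedes_asym hP (precedes_winner aw)).
Qed.

(** Here [n] is the index of [w] on the losing side and [k] the number of groups between [w] and the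
    loser; these move one place to the right. The order after the move reduces to this
    arithmetic. *)
Lemma loser_positions : exists n k : nat, [/\
  position (order_on P (opp s)) w = n, position (order_on Q (opp s)) w = n,
  forall x, labels L x -> position (order_on P (opp s)) x = (n + k).+1 /\
     position (order_on Q (opp s)) x = n.+1
  & forall x, x <> w -> ~ labels L x ->
     (position (order_on P (opp s)) x < n)%N /\
     position (order_on Q (opp s)) x = position (order_on P (opp s)) x \/
     (n < position (order_on P (opp s)) x <= n + k)%N /\
     position (order_on Q (opp s)) x = (position (order_on P (opp s)) x).+1].
Proof.
have [q1 [q2 oE]] := loser_split hP s; rewrite hw -/L in oE.
have o'E := rauzy_single_opp hP hw oE; rewrite -/L -/Q in o'E.
have hl := order_grouping hP (opp s); have hl' := order_grouping hQ (opp s).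
rewrite -/Q in hl'.
exists (size q1), (size q2); split.
- by move: hl; rewrite oE => hl; rewrite (position_split hl).
- by move: hl'; rewrite o'E => hl'; rewrite (position_split hl').
- move=> x Lx; split.
    move: hl; rewrite oE -rcons_cons -rcons_cat -cats1 => hl.
    by rewrite (position_split hl) // size_cat /= addnS.
  move: hl'; rewrite o'E -cat_rcons => hl'.
  by rewrite (position_split hl') // size_rcons.
move=> x xw xL; have [g gl gx] := grouping_ex x hl.
have : g \in q1 ++ q2.
  move: gl; rewrite oE !mem_cat in_cons mem_rcons in_cons.
  case/or4P=> [->//|/eqP gE|/eqP gE|->]; rewrite ?orbT //.
    by case: xw; rewrite gE in gx.
  by case: xL; rewrite -gE.
rewrite mem_cat => /orP[] /splitPr Eg.
- case: Eg oE o'E => r1 r2 oE o'E; left.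
  rewrite -catA cat_cons in oE; rewrite -catA cat_cons in o'E.
  rewrite oE in hl *; rewrite o'E in hl' *.
  by rewrite (position_split hl gx) (position_split hl' gx) size_cat /=; split=> //; lia.
- case: Eg oE o'E => r1 r2 oE o'E; right.
  rewrite rcons_cat rcons_cons -cat_cons catA in oE.
  rewrite -!cat_cons catA in o'E.
  rewrite oE in hl *; rewrite o'E in hl' *.
  rewrite (position_split hl gx) (position_split hl' gx) !size_cat /=.
  by split; lia.
Qed.

Let within_same c a : (exists2 g, g \in order_on Q (opp s) & within (opp s) g c a) <->
  (exists2 g, g \in order_on P (opp s) & within (opp s) g c a).
Proof.
have m : order_on Q (opp s) =i order_on P (opp s).
  by move=> g; rewrite (order_mem hQ _ s) (rauzy_single_same hw) (order_mem hP _ (opp s)).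
by split=> -[g gl h]; exists g; rewrite // ?m // -m.
Qed.

Let across s' c a : (exists2 g, g \in order_on P s' & within s' g c a) ->
  position (order_on P s') c = position (order_on P s') a.
Proof.
move=> [g gl /within_labels[gc ga]].
move: gl (order_grouping hP s') => /splitPr[l1 l2] hl.
by rewrite (position_split hl gc) (position_split hl ga).
Qed.

Lemma precedes_outside c a : ~ labels L c -> ~ labels L a ->
  (precedes (opp s) Q c a <-> precedes (opp s) P c a).
Proof.
have [n [k [pw qw hL ho]]] := loser_positions.
move=> cL aL; rewrite !precedesE within_same.
suff -> : (position (order_on Q (opp s)) c < position (order_on Q (opp s)) a)%N =
  (position (order_on P (opp s)) c < position (order_on P (opp s)) a)%N by [].
have [cw|cw] := pselect (c = w); have [aw|aw] := pselect (a = w).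
- by rewrite cw aw !ltnn.
- by have := ho a aw aL; rewrite cw pw qw; lia.
- by have := ho c cw cL; rewrite aw pw qw; lia.
- by have := ho a aw aL; have := ho c cw cL; lia.
Qed.

Lemma precedes_inside c a : labels L c -> labels L a ->
  (precedes (opp s) Q c a <-> precedes (opp s) P c a).
Proof.
have [n [k [pw qw hL ho]]] := loser_positions.
move=> /hL[p1 q1] /hL[p2 q2]; rewrite !precedesE within_same.
by rewrite p1 p2 q1 q2 !ltnn.
Qed.

(** The loser was last before the move and stands immediately after [w] afterwards. *)
Lemma loser_precedes_outside c a : labels L c -> ~ labels L a ->
  (precedes (opp s) Q c a <-> precedes (opp s) P w a) /\ ~ precedes (opp s) P c a.
Proof.
have [n [k [pw qw hL ho]]] := loser_positions.
move=> Lc aL; have [p1 q1] := hL _ Lc; split; last first.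
  move=> /(precedes_position hP); rewrite p1.
  have [->|aw] := pselect (a = w); first by rewrite pw; lia.
  by have := ho a aw aL; lia.
rewrite !precedesE within_same.
have [->|aw] := pselect (a = w).
  split=> [[]|/(iffRL (precedesE _ _ _ _)) /(precedes_irr hP) //].
    by rewrite q1 qw; lia.
  by move=> /across; rewrite p1 pw; lia.
split=> -[h|/across h].
- by left; have := ho a aw aL; rewrite pw; lia.
- by have := ho a aw aL; lia.
- by left; have := ho a aw aL; rewrite q1; lia.
- by have := ho a aw aL; lia.
Qed.

Lemma outside_precedes_loser c a : ~ labels L c -> labels L a ->
  (precedes (opp s) Q c a <-> c = w \/ precedes (opp s) P c w) /\
  precedes (opp s) P c a.
Proof.
have [n [k [pw qw hL ho]]] := loser_positions.
move=> cL La; have [p1 q1] := hL _ La; split; last first.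
  apply/precedesE; left; rewrite p1.
  have [->|cw] := pselect (c = w); first by rewrite pw; lia.
  by have := ho c cw cL; lia.
rewrite !precedesE within_same.
have [->|cw] := pselect (c = w).
  by split=> _; [left | left; rewrite qw q1].
split=> [[h|/across h]|[//|[h|/across h]]].
- by right; left; have := ho c cw cL; rewrite pw; lia.
- by have := ho c cw cL; lia.
- by left; have := ho c cw cL; rewrite q1; lia.
- by have := ho c cw cL; lia.
Qed.

End SingleWinner.

(** The revealed label stays on the side of the tail where it was. A comparison with [e 0] that was
    internal to the tail becomes one between groups, with the same outcome. *)
Lemma tail_precedes d e s' c a : winner s P = Tail d e ->
  (precedes s' Q c a <-> precedes s' P c a).
Proof.
move=> hw.
have : Tail d e \in order_on P s' by rewrite -hw; exact: rightmost_mem.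
case/splitPr E : _ / => [l1 l2].
have E' := rauzy_tail hP hw E; rewrite -/Q in E'.
have hl := order_grouping hP s'; have hl' := order_grouping hQ s'; rewrite -/Q in hl'.
have [_ inj _] := hl.
have ie : injective e by apply: (inj d); rewrite E mem_cat inE eqxx orbT.
pose n := size l1; pose b := outermost_left s' d.
(* The tail had index [n]; its two pieces have indices [n] and [n + 1], [e 0] coming first exactly
   when [b] holds. *)
have pT x i : x = e i -> position (order_on P s') x = n /\
    position (order_on Q s') x = (n + (if i is _.+1 then b : nat else ~~ b))%N.
  move=> ->; split.
    by move: hl; rewrite E => hl; rewrite (position_split hl) //; exists i.
  move: hl'; rewrite E' -/b; case: (b); case: i => [|i] /=.
  - by move=> hl'; rewrite (position_split hl') // addn0.
  - rewrite -cat_rcons => hl'; rewrite (position_split hl') ?size_rcons ?addn1 //.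
    by exists i.
  - rewrite -cat_rcons => hl'; rewrite (position_split hl') ?size_rcons ?addn1 //.
  - by move=> hl'; rewrite (position_split hl') ?addn0 //; exists i.
have pO x : ~ range e x ->
   (position (order_on P s') x < n)%N /\
   position (order_on Q s') x = position (order_on P s') x \/
   (n < position (order_on P s') x)%N /\
   position (order_on Q s') x = (position (order_on P s') x).+1.
  move=> xe; have [g gl gx] := grouping_ex x hl.
  have : g \in l1 ++ l2.
    move: gl; rewrite E !mem_cat in_cons => /or3P[->//|/eqP gE|->]; rewrite ?orbT //.
    by case: xe; rewrite gE in gx.
  rewrite mem_cat /n => /orP[] /splitPr Eg.
  + case: Eg E E' => r1 r2 E E'; left.
    rewrite -catA cat_cons in E; rewrite -catA cat_cons in E'.
    rewrite E in hl *; rewrite E' in hl' *.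
    by rewrite (position_split hl gx) (position_split hl' gx) size_cat /=; split=> //; lia.
  + case: Eg E E' => r1 r2 E E'; right.
    rewrite -cat_cons catA in E; rewrite !catA in E'.
    rewrite E in hl *; rewrite E' in hl' *.
    rewrite (position_split hl gx) (position_split hl' gx) !size_cat /=.
    by case: ifP => _ /=; split; lia.
have wT x y i j : x = e i -> y = e j ->
    ((exists2 g, g \in order_on P s' & within s' g x y) <-> if b then (i < j)%N else (j < i)%N).
  move=> -> ->; split=> [[g gl gw]|h].
    have [ga _] := within_labels gw.
    have gE : g = Tail d e.
      apply: (grouping_eq hl gl _ ga); last by exists i.
      by rewrite E mem_cat inE eqxx orbT.
    by move: gw; rewrite gE => -[i' [j' [/ie-> /ie->]]].
  exists (Tail d e); first by rewrite E mem_cat inE eqxx orbT.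
  by exists i, j.
have wT' x y i j : x = e i -> y = e j ->
    ((exists2 g, g \in order_on Q s' & within s' g x y) <->
     [/\ (0 < i)%N, (0 < j)%N & if b then (i < j)%N else (j < i)%N]).
  move=> -> ->; split=> [[g gl gw]|].
    have [ga gb] := within_labels gw.
    have [i0|i0] := posnP i.
      have gE : g = Single (e 0%N).
        apply: (grouping_eq hl' gl _ ga); last by rewrite i0.
        by rewrite E' !mem_cat; case: ifP; rewrite !inE eqxx ?orbT.
      by rewrite gE in gw.
    have gE : g = Tail d (fun n => e n.+1).
      apply: (grouping_eq hl' gl _ ga); last by exists i.-1; rewrite // prednK.
      by rewrite E' !mem_cat; case: ifP; rewrite !inE eqxx ?orbT.
    move: gw; rewrite gE => -[i' [j' [/ie-> /ie->]]].
    by rewrite -/b; case: (b) => h; split=> //; lia.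
  move=> [i0 j0 h]; exists (Tail d (fun n => e n.+1)).
    by rewrite E' !mem_cat; case: ifP; rewrite !inE eqxx ?orbT.
  exists i.-1, j.-1; rewrite !prednK //; split=> //.
  by rewrite -/b; move: h; case: (b); lia.
have w1 x y : ~ range e x -> ((exists2 g, g \in order_on Q s' & within s' g x y) <->
    (exists2 g, g \in order_on P s' & within s' g x y)).
  move=> xe; split=> -[g gl gw]; have [gx _] := within_labels gw; exists g => //.
    move: gl; rewrite E E' !mem_cat inE => /or3P[->//| |->]; rewrite ?orbT //.
    case: ifP => _; rewrite !inE => /orP[] /eqP gE; case: xe; rewrite gE in gx;
      try (by rewrite gx; exists 0%N); by case: gx => i _ <-; exists i.+1.
  move: gl; rewrite E E' !mem_cat inE => /or3P[->//| |->]; rewrite ?orbT //.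
  by move=> /eqP gE; case: xe; rewrite gE in gx.
rewrite !precedesE.
have [[i _ ei]|ce] := pselect (range e c); last first.
  rewrite w1 //.
  have [[j _ ej]|ae] := pselect (range e a).
    have [p q] := pT a j (esym ej).
    suff -> : (position (order_on Q s') c < position (order_on Q s') a)%N =
      (position (order_on P s') c < position (order_on P s') a)%N by [].
    by have := pO c ce; rewrite p q; case: (j) => [|?]; case: (b) => /=; lia.
  suff -> : (position (order_on Q s') c < position (order_on Q s') a)%N =
      (position (order_on P s') c < position (order_on P s') a)%N by [].
  by have := pO c ce; have := pO a ae; lia.
have [p q] := pT c i (esym ei).
have [[j _ ej]|ae] := pselect (range e a).
  rewrite (wT _ _ i j) // (wT' _ _ i j) //.
  have [p' q'] := pT a j (esym ej); rewrite p q p' q' ltnn.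
  case: (b) => /=; case: (i) => [|i']; case: (j) => [|j'] /=;
   split=> -[]; try lia; try (by move=> []; lia); move=> h; try (by left; lia);
   right; try (split; lia); lia.
have nw R' : (exists2 g, g \in order_on R' s' & within s' g c a) -> vertex R' ->
   position (order_on R' s') c = position (order_on R' s') a.
  move=> [g gl /within_labels[gc ga]] hR.
  move: gl (order_grouping hR s') => /splitPr[m1 m2] hm.
  by rewrite (position_split hm gc) (position_split hm ga).
split=> -[h|h].
- left; have := pO a ae; rewrite p q in h *.
  by move: h; case: (i) => [|?]; case: (b) => /=; lia.
- have := nw _ h hQ; have := pO a ae; rewrite q.
  by case: (i) => [|?]; case: (b) => /=; lia.
- left; have := pO a ae; rewrite p q in h *.
  by move: h; case: (i) => [|?]; case: (b) => /=; lia.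
- have := nw _ h hP; have := pO a ae; rewrite p; lia.
Qed.

End Step.
End Order.

(** * Sums over sets of labels *)

Section Part.
Context {R : realType}.
Implicit Types (b : nat -> bool) (u v : nat -> R).

Definition part b v := rsum (fun c => if b c then v c else 0).

Lemma part_mul b v : part b v = rsum (fun c => (b c)%:R * v c).
Proof. by apply: eq_rsum => c; case: (b c); rewrite ?mul1r ?mul0r. Qed.

Lemma part_ge0 b v : pos_summable v -> 0 <= part b v.
Proof. by move=> hv; have [h1 h2] := pos_summable_if b hv; exact: rsum_ge0. Qed.

Lemma part_le b b' v : pos_summable v -> (forall c, b c -> b' c) -> part b v <= part b' v.
Proof.
move=> hv bb'; have [_ s1] := pos_summable_if b hv.
have [_ s2] := pos_summable_if b' hv; apply: ler_rsum => // c.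
have [v0 _] := hv; case: (boolP (b c)) => [/bb' -> //|_].
by case: ifP.
Qed.

Lemma partU b b1 b2 v : pos_summable v ->
  (forall c, b c = b1 c || b2 c) -> (forall c, ~~ (b1 c && b2 c)) ->
  part b v = part b1 v + part b2 v.
Proof.
move=> hv h1 h2; have [_ s1] := pos_summable_if b1 hv.
have [_ s2] := pos_summable_if b2 hv; rewrite /part -rsumD //.
apply: eq_rsum => c; rewrite h1; have := h2 c.
by case: (b1 c); case: (b2 c); rewrite //= ?addr0 ?add0r.
Qed.

Lemma part1 a v : part (fun c => c == a) v = v a.
Proof.
have [_ r] := rsum_single a (v a); rewrite -[RHS]r.
by apply: eq_rsum => c; case: eqP => [->|].
Qed.

Lemma partT v : part (fun=> true) v = rsum v.
Proof. by []. Qed.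

Lemma part0 v : part (fun=> false) v = 0.
Proof.
have [_ r] := @summable_fin R (fun=> 0) 0 (fun _ _ => erefl).
by rewrite /part r big_nil.
Qed.

Lemma eq_part b b' v : b =1 b' -> part b v = part b' v.
Proof. by move=> h; apply: eq_rsum => c; rewrite h. Qed.

Lemma partC b v : pos_summable v -> rsum v = part b v + part (fun c => ~~ b c) v.
Proof. by move=> hv; rewrite -partT; apply: partU => // c; case: (b c). Qed.

(** An injective enumeration eventually leaves each initial segment of [nat], so its far labels lie
    in a small remainder of the series. *)
Lemma part_tail_small (e : nat -> nat) v eps : injective e -> pos_summable v -> 0 < eps ->
  exists n, part (fun c => `[< exists i, (n < i)%N /\ c = e i >]) v < eps.
Proof.
move=> ie hv e0; have [v0 sv] := hv.
have [N _ hN] : \forall n \near \oo, `|rsum v - series v n| < eps.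
  have : series v @ \oo --> rsum v by [].
  by move/cvgrPdist_lt => /(_ _ e0).
have {}hN := hN N (leqnn N).
have [n hn] : exists n, forall i, (n < i)%N -> (N <= e i)%N.
  elim: (N) => [|M [n IH]]; first by exists 0%N.
  have [[k ek]|nk] := pselect (exists k, e k = M); last first.
    exists n => i ni; have := IH i ni; rewrite leq_eqVlt => /predU1P[E|//].
    by case: nk; exists i.
  exists (maxn n k) => i ni; have ni' : (n < i)%N by lia.
  have := IH i ni'; rewrite leq_eqVlt -ek => /predU1P[/ie ki|//].
  by move: ni; rewrite -ki; lia.
exists n; apply: le_lt_trans hN.
apply: (@le_trans _ _ (part (fun c => (N <= c)%N) v)).
  by apply: part_le => // c /asboolP[i [/hn h ->]].
have h c : (N <= c)%N -> (if (c < N)%N then v c else 0) = 0.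
  by rewrite leqNgt => /negPf->.
have [s1 r1] := summable_fin h.
apply: (le_trans _ (ler_norm _)); rewrite lerBrDr.
rewrite (_ : series v N = part (fun c => (c < N)%N) v).
  rewrite (partC (fun c => (N <= c)%N) hv) lerD2l.
  by apply: part_le => // c; rewrite ltnNge.
rewrite /part r1 /series /=; apply: eq_big_nat => c /andP[_ ->] //.
Qed.

End Part.

(** * Positions of the intervals *)

Section Ends.
Context {R : realType}.
Variables (P : gperm) (hP : vertex P).
Implicit Types (s : side) (lam : nat -> R).

Lemma left_endE s lam a : left_end s P lam a = part (fun c => `[< precedes s P c a >]) lam.
Proof. by []. Qed.

Lemma left_end_ge0 s lam a : pos_summable lam -> 0 <= left_end s P lam a.
Proof. exact: part_ge0. Qed.

Lemma left_end_next s lam c a : pos_summable lam -> precedes s P c a ->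
  left_end s P lam c + lam c <= left_end s P lam a.
Proof.
move=> hl ca; rewrite !left_endE -[X in _ + X](part1 c).
rewrite -(@partU _ (fun d => `[< precedes s P d c >] || (d == c))) //.
  apply: part_le => // d /orP[/asboolP dc|/eqP->]; apply/asboolP => //.
  exact: precedes_trans ca.
move=> d; apply/negP => /andP[/asboolP + /eqP E]; rewrite E.
exact: precedes_irr.
Qed.

Lemma left_end_total s lam a : pos_summable lam ->
  left_end s P lam a + lam a <= rsum lam.
Proof.
move=> hl; rewrite left_endE -[X in _ + X](part1 a).
rewrite -(@partU _ (fun d => `[< precedes s P d a >] || (d == a))) //.
  by rewrite -partT; apply: part_le.
move=> d; apply/negP => /andP[/asboolP + /eqP E]; rewrite E.
exact: precedes_irr.
Qed.

End Ends.

Section StepEnds.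
Context {R : realType}.
Implicit Types (lam : nat -> R) (eps : R).
Variables (P : gperm) (s : side).
Hypotheses (hP : vertex P) (hQ : vertex (rauzy s P)).
Let Q := rauzy s P.
Let o := opp s.
Variable v : nat -> R.
Hypothesis hv : pos_summable v.
Let u := edge_col s P v.

Lemma left_end_tail d e s' a : winner s P = Tail d e ->
  left_end s' Q v a = left_end s' P u a.
Proof.
move=> hw; rewrite /u /edge_col hw !left_endE; apply: eq_part => c.
by apply/asboolP/asboolP => /(tail_precedes hP hQ s' c a hw).
Qed.

Lemma part_edge b : part b u = rsum (fun c => edge_row s P (fun c => (b c)%:R) c * v c).
Proof. by rewrite part_mul /u edge_duality //; exact: bounded1. Qed.

Section SingleWinner.
Variable w : nat.
Hypothesis hw : winner s P = Single w.
Let L := loser s P.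
Let inL c := `[< labels L c >].

Let edge_row_bool (b : nat -> bool) c :
  edge_row s P (fun c => (b c)%:R : R) c = (b c)%:R + (inL c && b w)%:R.
Proof. by rewrite /edge_row hw /inL /L; case: `[< _ >]. Qed.

Lemma left_end_winner_side a : left_end s Q v a = left_end s P u a.
Proof.
rewrite !left_endE part_edge part_mul; apply: eq_rsum => c; congr (_ * _).
rewrite edge_row_bool (asboolF (winner_not_precedes hP hw (a := a))) andbF addr0.
congr (_%:R); congr nat_of_bool.
by apply/asboolP/asboolP => /(single_precedes_same hw).
Qed.

Lemma left_end_not_loser a : ~ labels L a -> left_end o Q v a = left_end o P u a.
Proof.
move=> aL; rewrite !left_endE part_edge part_mul; apply: eq_rsum => c; congr (_ * _).
rewrite edge_row_bool /inL; case: (asboolP (labels _ c)) => cL /=; last first.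
  rewrite mulr0n addr0; congr (_%:R); congr nat_of_bool.
  by apply/asboolP/asboolP => /(precedes_outside hP hQ hw cL aL).
have [h1 h2] := loser_precedes_outside hP hQ hw cL aL.
rewrite (asboolF h2) add0r; congr (_%:R); congr nat_of_bool.
by apply/asboolP/asboolP => /h1.
Qed.

(** The losing group moves by the translation taking [w] from side [s] to side [o]. In this additive
    form both sides are linear in [v] and are compared coefficient by coefficient through
    [part_edge]. *)
Lemma left_end_loser a : labels L a ->
  left_end o Q v a + left_end s P u w = left_end o P u w + left_end o P u a.
Proof.
move=> La; rewrite !left_endE !part_edge part_mul.
have hb (b : nat -> bool) : summable (fun c => edge_row s P (fun c => (b c)%:R : R) c * v c).
  by have [] := pos_summable_mul hv (edge_row_bounded s P (bounded1 b)).
rewrite -!rsumD //; last by have [] := pos_summable_mul hv (bounded1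
  (fun c => `[< precedes o Q c a >])).
apply: eq_rsum => c; rewrite !edge_row_bool -!mulrDl; congr (_ * _).
rewrite (asboolF (winner_not_precedes hP hw (a := w))).
rewrite (asboolF (precedes_irr hP (s := o) (a := w))) !andbF !addr0.
have wL := single_label_notin_loser hP hw.
have [_ wa] := outside_precedes_loser hP hQ hw wL La.
rewrite (asboolT wa) andbT /inL; case: (asboolP (labels _ c)) => Lc.
  have cw : c <> w by move=> cw; apply: wL; rewrite -cw.
  have [_ /asboolF ->] := loser_precedes_outside hP hQ hw Lc wL.
  rewrite (asboolT (precedes_winner hP hw cw)) add0r.
  congr (_%:R + _); congr nat_of_bool.
  by apply/asboolP/asboolP => /(precedes_inside hP hQ hw Lc La).
have [h1 /asboolT ->] := outside_precedes_loser hP hQ hw Lc La.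
rewrite /= addr0 -!natrD; congr (_%:R).
have -> : `[< precedes o Q c a >] = (c == w) || `[< precedes o P c w >].
  apply/asboolP/orP => [/h1[->|h]|[/eqP cw|/asboolP h]].
  - by left.
  - by right; apply/asboolP.
  - by apply/h1; left.
  - by apply/h1; right.
have [->|/eqP cw] := eqVneq c w.
  rewrite (asboolF (winner_not_precedes hP hw (a := w))).
  by rewrite (asboolF (precedes_irr hP (s := o) (a := w))).
by rewrite (asboolT (precedes_winner hP hw cw)) /= addnC.
Qed.

Lemma edge_colE c : u c = v c + (if c == w then part inL v else 0).
Proof. by rewrite /u /edge_col hw. Qed.

Lemma edge_col_neq c : c <> w -> u c = v c.
Proof. by move=> /eqP/negPf cw; rewrite edge_colE cw addr0. Qed.

Lemma part_loser : part inL u = part inL v.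
Proof.
apply: eq_rsum => c; case: ifP => // /asboolP Lc; apply: edge_col_neq => cw.
by apply: (single_label_notin_loser hP hw); rewrite -cw.
Qed.

Lemma rsum_edge : rsum u = rsum v + part inL v.
Proof.
rewrite -partT part_edge /part -rsumD; first last.
- by have [] := pos_summable_if inL hv.
- by case: hv.
apply: eq_rsum => c; rewrite edge_row_bool andbT mulrDl mul1r.
by case: (inL c); rewrite ?mul1r ?mul0r.
Qed.

Lemma left_end_winner lam : pos_summable lam ->
  left_end s P lam w + lam w = rsum lam.
Proof.
move=> hl; rewrite left_endE -[X in _ + X](part1 w).
rewrite -(@partU _ (fun=> true)) // => c.
  have [->|/eqP cw] := eqVneq c w; first by rewrite orbT.
  by rewrite (asboolT (precedes_winner hP hw cw)).
apply/negP => /andP[/asboolP + /eqP E]; rewrite E; exact: precedes_irr.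
Qed.

Lemma left_end_loser_start lam a : pos_summable lam -> labels L a ->
  left_end o P lam a = part (fun c => ~~ inL c) lam +
    part (fun c => inL c && `[< precedes o P c a >]) lam.
Proof.
move=> hl La; rewrite left_endE; apply: partU => // c; last by case: (inL c).
rewrite /inL; case: (asboolP (labels _ c)) => //= Lc.
have [_ h] := outside_precedes_loser hP hQ hw Lc La.
by rewrite asboolT.
Qed.

(** A losing tail whose outermost label is on its right has no first interval; far labels of its
    enumeration still start as close as desired to the left end of the group. *)
Lemma loser_start lam eps : pos_summable lam -> 0 < eps ->
  exists2 a, labels L a & left_end o P lam a < part (fun c => ~~ inL c) lam + eps.
Proof.
move=> hl e0.
have -> : (exists2 a, labels L a & left_end o P lam a < part (fun c => ~~ inL c) lam + eps)
   <-> exists2 a, labels L a & part (fun c => inL c && `[< precedes o P c a >]) lam < eps.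
  by split=> -[a La h]; exists a => //; move: h; rewrite left_end_loser_start // ltrD2l.
case E : L => [a|d e].
  exists a => //; rewrite (eq_part (b' := fun=> false)) ?part0 // => c.
  rewrite /inL E; case: (asboolP (labels _ c)) => //= ->; apply: asboolF.
  exact: precedes_irr.
have LP : Tail d e \in order_on P o by rewrite -E; exact: rightmost_mem.
have [_ inj _] := order_grouping hP o; have ie := inj _ _ LP.
have wE i j := precedes_tail hP i j LP.
case ol : (outermost_left o d).
  exists (e 0%N); first by exists 0%N.
  rewrite (eq_part (b' := fun=> false)) ?part0 // => c.
  rewrite /inL E; case: (asboolP (labels _ c)) => //= -[i _ <-]; apply: asboolF.
  by move=> /(wE _ _); rewrite ol.
have [n hn] := part_tail_small ie hl e0; exists (e n); first by exists n.
apply: le_lt_trans hn; apply: part_le => // c /andP[/asboolP]; rewrite E.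
by move=> [i _ <-] /asboolP/(wE _ _); rewrite ol => h; apply/asboolP; exists i.
Qed.

Lemma left_end_le lam s' a b : pos_summable lam ->
  (forall c, precedes s' P c b -> precedes s' P c a \/ c = a) ->
  left_end s' P lam b <= left_end s' P lam a + lam a.
Proof.
move=> hl h; rewrite !left_endE -[X in _ + X](part1 a).
rewrite -(@partU _ (fun d => `[< precedes s' P d a >] || (d == a))) //.
  apply: part_le => // c /asboolP/h[hc|->]; apply/orP; [left|right] => //.
  exact/asboolP.
move=> d; apply/negP => /andP[/asboolP + /eqP E]; rewrite E.
exact: precedes_irr.
Qed.

Lemma rsum_le_left_end lam s' a : pos_summable lam ->
  (forall c, c <> a -> precedes s' P c a) -> rsum lam <= left_end s' P lam a + lam a.
Proof.
move=> hl h; rewrite left_endE -[X in _ + X](part1 a).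
rewrite -(@partU _ (fun d => `[< precedes s' P d a >] || (d == a))) //.
  rewrite -partT; apply: part_le => // c _.
  by have [->|/eqP/h/asboolT->] := eqVneq c a; rewrite ?orbT.
move=> d; apply/negP => /andP[/asboolP + /eqP E]; rewrite E.
exact: precedes_irr.
Qed.

(** The left end of the group is excluded, since the intervals of a tail may accumulate there. *)
Lemma loser_cover lam x : pos_summable lam ->
  part (fun c => ~~ inL c) lam < x -> x < rsum lam ->
  exists2 a, labels L a & left_end o P lam a <= x < left_end o P lam a + lam a.
Proof.
move=> hl x1 x2.
have before c a : ~ labels L c -> labels L a -> precedes o P c a.
  by move=> Lc La; have [] := outside_precedes_loser hP hQ hw Lc La.
have startx a : labels L a -> (forall c, labels L c -> ~ precedes o P c a) ->
    left_end o P lam a <= x.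
  move=> La na; apply: le_trans (ltW x1); rewrite left_end_loser_start //.
  have -> : part (fun c => inL c && `[< precedes o P c a >]) lam = 0.
    rewrite (eq_part (b' := fun=> false)) ?part0 // => c.
    by rewrite /inL; case: (asboolP (labels _ c)) => //= /na /asboolF.
  by rewrite addr0.
case E : L => [b|d e].
  have La : labels L b by rewrite E.
  have LE c : labels L c -> c = b by rewrite E.
  exists b => //; apply/andP; split.
    by apply: startx => // c /LE ->; exact: precedes_irr.
  apply: (lt_le_trans x2); apply: rsum_le_left_end => // c cb.
  by apply: before => // /LE.
have LP : Tail d e \in order_on P o by rewrite -E; exact: rightmost_mem.
have [_ inj _] := order_grouping hP o; have ie := inj _ _ LP.
have wE i j := precedes_tail hP i j LP.
have Le i : labels L (e i) by rewrite E; exists i.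
have LE c : labels L c -> exists i, c = e i by rewrite E => -[i _ <-]; exists i.
case ol : (outermost_left o d).
(* The intervals run from left to right: the first one that ends beyond [x] contains it. *)
- have exn : exists n, x < left_end o P lam (e n) + lam (e n).
    have e0 : 0 < rsum lam - x by rewrite subr_gt0.
    have [n hn] := part_tail_small ie hl e0; exists n.
    rewrite ltrBrDr in hn.
    rewrite -(ltrD2l (part (fun c => `[< exists i, (n < i)%N /\ c = e i >]) lam)).
    apply: (lt_le_trans hn); rewrite left_endE -[X in _ + (_ + X)](part1 (e n)).
    rewrite -(@partU _ (fun c => `[< precedes o P c (e n) >] || (c == e n))) //; last first.
      move=> c; apply/negP => /andP[/asboolP + /eqP ce]; rewrite ce.
      exact: precedes_irr.
    rewrite (partC (fun c => `[< exists i, (n < i)%N /\ c = e i >]) hl) lerD2l.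
    apply: part_le => // c /asboolP nc; apply/orP.
    have [/LE[i ci]|cL] := pselect (labels L c); last first.
      by left; apply/asboolP; exact: before.
    have [lt|gt|eq] := ltngtP i n.
    + by left; apply/asboolP; rewrite ci; apply/wE; rewrite ol.
    + by case: nc; exists i.
    + by right; rewrite ci eq.
  case: (ex_minnP exn) => n hn mn; exists (e n); first by exists n.
  rewrite hn andbT; case: n hn mn => [|m] hn mn.
    apply: startx => // c /LE[i ->] /(wE _ _); by rewrite ol.
  have hm : left_end o P lam (e m) + lam (e m) <= x.
    by rewrite leNgt; apply/negP => /mn; rewrite ltnn.
  apply: le_trans hm; apply: left_end_le => // c.
  have [/LE[i ->]|cL _] := pselect (labels L c); last by left; exact: before.
  move=> /(wE _ _); rewrite ol ltnS leq_eqVlt => /predU1P[->|h]; first by right.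
  by left; apply/wE; rewrite ol.
(* The intervals run from right to left: the first one of the enumeration that starts at or before
   [x] contains it. *)
have exn : exists n, left_end o P lam (e n) <= x.
  have e0 : 0 < x - part (fun c => ~~ inL c) lam by rewrite subr_gt0.
  have [a /LE[n ->] h] := loser_start hl e0; exists n; apply: ltW.
  by apply: (lt_le_trans h); rewrite addrC subrK.
case: (ex_minnP exn) => n hn mn; exists (e n); first by exists n.
rewrite hn /=; case: n hn mn => [|m] hn mn.
  apply: (lt_le_trans x2); apply: rsum_le_left_end => // c ce.
  have [/LE[i ci]|cL] := pselect (labels L c); last exact: before.
  rewrite ci; apply/wE; rewrite ol; case: i ci => [|//] ci.
  by case: ce.
have hm : x < left_end o P lam (e m).
  by rewrite ltNge; apply/negP => /mn; rewrite ltnn.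
apply: (lt_le_trans hm); apply: left_end_le => // c.
have [/LE[i ->]|cL _] := pselect (labels L c); last by left; exact: before.
move=> /(wE _ _); rewrite ol leq_eqVlt => /predU1P[->|h]; first by right.
by left; apply/wE; rewrite ol.
Qed.

End SingleWinner.
End StepEnds.

(** * Distribution functions of invariant measures *)

Section Compatible.
Context {R : realType}.
Implicit Types lam : nat -> R.

(* [F] is the distribution function of an invariant measure giving mass [mu a]
   to the interval of label [a]. *)
Definition compatible (P : gperm) (lam mu : nat -> R) (F : R -> R) : Prop :=
  [/\ forall x y, 0 <= x -> x <= y -> y < rsum lam -> F x <= F y,
      forall x, 0 <= x < rsum lam -> 0 <= F x <= rsum mu,
      forall s a, F (left_end s P lam a) = left_end s P mu a
    & forall s a t, 0 <= t < lam a ->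
        F (left_end s P lam a + t) - F (left_end s P lam a) =
        F (left_end (opp s) P lam a + t) - F (left_end (opp s) P lam a)].

(** The inverse of [edge_col]: a single winner gives back the mass of the losing group, and
    [winner_mass] keeps the result nonnegative. *)
Definition edge_solve s P (mu : nat -> R) : nat -> R :=
  match winner s P with
  | Tail _ _ => mu
  | Single w => fun i => mu i -
      (if i == w then part (fun c => `[< labels (loser s P) c >]) mu else 0)
  end.

Section Step.
Variables (P : gperm) (s : side).
Hypotheses (hP : vertex P) (hQ : vertex (rauzy s P)).
Let Q := rauzy s P.
Let o := opp s.
Variable v : nat -> R.
Hypotheses (hv : pos_summable v) (v_gt0 : forall i, 0 < v i).
Let u := edge_col s P v.

Let hu : pos_summable u.
Proof. exact: edge_col_summable. Qed.

Section SingleWinner.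
Variable w : nat.
Hypothesis hw : winner s P = Single w.
Let L := loser s P.
Let inL c := `[< labels L c >].

Let uE c : u c = v c + (if c == w then part inL v else 0) := edge_colE v hw c.

Let total : rsum u = rsum v + part inL v := rsum_edge hv hw.

Let partv_ge0 : 0 <= part inL v := part_ge0 inL hv.

Let compl : part (fun c => ~~ inL c) u = rsum v.
Proof.
have E1 : part inL u = part inL v := part_loser hP v hw.
have := partC inL hu; rewrite E1 total => h.
by apply: (addrI (part inL v)); rewrite -h addrC.
Qed.

Let u_ge a : v a <= u a.
Proof. by rewrite uE; have := partv_ge0; case: ifP => _; lra. Qed.

Let u_gt0 a : 0 < u a := lt_le_trans (v_gt0 a) (u_ge a).

Let winner_end : left_end s P u w + u w = rsum u := left_end_winner hP hw hu.

Let winner_le : left_end s P u w <= rsum v.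
Proof.
have := winner_end; rewrite total uE eqxx; have := v_gt0 w; lra.
Qed.

Let loser_ge a : labels L a -> rsum v <= left_end o P u a.
Proof.
move=> La; rewrite (left_end_loser_start hP hQ hw hu La) -compl lerDl.
exact: part_ge0.
Qed.

Let loser_end a : left_end o P u a + u a <= rsum u := left_end_total hP o a hu.

Variables (mu : nat -> R) (F : R -> R).
Hypotheses (hmu : pos_summable mu) (hF : compatible P u mu F).

Let F_below x : 0 <= x -> x <= rsum v -> F x <= part (fun c => ~~ inL c) mu.
Proof.
have [F1 F2 F3 F4] := hF; move=> x0 xv; apply/ler_addgt0Pr => e e0.
(* The label is chosen close to the start of the group in mass, not in length; [F] maps the left end
   for the lengths to that for the masses, so monotonicity suffices. *)
have [a La h] := loser_start hP hQ hw hmu e0.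
rewrite -F3 in h; apply: le_trans (ltW h); apply: F1 => //.
  by apply: (le_trans xv); exact: loser_ge.
by apply: lt_le_trans (loser_end a); rewrite ltrDl.
Qed.

(** On side [s] the interval of [w] reaches the right end and starts no later than the losing group
    on side [o]; monotonicity of [F] turns this into an inequality of masses. *)
Lemma winner_mass : part inL mu <= mu w.
Proof.
have [F1 F2 F3 F4] := hF.
have h0 : 0 <= left_end s P u w by exact: left_end_ge0.
have := F_below h0 winner_le; rewrite F3.
by have := left_end_winner hP hw hmu; have := partC inL hmu; lra.
Qed.

Let mu' i := mu i - (if i == w then part inL mu else 0).

Let mu'L : part inL mu' = part inL mu.
Proof.
apply: eq_rsum => c; rewrite /mu'; case: ifP => // /asboolP Lc.
case: eqP => [cw|_]; last by rewrite subr0.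
by case: (single_label_notin_loser hP hw); rewrite -cw.
Qed.

Let hmu' : pos_summable mu'.
Proof.
have [mu0 smu] := hmu; split=> [j|].
  rewrite /mu'; case: eqP => [->|_]; last by rewrite subr0.
  by rewrite subr_ge0 winner_mass.
apply: summable_le smu => j; rewrite /mu'; case: eqP => [->|_].
  by rewrite subr_ge0 winner_mass /= lerBlDr lerDl part_ge0.
by rewrite subr0 mu0 lexx.
Qed.

Let mu'_edge : edge_col s P mu' = mu.
Proof.
apply/funext => i; rewrite (edge_colE _ hw) -/inL mu'L /mu'.
by case: eqP => _; rewrite ?subr0 ?addr0 ?subrK.
Qed.

Let total' : rsum mu' = part (fun c => ~~ inL c) mu.
Proof.
have := rsum_edge hmu' hw; rewrite mu'_edge -/inL mu'L.
have := partC inL hmu; lra.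
Qed.

Let same_winner a lam : pos_summable lam ->
  left_end s Q lam a = left_end s P (edge_col s P lam) a.
Proof. by move=> h; exact: (left_end_winner_side hP h hw). Qed.

Let same_loser a lam : pos_summable lam -> ~ labels L a ->
  left_end o Q lam a = left_end o P (edge_col s P lam) a.
Proof. by move=> h; exact: (left_end_not_loser hP hQ h hw). Qed.

Let moved_loser a lam : pos_summable lam -> labels L a ->
  left_end o Q lam a = left_end o P (edge_col s P lam) w +
    (left_end o P (edge_col s P lam) a - left_end s P (edge_col s P lam) w).
Proof.
by move=> h La; have := left_end_loser hP hQ h hw La; rewrite -/o -/Q; lra.
Qed.

(* The step moves the losing group by the translation that carries the interval
   of the winner on side [s] onto its interval on side [o]. *)
Let moved_value a t : labels L a -> 0 <= t < u a ->
  F (left_end o Q v a + t) =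
  left_end o P mu w + (F (left_end o P u a + t) - left_end s P mu w).
Proof.
have [F1 F2 F3 F4] := hF.
move=> La /andP[t0 ta]; rewrite moved_loser // -/u.
have E : left_end o P u a + t = left_end s P u w + (left_end o P u a - left_end s P u w + t).
  by ring.
rewrite -addrA [in RHS]E -F3 -(F3 s w).
have h : 0 <= left_end o P u a - left_end s P u w + t < u w.
  have := loser_ge La; have := loser_end a; have := winner_end; have := winner_le.
  move: t0 ta; lra.
have := F4 s w _ h; rewrite -/o; lra.
Qed.

Lemma compatible_single :
  [/\ pos_summable mu', edge_col s P mu' = mu & compatible Q v mu' F].
Proof.
have [F1 F2 F3 F4] := hF.
have vu : rsum v <= rsum u by rewrite total; have := partv_ge0; lra.
have wL := single_label_notin_loser hP hw.
split=> //; split.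
- by move=> x y x0 xy yv; apply: F1 => //; exact: lt_le_trans vu.
- move=> x /andP[x0 xv].
  have /andP[-> _] : 0 <= F x <= rsum mu by apply: F2; rewrite x0 (lt_le_trans xv).
  by rewrite total' F_below // ltW.
- move=> s' a; have [->|->] : s' = s \/ s' = o by rewrite /o; case: (s) (s') => -[]; auto.
    by rewrite !same_winner // F3 mu'_edge.
  have [La|La] := pselect (labels L a); last by rewrite !same_loser // F3 mu'_edge.
  have := @moved_value a 0 La; rewrite addr0 lexx u_gt0 => -> //.
  by rewrite addr0 F3 [RHS]moved_loser // mu'_edge.
suff H a t : 0 <= t < v a -> F (left_end s Q v a + t) - F (left_end s Q v a) =
     F (left_end o Q v a + t) - F (left_end o Q v a).
  move=> s' a t h; have [->|->] : s' = s \/ s' = o by rewrite /o; case: (s) (s') => -[]; auto.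
    exact: H.
  by rewrite /o oppK; apply/esym; exact: H.
move=> /andP[t0 ta]; rewrite same_winner // -/u.
have h : 0 <= t < u a by rewrite t0 (lt_le_trans ta).
have [La|La] := pselect (labels L a); last by rewrite same_loser // -/u F4.
have := @moved_value a 0 La; rewrite addr0 lexx u_gt0 => -> //.
by rewrite moved_value // F4 // addr0 -/o; ring.
Qed.

End SingleWinner.

(** The same [F] serves at every stage: inducing restricts it to a shorter interval and updates the
    lengths and masses. *)
Lemma compatible_step mu F : pos_summable mu -> compatible P u mu F ->
  [/\ pos_summable (edge_solve s P mu), edge_col s P (edge_solve s P mu) = mu
    & compatible Q v (edge_solve s P mu) F].
Proof.
move=> hmu hF; rewrite /edge_solve; case E : (winner s P) => [w|d e].
  exact: (compatible_single E hmu hF).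
have uv : u = v by rewrite /u /edge_col E.
have muE : edge_col s P mu = mu by rewrite /edge_col E.
have lE lam s' a : left_end s' Q lam a = left_end s' P lam a.
  by rewrite (left_end_tail hP hQ lam s' a E) /edge_col E.
split=> //; move: hF; rewrite uv => -[F1 F2 F3 F4]; split=> //.
  by move=> s' a; rewrite !lE.
by move=> s' a t h; rewrite !lE F4.
Qed.

Lemma compatible_dist F eps : compatible P u u F ->
  (forall x, 0 <= x < rsum v -> `|F x - x| <= eps) ->
  forall x, 0 <= x < rsum u -> `|F x - x| <= eps.
Proof.
move=> [F1 F2 F3 F4] h x /andP[x0 xu].
case E : (winner s P) => [w|d e]; last first.
  by apply: h; rewrite x0; move: xu; rewrite /u /edge_col E.
have [xv|vx] := ltP x (rsum v); first by apply: h; rewrite x0.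
pose inL c := `[< labels (loser s P) c >].
have total : rsum u = rsum v + part inL v := rsum_edge hv E.
have compl : part (fun c => ~~ inL c) u = rsum v.
  have E1 : part inL u = part inL v := part_loser hP v E.
  have := partC inL hu; rewrite E1 total => h'.
  by apply: (addrI (part inL v)); rewrite -h' addrC.
have uv a : labels (loser s P) a -> a <> w.
  by move=> La aw; apply: (single_label_notin_loser hP E); rewrite -aw.
have wend : left_end s P u w + u w = rsum u := left_end_winner hP E hu.
have wE : u w = v w + part inL v by rewrite /u (edge_colE v E) eqxx.
move: vx; rewrite le_eqVlt => /predU1P[xv|vx]; last first.
  have vx' : part (fun c => ~~ inL c) u < x by rewrite compl.
  have [a La /andP[ax xa]] := loser_cover hP hQ E hu vx' xu.
  (* The point [x] is moved to the same offset in the interval of [a] on side [s]. That interval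
     ends before the one of [w] begins, hence below [rsum v], and [F - id] takes the same value
     there because [F] fixes the left ends. *)
  pose t := x - left_end o P u a.
  have ht : 0 <= t < u a by rewrite /t; lra.
  have xE : x = left_end o P u a + t by rewrite /t; ring.
  have := F4 s a t ht; rewrite -/o !F3 -xE => Fx.
  have aw := left_end_next hP hu (precedes_winner hP E (uv _ La)).
  have yv : 0 <= left_end s P u a + t < rsum v.
    have h0 : 0 <= left_end s P u a by exact: left_end_ge0.
    have := v_gt0 w.
    by move: ht; lra.
  have := h _ yv; rewrite (_ : F (left_end s P u a + t) - _ = F x - x) //.
  have : F (left_end s P u a + t) - left_end s P u a = F x - left_end o P u a by [].
  rewrite {3}xE; lra.
(* The remaining point [rsum v] may be an accumulation point of losing intervals. The value of [F]
   there is squeezed between its value at a point [y] just below and at the start of a losing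
   interval close by. *)
rewrite -xv; apply/ler_addgt0Pr => e e0; rewrite ler_norml.
have Fle : F (rsum v) <= rsum v + e.
  have [a La ha] := loser_start hP hQ E hu e0; rewrite compl in ha.
  apply: le_trans (ltW ha); rewrite -(F3 o a); apply: F1.
  - by rewrite xv.
  - rewrite (left_end_loser_start hP hQ E hu La) compl lerDl; exact: part_ge0.
  apply: lt_le_trans (left_end_total hP o a hu); rewrite ltrDl.
  by apply: (lt_le_trans (v_gt0 a)); exact: edge_col_ge.
have eps0 : 0 <= eps.
  apply: (le_trans (normr_ge0 (F 0 - 0))); apply: h; rewrite lexx /=.
  apply: (lt_le_trans (v_gt0 w)); apply: term_le_rsum; by case: hv.
have v0 : 0 < rsum v.
  apply: (lt_le_trans (v_gt0 w)); apply: term_le_rsum; by case: hv.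
pose y := Num.max 0 (rsum v - e).
have hy : 0 <= y < rsum v by rewrite /y le_max lexx /= gt_max v0 ltrBlDr ltrDl.
have := h y hy; rewrite ler_norml => /andP[h1 _].
have yy : rsum v - e <= y by rewrite /y le_max lexx orbT.
have Fy : F y <= F (rsum v).
  by apply: F1; [case/andP: hy | case/andP: hy => _ /ltW | rewrite xv].
lra.
Qed.

End Step.
End Compatible.

(** * Contraction along the given factorisation *)

Section Main.
Context {R : realType}.
Variables (gamma : infinite_path) (A : nat -> set nat) (cut : nat -> nat) (C : R).
Hypothesis hv : forall n, vertex (vtx gamma n).
Hypothesis hs : forall n, vtx gamma n.+1 = rauzy (won gamma n) (vtx gamma n).
Hypothesis hAfin : forall n, (1 <= n)%N -> finite_set (A n).
Hypothesis hAinc : forall n, (1 <= n)%N -> A n `<=` A n.+1.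
Hypothesis hAcov : \bigcup_(n in [set n | (1 <= n)%N]) A n = setT.
Hypothesis hcut0 : cut 0%N = 0%N.
Hypothesis hcut : forall n, (cut n < cut n.+1)%N.
Hypothesis hsupp : forall n, (1 <= n)%N ->
  strictly_supported (A n) (path_imx R gamma (cut n.-1) (cut n)).
Hypothesis hrev : forall n, (1 <= n)%N ->
  reveals gamma (cut n.-1) (cut n) n (A n).
Hypothesis hC : (ereal_sup [set diameter (A n) (path_imx R gamma (cut n.-1) (cut n))
             | n in [set n | (1 <= n)%N]] < C%:E)%E.

(** Indices are shifted by one: this is the matrix of factor n + 1, to which [A n.+1] belongs. *)
Let M n := path_imx R gamma (cut n) (cut n.+1).

Lemma sub_A n p : (1 <= n <= p)%N -> A n `<=` A p.
Proof.
move=> /andP[n1]; elim: p => [|p IH]; first by rewrite leqn0 => /eqP->.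
rewrite leq_eqVlt => /predU1P[<- //|]; rewrite ltnS => np.
by apply: subset_trans (IH np) (hAinc _); exact: leq_trans np.
Qed.

Lemma cut_mono n p : (n <= p)%N -> (cut n <= cut p)%N.
Proof.
elim: p => [|p IH]; first by rewrite leqn0 => /eqP->.
rewrite leq_eqVlt => /predU1P[<- //|]; rewrite ltnS => /IH /leq_trans; apply.
exact/ltnW/hcut.
Qed.

Lemma leq_cut n : (n <= cut n)%N.
Proof. by elim: n => // n IH; exact: leq_ltn_trans (hcut n). Qed.

(** A win of [a] would create a positive off-diagonal entry in row [a], in a column of the losing
    group, whereas rows outside the support are those of the identity. Since the sets [A] increase,
    all earlier factors are covered too. *)
Lemma outside_never_wins n v a : (v < cut n)%N -> ~ A n a ->
  winner (won gamma v) (vtx gamma v) <> Single a.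
Proof.
move=> vn nA E.
have [j [jv vj jn]] : exists j, [/\ (cut j <= v)%N, (v < cut j.+1)%N & (j < n)%N].
  elim: n vn {nA} => [|n IH]; first by rewrite hcut0.
  have [nv|vn _] := leqP (cut n) v; first by exists n.
  have [j [h1 h2 h3]] := IH vn; exists j; split=> //; exact: ltnW.
have nAj : ~ A j.+1 a by move=> h; apply: nA; apply: (@sub_A j.+1 n) h.
have [sM _] := hsupp (ltn0Sn j).
have [l Ll] := labels_ex (loser (won gamma v) (vtx gamma v)).
have la : l != a.
  by apply/eqP => la; apply: (single_label_notin_loser (hv v) E); rewrite -la.
have := sM a l nAj; rewrite path_imxE /id_imx eq_sym (negPf la) /=.
set phi : nat -> R := fun j => (j == a)%:R.
have phi0 i : 0 <= phi i by rewrite ler0n.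
have h1 : 1 <= path_row gamma (cut j) v phi a.
  have := @path_row_mono R gamma (cut j) (cut j) v phi phi0 jv a.
  by rewrite path_row_id // /phi eqxx.
have h2 : 1 <= path_row gamma (cut j) v.+1 phi l.
  rewrite path_rowS // /edge_row E asboolT //; apply: (le_trans h1).
  by rewrite lerDr; exact: path_row_ge0.
have := @path_row_mono R gamma (cut j) v.+1 (cut j.+1) phi phi0 vj l.
by move=> h3 h4; have := le_trans h2 h3; rewrite h4 ler10.
Qed.

Lemma imx_ge1 n i k : A n.+1 i -> 1 <= M n i k.
Proof.
move=> Ai; have [_ /(_ i k Ai)] := hsupp (ltn0Sn n); rewrite /= -/(M n).
rewrite /M path_imxE.
have [j|a ->] := @path_row_nat R gamma (cut n) (cut n.+1) (fun j => (j == i)%:R) _ k.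
  by exists (j == i : nat).
by rewrite ltr0n -[1]/(1%:R) ler_nat.
Qed.

Lemma imx_ratio n i j k l : A n.+1 i -> A n.+1 j ->
  M n i k * M n j l <= expR C * (M n i l * M n j k).
Proof.
move=> Ai Aj.
have Mil := lt_le_trans ltr01 (imx_ge1 l Ai).
have Mjk := lt_le_trans ltr01 (imx_ge1 k Aj).
have Mik := lt_le_trans ltr01 (imx_ge1 k Ai).
have Mjl := lt_le_trans ltr01 (imx_ge1 l Aj).
rewrite -ler_pdivrMr ?mulr_gt0 //.
set x := _ / _; have x0 : 0 < x by rewrite divr_gt0 // mulr_gt0.
rewrite -ler_ln ?posrE ?expR_gt0 // expRK.
rewrite -lee_fin -lne_EFin //.
apply: le_trans (ltW hC).
set d := diameter (A n.+1) (M n).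
apply: (@le_trans _ _ d); last by apply: ereal_sup_ubound; exists n.+1.
rewrite /d /diameter; set S := ereal_sup _.
have xS : (x%:E <= S)%E by apply: ereal_sup_ubound; exists i, j, k, l; split.
rewrite lee_lne // in_itv /= leey andbT ?lee_fin ?ltW //.
by apply: lt_le_trans xS; rewrite lte_fin.
Qed.

Lemma A_seq n : exists2 s : seq nat, uniq s & forall i, i \in s <-> A n.+1 i.
Proof.
have /finite_seqP[s sA] := hAfin (ltn0Sn n).
by exists (undup s); [exact: undup_uniq | move=> i; rewrite mem_undup sA].
Qed.

(** Pairing with the basis column [k] leaves a finite sum, because column [k] of the factor vanishes
    outside [A n.+1] and [k]. *)
Lemma path_row_push n s phi : bounded phi -> uniq s ->
  (forall i, i \in s <-> A n.+1 i) ->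
  path_row gamma (cut n) (cut n.+1) phi = push s (M n) phi.
Proof.
move=> hp us sA; apply/funext => k.
pose e j : R := if j == k then 1 else 0.
have [se re] := rsum_single k (1 : R).
have he : pos_summable e by split=> // j; rewrite /e; case: ifP.
have [_ r] := rsum_single k (path_row gamma (cut n) (cut n.+1) phi k).
rewrite -[LHS]r.
transitivity (rsum (fun j => path_row gamma (cut n) (cut n.+1) phi j * e j)).
  by apply: eq_rsum => j; rewrite /e; case: eqP => [->|]; rewrite ?mulr1 ?mulr0.
rewrite -path_duality //.
have cE j : path_col gamma (cut n) (cut n.+1) e j = M n j k.
  rewrite path_col_row // /M path_imxE.
  have [_ <-] := rsum_single k (path_row gamma (cut n) (cut n.+1) (fun j0 => (j0 == j)%:R : R) k).
  by apply: eq_rsum => i; rewrite /e; case: eqP => [->|]; rewrite ?mulr1 ?mulr0.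
have [sM _] := hsupp (ltn0Sn n).
pose t := if k \in s then s else k :: s.
have ut : uniq t by rewrite /t; case: (boolP (k \in s)) => //= ->.
have [N hN] : exists N, forall j, j \in t -> (j < N)%N.
  elim: (t) => [|x l [N IH]]; first by exists 0%N.
  by exists (maxn N x.+1) => j; rewrite inE => /predU1P[->|/IH]; lia.
have z j : j \notin t -> phi j * path_col gamma (cut n) (cut n.+1) e j = 0.
  move=> jt; rewrite cE /M sM; last first.
    by move=> /sA js; move: jt; rewrite /t; case: ifP => _; rewrite ?inE js ?orbT.
  rewrite /id_imx; case: eqP => [jk|]; last by rewrite mulr0.
  by move: jt; rewrite jk /t; case: (boolP (k \in s)) => [->//|_]; rewrite inE eqxx.
have fN j : (N <= j)%N -> phi j * path_col gamma (cut n) (cut n.+1) e j = 0.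
  by move=> Nj; apply: z; apply/negP => /hN; rewrite ltnNge Nj.
have [_ ->] := summable_fin fN.
transitivity (\sum_(j <- t) phi j * path_col gamma (cut n) (cut n.+1) e j).
  rewrite (bigID [in t]) /= [X in _ + X]big1 ?addr0; last by move=> j /z.
  rewrite -big_filter; apply: perm_big; apply: uniq_perm => //.
    by rewrite filter_uniq // iota_uniq.
  move=> j; rewrite mem_filter mem_index_iota /=.
  by case: (boolP (j \in t)) => //= /hN ->.
rewrite /push /mix /t; case: ifP => ks.
  by rewrite addr0; apply: eq_bigr => j _; rewrite cE.
rewrite big_cons cE addrC; congr (_ + _).
  by apply: eq_bigr => j _; rewrite cE.
rewrite /M sM; last by move=> /sA; rewrite ks.
by rewrite /id_imx eqxx mulr1.
Qed.

(** The maximum provides the bound 1 <= [K] of the contraction, whatever the sign of [C]. *)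
Let K := Num.max 1 (expR C).
Let theta : R := 1 - (6 * K)^-1.

Lemma path_row1_ge1 m n j : 1 <= path_row gamma m n (fun=> 1 : R) j.
Proof.
have [nm|mn] := leqP n m; first by rewrite path_row_id.
have := @path_row_mono R gamma m m n (fun=> 1) (fun=> ler01) (ltnW mn) j.
by rewrite path_row_id.
Qed.

Lemma contract_step m n phi alpha beta : (m <= cut n)%N -> bounded phi ->
  (forall k, alpha * path_row gamma m (cut n) (fun=> 1) k <=
     path_row gamma m (cut n) phi k <=
     beta * path_row gamma m (cut n) (fun=> 1) k) ->
  exists alpha' beta', beta' - alpha' = theta * (beta - alpha) /\
  forall k, alpha' * path_row gamma m (cut n.+1) (fun=> 1) k <=
     path_row gamma m (cut n.+1) phi k <=
     beta' * path_row gamma m (cut n.+1) (fun=> 1) k.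
Proof.
move=> mn hp h; have [s us sA] := A_seq n.
have b1 : bounded (fun=> 1 : R) by split=> //; exists 1.
have cn : (m <= cut n <= cut n.+1)%N by rewrite mn ltnW.
rewrite !(path_row_cat _ _ cn).
rewrite !(@path_row_push n s) //; [|exact: path_row_bounded..].
apply: contraction h.
- by move=> i k /sA; exact: imx_ge1.
- by rewrite /K le_max lexx.
- move=> i j k l /sA iA /sA jA; apply: (le_trans (imx_ratio k l iA jA)).
  have Mil := lt_le_trans ltr01 (imx_ge1 l iA).
  have Mjk := lt_le_trans ltr01 (imx_ge1 k jA).
  apply: ler_wpM2r; first by rewrite mulr_ge0 // ltW.
  by rewrite /K le_max lexx orbT.
- exact: path_row1_ge1.
(* The comparison looks one factor ahead: each tail present at [cut n] has a label of [A n.+1]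
   revealed before [cut n.+1], and labels outside [A n.+1] do not win until then. *)
move=> k; apply: (@path_row1_le R gamma (A n.+1) m (cut n) (cut n.+1)) => //.
- by move=> v a vn; exact: outside_never_wins.
- move=> T TP Ts; apply: card_le_trans (hrev (ltn0Sn n) TP Ts).
  by apply: subset_card_le => i /= /leq_trans; apply.
move=> a /sA as_; rewrite (big_rem a) //= lerDl; apply: sumr_ge0 => i _.
exact: le_trans (path_row1_ge1 _ _ _).
Qed.

Lemma contract_iter m n phi j : (m <= cut n)%N -> (forall i, 0 <= phi i <= 1) ->
  exists alpha beta, beta - alpha = theta ^+ j /\
  forall k, alpha * path_row gamma m (cut (n + j)) (fun=> 1) k <=
     path_row gamma m (cut (n + j)) phi k <=
     beta * path_row gamma m (cut (n + j)) (fun=> 1) k.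
Proof.
move=> mn hp; have p0 i : 0 <= phi i by have /andP[] := hp i.
have p1 i : phi i <= 1 by have /andP[] := hp i.
elim: j => [|j [al [be [E h]]]].
  exists 0, 1; rewrite subr0 expr0 addn0; split=> // k.
  by rewrite mul0r mul1r path_row_ge0 // path_row_le.
have [|//|al' [be' [E' h']]] := @contract_step m (n + j) phi al be _ _ h.
- by apply: (leq_trans mn); apply: cut_mono; rewrite leq_addr.
- by split=> //; exists 1.
by exists al', be'; rewrite addnS exprS -E.
Qed.

Lemma theta_lt1 : 0 <= theta < 1.
Proof.
have K1 : 1 <= K by rewrite /K le_max lexx.
have K0 : 0 < 6 * K by lra.
have i0 : 0 < (6 * K)^-1 by rewrite invr_gt0.
have i1 : (6 * K)^-1 <= 1 by rewrite invf_le1 //; lra.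
by rewrite /theta; lra.
Qed.

Definition average (phi v : nat -> R) := rsum (fun i => phi i * v i) / rsum v.

(** By duality the average is a mean of the quotients of the two rows, weighted by column sums times
    [v]. It lies in the interval given by [contract_iter], whatever the vector [v]. *)
Lemma average_close m n j phi v w : (m <= cut n)%N -> (forall i, 0 <= phi i <= 1) ->
  pos_summable v -> 0 < rsum v -> pos_summable w -> 0 < rsum w ->
  `|average phi (path_col gamma m (cut (n + j)) v) -
    average phi (path_col gamma m (cut (n + j)) w)| <= theta ^+ j.
Proof.
move=> mn hp; have [al [be [E h]]] := contract_iter j mn hp.
have p0 i : 0 <= phi i by have /andP[] := hp i.
have p1 i : phi i <= 1 by have /andP[] := hp i.
have bp : bounded phi by split=> //; exists 1.
have b1 : bounded (fun=> 1 : R) by split=> //; exists 1.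
suff H u : pos_summable u -> 0 < rsum u ->
    al <= average phi (path_col gamma m (cut (n + j)) u) <= be.
  move=> hv' v0 hw w0; rewrite -E ler_norml.
  by have := H _ hv' v0; have := H _ hw w0; lra.
move=> hu u0.
have N : rsum (path_col gamma m (cut (n + j)) u) =
    rsum (fun i => path_row gamma m (cut (n + j)) (fun=> 1) i * u i).
  by rewrite -path_duality //; apply: eq_rsum => i; rewrite mul1r.
have br := path_row_bounded gamma m (cut (n + j)) b1.
have bq := path_row_bounded gamma m (cut (n + j)) bp.
have [q0 sq] := pos_summable_mul hu bq.
have [r0 sr] := pos_summable_mul hu br.
have [u0' su] := hu.
have N0 : 0 < rsum (path_col gamma m (cut (n + j)) u).
  apply: (lt_le_trans u0); rewrite N; apply: ler_rsum => // i.
  by rewrite ler_peMl //; exact: path_row1_ge1.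
rewrite /average ler_pdivlMr // ler_pdivrMr // N path_duality //.
have sZ x : summable (fun i => x * (path_row gamma m (cut (n + j)) (fun=> 1) i * u i)).
  exact: summableZ.
rewrite -!rsumZ //; apply/andP; split; apply: ler_rsum => // i;
  by rewrite mulrA ler_wpM2r //; have /andP[] := h i.
Qed.

Section Directions.

Let edge k := edge_col (R := R) (won gamma k) (vtx gamma k).

Let unit0 (j : nat) : R := if j == 0%N then 1 else 0.

Let unit0_summable : pos_summable unit0.
Proof.
have [s _] := rsum_single 0%N (1 : R).
by split=> // j; rewrite /unit0; case: ifP.
Qed.

Let unit0_sum : rsum unit0 = 1.
Proof. by have [_] := rsum_single 0%N (1 : R). Qed.

(** The final time depends on m + j only, so that [y m j.+1] is the image of [y m.+1 j] under the
    edge m; j whole factors remain after time [cut m], which is at least m. *)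
Let y m j := path_col gamma m (cut (m + j)) unit0.

Let y_summable m j : pos_summable (y m j).
Proof. exact: path_col_summable. Qed.

Let y_sum m j : 1 <= rsum (y m j).
Proof. by rewrite -unit0_sum; exact: rsum_path_col_ge. Qed.

Let x m j i := (rsum (y m j))^-1 * y m j i.

Let ys_gt0 m j : 0 < rsum (y m j) := lt_le_trans ltr01 (y_sum m j).

Let x_summable m j : pos_summable (x m j).
Proof. by apply: pos_summableZ => //; rewrite invr_ge0 ltW. Qed.

Let x_sum m j : rsum (x m j) = 1.
Proof.
have [_ s] := y_summable m j.
by rewrite rsumZ // mulVf // gt_eqF.
Qed.

Let x_average m j phi : (forall i, 0 <= phi i <= 1) ->
  rsum (fun i => phi i * x m j i) = average phi (y m j).
Proof.
move=> hp; have bp : bounded phi.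
  by split=> [i|]; [|exists 1 => i]; have /andP[] := hp i.
have [_ s] := pos_summable_mul (y_summable m j) bp.
rewrite /average mulrC -rsumZ //; apply: eq_rsum => i; rewrite /x; ring.
Qed.

Let theta0 : (fun j => theta ^+ j) @ \oo --> (0 : R).
Proof.
have /andP[h0 h1] := theta_lt1.
have := @cvg_geometric R 1 theta; rewrite ger0_norm // => /(_ h1).
rewrite (_ : geometric 1 theta = (fun j => theta ^+ j)) //.
by apply/funext => j; rewrite /geometric /= mul1r.
Qed.

Let x_close m phi : (forall i, 0 <= phi i <= 1) ->
  forall j j', (j <= j')%N ->
  `|rsum (fun i => phi i * x m j i) - rsum (fun i => phi i * x m j' i)| <= theta ^+ j.
Proof.
move=> hp j j' jj'; rewrite !x_average //.
have -> : y m j' = path_col gamma m (cut (m + j))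
    (path_col gamma (cut (m + j)) (cut (m + j')) unit0).
  rewrite /y -path_col_cat // (leq_trans (leq_addr j m) (leq_cut _)) /=.
  by apply: cut_mono; rewrite leq_add2l.
apply: average_close => //.
- exact: leq_cut.
- by rewrite unit0_sum.
- exact: path_col_summable.
apply: (lt_le_trans ltr01); rewrite -unit0_sum; exact: rsum_path_col_ge.
Qed.

Let p m := limit_vector (x m).

Let p_summable m : pos_summable (p m).
Proof. exact: (limit_summable (x_summable m) (x_sum m) theta0 (x_close m)). Qed.

Let p_sum m : rsum (p m) = 1.
Proof. exact: (limit_sum (x_summable m) (x_sum m) theta0 (x_close m)). Qed.

Let x_cvg m phi : bounded phi ->
  (fun j => rsum (fun i => phi i * x m j i)) @ \oo --> rsum (fun i => phi i * p m i).
Proof. exact: (limit_cvg (x_summable m) (x_sum m) theta0 (x_close m)). Qed.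

Let edge_sum_ge m v : pos_summable v -> rsum v <= rsum (edge m v).
Proof.
move=> hv'; apply: ler_rsum => [i||]; first exact: edge_col_ge.
  by case: hv'.
by have [] := edge_col_summable (won gamma m) (vtx gamma m) hv'.
Qed.

Let x_edge m j i : x m j.+1 i * rsum (edge m (x m.+1 j)) = edge m (x m.+1 j) i.
Proof.
have yE : y m j.+1 = edge m (y m.+1 j).
  rewrite /y path_colS; last by apply: (leq_trans _ (leq_cut _)); lia.
  by rewrite addnS addSn.
have hy := y_summable m.+1 j.
have [_ hs1] := edge_col_summable (won gamma m) (vtx gamma m) hy.
have E : edge m (x m.+1 j) = fun i => (rsum (y m.+1 j))^-1 * edge m (y m.+1 j) i.
  by rewrite /x /edge edge_colZ.
rewrite E rsumZ // /x yE -/(edge m).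
have h : 0 < rsum (edge m (y m.+1 j)).
  by apply: lt_le_trans (edge_sum_ge m hy); exact: ys_gt0.
by field; rewrite !gt_eqF.
Qed.

Let edge_coord m v i : pos_summable v -> edge m v i =
  rsum (fun j => edge_row (won gamma m) (vtx gamma m) (fun j => (j == i)%:R) j * v j).
Proof.
move=> hv'; rewrite -edge_duality //; last exact: bounded1.
have [_ r] := rsum_single i (edge m v i); rewrite -[LHS]r.
by apply: eq_rsum => j; case: eqP => [->|]; rewrite ?mul1r ?mul0r.
Qed.

Let edge_total m v : pos_summable v -> rsum (edge m v) =
  rsum (fun j => edge_row (won gamma m) (vtx gamma m) (fun=> 1) j * v j).
Proof.
move=> hv'; rewrite -edge_duality //; last by split=> //; exists 1.
by apply: eq_rsum => j; rewrite mul1r.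
Qed.

(** Each coordinate and the total of an image are pairings with a bounded row, so both pass to the
    limit by [x_cvg]. *)
Let p_edge m i : p m i * rsum (edge m (p m.+1)) = edge m (p m.+1) i.
Proof.
have b1 : bounded (fun=> 1 : R) by split=> //; exists 1.
have h1 : (fun j => x m j.+1 i) @ \oo --> p m i.
  have := limit_term theta0 (x_close m) (i := i).
  by rewrite -cvg_shiftS.
have h2 : (fun j => rsum (edge m (x m.+1 j))) @ \oo --> rsum (edge m (p m.+1)).
  rewrite edge_total //; under eq_fun do rewrite edge_total //.
  by apply: x_cvg; exact: edge_row_bounded.
have h3 : (fun j => edge m (x m.+1 j) i) @ \oo --> edge m (p m.+1) i.
  rewrite edge_coord //; under eq_fun do rewrite edge_coord //.
  by apply: x_cvg; apply: edge_row_bounded; exact: bounded1.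
have h4 : (fun j => x m j.+1 i * rsum (edge m (x m.+1 j))) @ \oo -->
    p m i * rsum (edge m (p m.+1)) by exact: cvgM.
have E : (fun j => x m j.+1 i * rsum (edge m (x m.+1 j))) =
    (fun j => edge m (x m.+1 j) i) by apply/funext => j; exact: x_edge.
rewrite E in h4.
by rewrite -(cvg_lim (@Rhausdorff R) h4) -(cvg_lim (@Rhausdorff R) h3).
Qed.

Let norms_gt0 m : 0 < rsum (edge m (p m.+1)).
Proof. by apply: lt_le_trans (edge_sum_ge m _); rewrite // p_sum. Qed.

(** The limit directions match along an edge only up to a factor; these cumulated factors make the
    relation exact. *)
Fixpoint rescale k : R :=
  if k is k'.+1 then rescale k' / rsum (edge k' (p k'.+1)) else 1.

Let lam k i := rescale k * p k i.

Lemma rescale_gt0 k : 0 < rescale k.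
Proof. by elim: k => //= k IH; rewrite divr_gt0. Qed.

Let lam_summable k : pos_summable (lam k).
Proof. by apply: pos_summableZ => //; rewrite ltW // rescale_gt0. Qed.

Let lam_edge k : lam k = edge k (lam k.+1).
Proof.
apply/funext => i; rewrite /edge /lam edge_colZ // -/(edge k) -p_edge /=.
by field; rewrite gt_eqF.
Qed.

Let lam_path k n : (k <= n)%N -> lam k = path_col gamma k n (lam n).
Proof. exact: seq_path_col. Qed.

Let lam_sum k : 0 < rsum (lam k).
Proof.
have [_ s] := p_summable k.
by rewrite rsumZ // p_sum mulr1 rescale_gt0.
Qed.

(** Each label belongs to the support of a later factor, whose row at this label has entries at
    least 1, so its weight is at least a later total. *)
Let lam_gt0 k i : 0 < lam k i.
Proof.
have [n Ani kn] : exists2 n, A n.+1 i & (k <= cut n)%N.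
  have : (\bigcup_(n in [set n | (1 <= n)%N]) A n) i by rewrite hAcov.
  move=> [n0 /= n01 An0]; exists (maxn n0 k).
    by apply: (@sub_A n0 (maxn n0 k).+1 _ i An0); rewrite n01; lia.
  by apply: (leq_trans _ (leq_cut _)); lia.
rewrite (lam_path kn); apply: lt_le_trans (path_col_ge _ _ _ _ _) => //.
rewrite (lam_path (ltnW (hcut n))) path_col_row //.
have [l0 sl] := lam_summable (cut n.+1).
apply: (lt_le_trans (lam_sum (cut n.+1))); apply: ler_rsum => // [j|].
  by rewrite ler_peMl // -path_imxE; exact: imx_ge1.
have [] // := pos_summable_mul (lam_summable (cut n.+1))
  (path_row_bounded gamma (cut n) (cut n.+1) (bounded1 (fun j => j == i))).
Qed.

Lemma exists_weights : exists lam : nat -> nat -> R,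
  [/\ forall k, pos_summable (lam k), forall k i, 0 < lam k i,
      forall k, lam k = edge_col (won gamma k) (vtx gamma k) (lam k.+1)
    & rsum (lam 0%N) = 1].
Proof.
exists lam; split=> //; have [_ s] := p_summable 0.
by rewrite rsumZ // p_sum mulr1.
Qed.

(** The preimages may be unrelated for different n. Averages ignore scaling, so each coordinate of
    [a] and [b] is an average over the images, and the two differ by at most [theta ^+ j] for every
    j. *)
Lemma path_images_eq m (u v : nat -> nat -> R) a b :
  (forall n, pos_summable (u n) /\ 0 < rsum (u n)) ->
  (forall n, pos_summable (v n) /\ 0 < rsum (v n)) ->
  rsum a = 1 -> rsum b = 1 ->
  (forall n, (m <= cut n)%N -> exists c, a = fun i => c * path_col gamma m (cut n) (u n) i) ->
  (forall n, (m <= cut n)%N -> exists c, b = fun i => c * path_col gamma m (cut n) (v n) i) ->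
  a = b.
Proof.
move=> hu hv' a1 b1 ha hb; apply/funext => i.
have avg (a' w : nat -> R) c : rsum a' = 1 -> pos_summable w -> a' = (fun i => c * w i) ->
    average (fun j => (j == i)%:R) w = a' i.
  move=> a1' hw E; have [w0 sw] := hw.
  move: a1'; rewrite E rsumZ // => cw.
  have [_ r] := rsum_single i (w i); rewrite /average.
  have -> : rsum (fun j => (j == i)%:R * w j) = w i.
    by rewrite -[RHS]r; apply: eq_rsum => j; case: eqP => [->|]; rewrite ?mul1r ?mul0r.
  have w1 : rsum w != 0.
    by apply/eqP => w1; move: cw; rewrite w1 mulr0 => /eqP; rewrite eq_sym oner_eq0.
  by apply: (mulIf w1); rewrite divfK // mulrAC -[LHS]mul1r -cw; ring.
have le j : `|a i - b i| <= theta ^+ j.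
  have mj : (m <= cut (m + j))%N by exact: leq_trans (leq_addr j m) (leq_cut _).
  have [cu Eu] := ha _ mj; have [cv Ev] := hb _ mj.
  have [hu1 hu2] := hu (m + j)%N; have [hv1 hv2] := hv' (m + j)%N.
  rewrite -(avg a _ cu a1 _ Eu); last exact: path_col_summable.
  rewrite -(avg b _ cv b1 _ Ev); last exact: path_col_summable.
  apply: average_close => // [|k]; first exact: leq_cut.
  by case: eqP; rewrite ?ler01 ?lexx.
apply/eqP; rewrite -subr_eq0 -normr_le0.
apply: (ler_cvg_to (cvg_cst `|a i - b i|) theta0).
exact: nearW.
Qed.

End Directions.

(** * Lengths of the induction intervals and rigidity of distribution functions *)

Section Weights.
Variable lam : nat -> nat -> R.
Hypothesis lam_s : forall k, pos_summable (lam k).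
Hypothesis lam_gt0 : forall k i, 0 < lam k i.
Hypothesis lamE : forall k, lam k = edge_col (won gamma k) (vtx gamma k) (lam k.+1).
Hypothesis lam1 : rsum (lam 0%N) = 1.

Let rsum_lam_gt0 k : 0 < rsum (lam k).
Proof.
by apply: (lt_le_trans (lam_gt0 k 0%N)); apply: term_le_rsum; case: (lam_s k).
Qed.

(** At time [cut n.+1] every column sum is at least the number of labels in [A n.+1], which is at
    least [D] for large n. The lengths weighted by the column sums add up to the initial total 1. *)
Lemma rsum_weights_small D : exists N, D%:R * rsum (lam N) <= 1.
Proof.
have [n hn] : exists n, forall i, (i < D)%N -> A n.+1 i.
  elim: D => [|D [n IH]]; first by exists 0%N.
  have : (\bigcup_(n in [set n | (1 <= n)%N]) A n) D by rewrite hAcov.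
  move=> [n0 /= n01 An0]; exists (maxn n0 n) => i; rewrite ltnS leq_eqVlt => /predU1P[->|iD].
    by apply: (@sub_A n0) => //; lia.
  by apply: (@sub_A n.+1 (maxn n0 n).+1 _ i (IH i iD)); lia.
have [s us sA] := A_seq n.
have b1 : bounded (fun=> 1 : R) by split=> //; exists 1.
exists (cut n.+1); rewrite -[leRHS]lam1 (seq_path_col lamE (leq0n (cut n.+1))).
have [l0 sl] := lam_s (cut n.+1).
rewrite rsum_path_col // -rsumZ //; apply: ler_rsum => [k||].
- apply: ler_wpM2r => //.
  have cn : (0 <= cut n <= cut n.+1)%N by rewrite leq0n ltnW.
  rewrite (path_row_cat _ _ cn).
  apply: (@le_trans _ _ (path_row gamma (cut n) (cut n.+1) (fun=> 1) k)); last first.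
    by apply: path_row_le => i; exact: path_row1_ge1.
  rewrite (path_row_push b1 us sA) /push /mix.
  have D1 : D%:R <= \sum_(i <- s) (1 : R) * path_imx R gamma (cut n) (cut n.+1) i k.
    have -> : D%:R = \sum_(i <- iota 0 D) (1 : R).
      by rewrite big_const_seq count_predT size_iota iter_addr_0.
    apply: (@le_trans _ _ (\sum_(i <- s) (1 : R))).
      rewrite !big_const_seq !count_predT size_iota !iter_addr_0 ler_nat.
      have := @uniq_leq_size _ (iota 0 D) s (iota_uniq 0 D).
      rewrite size_iota; apply=> i; rewrite mem_iota => /andP[_ iD].
      by apply/sA/hn.
    rewrite big_seq [leRHS]big_seq; apply: ler_sum => i /sA iA.
    by rewrite mul1r; exact: imx_ge1.
  by apply: (le_trans D1); rewrite lerDl; case: ifP.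
- exact: summableZ.
by have [] := pos_summable_mul (lam_s (cut n.+1)) (path_row_bounded gamma 0 (cut n.+1) b1).
Qed.

(** No stage of [mu] can vanish, since stage 0 has total 1. At stage k the directions agree by
    contraction, and the factor between the vectors is carried unchanged to stage 0, where both
    totals are 1. *)
Lemma weights_unique (mu : nat -> nat -> R) k :
  (forall k, pos_summable (mu k)) ->
  (forall k, mu k = edge_col (won gamma k) (vtx gamma k) (mu k.+1)) ->
  rsum (mu 0%N) = 1 -> mu k = lam k.
Proof.
move=> mu_s muE mu1.
have mu_gt0 n : 0 < rsum (mu n).
  have [m0 sm] := mu_s n; rewrite lt_neqAle rsum_ge0 // andbT eq_sym.
  apply/eqP => z; have mz j : mu n j = 0.
    by apply/eqP; rewrite eq_le m0 andbT -z; exact: term_le_rsum.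
  move: mu1; rewrite (seq_path_col muE (leq0n n)) rsum_path_col //.
  have -> : (fun j => path_row gamma 0 n (fun=> 1) j * mu n j) = (fun=> 0).
    by apply/funext => j; rewrite mz mulr0.
  have [_ ->] := @summable_fin R (fun=> 0) 0 (fun _ _ => erefl).
  by rewrite big_nil => /eqP; rewrite eq_sym oner_eq0.
pose unitize (u : nat -> R) i := (rsum u)^-1 * u i.
have E : unitize (mu k) = unitize (lam k).
  apply: (@path_images_eq k (fun n => mu (cut n)) (fun n => lam (cut n))) => //.
  - have [_ s] := mu_s k; by rewrite rsumZ // mulVf // gt_eqF.
  - have [_ s] := lam_s k; by rewrite rsumZ // mulVf // gt_eqF.
  - by move=> n kn; exists (rsum (mu k))^-1; rewrite /unitize {2}(seq_path_col muE kn).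
  - by move=> n kn; exists (rsum (lam k))^-1; rewrite /unitize {2}(seq_path_col lamE kn).
pose c := rsum (mu k) / rsum (lam k).
have muk : mu k = fun i => c * lam k i.
  apply/funext => i; have := congr1 (fun f => f i) E; rewrite /unitize /c => h.
  by rewrite -mulrA -h mulrA mulfV ?mul1r // gt_eqF.
have c0 : 0 <= c by rewrite divr_ge0 // ltW.
have : c = 1.
  have [_ s0] := lam_s 0%N.
  have := mu1; rewrite (seq_path_col muE (leq0n k)) muk path_colZ //.
  by rewrite -(seq_path_col lamE (leq0n k)) rsumZ // lam1 mulr1.
by move=> c1; rewrite muk c1; apply/funext => i; rewrite mul1r.
Qed.

Lemma compatible_id (mu : nat -> R) F : pos_summable mu -> rsum mu = 1 ->
  compatible (vtx gamma 0) (lam 0%N) mu F ->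
  mu = lam 0%N /\ forall x, 0 <= x < 1 -> F x = x.
Proof.
move=> hmu mu1 hF.
(* The masses at the later stages, obtained by undoing the edges; they satisfy the recursion of the
   lengths. *)
pose fix m k := if k is k'.+1 then edge_solve (won gamma k') (vtx gamma k') (m k') else mu.
have hQ k : vertex (rauzy (won gamma k) (vtx gamma k)) by rewrite -hs.
have hm k : pos_summable (m k) /\ compatible (vtx gamma k) (lam k) (m k) F.
  elim: k => [//|k [IH1 IH2]]; rewrite lamE in IH2.
  have [h1 _ h3] := compatible_step (hv k) (hQ k) (lam_s k.+1) (lam_gt0 k.+1) IH1 IH2.
  by rewrite hs.
have mE k : m k = edge_col (won gamma k) (vtx gamma k) (m k.+1).
  have [IH1 IH2] := hm k; rewrite lamE in IH2.
  by have [] := compatible_step (hv k) (hQ k) (lam_s k.+1) (lam_gt0 k.+1) IH1 IH2.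
have ml k : m k = lam k by apply: weights_unique => // j; case: (hm j).
split; first exact: (ml 0%N).
(* The induction goes back from stage [N], where [F x] and [x] both lie between 0 and
   [rsum (lam N)]. *)
have dist N k : (k <= N)%N -> forall x, 0 <= x < rsum (lam (N - k)) ->
    `|F x - x| <= rsum (lam N).
  elim: k => [|k IH] kN x hx.
    rewrite subn0 in hx; have [_ [_ F2 _ _]] := hm N.
    have := F2 x hx; rewrite ml; move: hx => /andP[x0 x1] /andP[h1 h2].
    by rewrite ler_norml; apply/andP; split; lra.
  have [_ hc] := hm (N - k.+1)%N; rewrite ml lamE in hc.
  have NK : (N - k = (N - k.+1).+1)%N by lia.
  have {}IH := IH (ltnW kN); rewrite NK in IH.
  apply: (compatible_dist (hv _) (hQ _) (lam_s _) (lam_gt0 _) hc) => //.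
  by rewrite -lamE.
move=> x hx; apply/eqP; rewrite -subr_eq0 -normr_le0.
apply/ler_addgt0Pr => e e0; rewrite add0r.
have [N hN] := rsum_weights_small (Num.truncn e^-1).+1.
have := dist N N (leqnn N) x; rewrite subnn lam1 => /(_ hx) /le_trans; apply.
have h1 := truncnS_gt e^-1.
have : e^-1 * rsum (lam N) <= 1.
  by apply: le_trans hN; apply: ler_wpM2r; apply: ltW.
by rewrite ler_pdivrMl // mulr1.
Qed.

End Weights.

End Main.

(** * Invariant measures *)

Section MeasureLemmas.
Context {R : realType}.

Lemma eseries_rsum (g : nat -> R) : summable g ->
  (\sum_(c <oo) (g c)%:E)%E = (rsum g)%:E.
Proof.
move=> sg; rewrite /rsum -EFin_lim //.
by apply/congr_lim/funext => n; rewrite /= sumEFin.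
Qed.

Lemma eseries_real (g : nat -> R) (M : R) : (forall c, 0 <= g c) ->
  (\sum_(c <oo) (g c)%:E <= M%:E)%E ->
  pos_summable g /\ (\sum_(c <oo) (g c)%:E)%E = (rsum g)%:E.
Proof.
move=> g0 hM.
have part n : (series g n)%:E = (\sum_(0 <= i < n) (g i)%:E)%E by rewrite sumEFin.
have sg : summable g.
  apply: nondecreasing_is_cvgn; first by apply: nondecreasing_series => i _ _.
  exists M => _ [n _ <-]; rewrite -lee_fin part; apply: le_trans hM.
  by apply: nneseries_lim_ge => i _ _; rewrite lee_fin.
by split=> //; exact: eseries_rsum.
Qed.

Section Translation.
Variable c : R.
Let f (x : measurableTypeR R) : measurableTypeR R := x + c.

Let mf : measurable_fun setT f.
Proof. by apply: measurable_funD => //; exact: measurable_cst. Qed.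

HB.instance Definition _ := isMeasurableFun.Build _ _ _ _ f mf.

Lemma measurable_translate (B : set (measurableTypeR R)) : measurable B ->
  measurable ([set x | B (x + c)] : set (measurableTypeR R)).
Proof. by move=> mB; rewrite -[X in measurable X]setTI; exact: mf. Qed.

Lemma lebesgue_measure_translate (B : set (measurableTypeR R)) : measurable B ->
  lebesgue_measure ([set x | B (x + c)] : set (measurableTypeR R)) = lebesgue_measure B.
Proof.
move=> mB; rewrite -[LHS]/(pushforward lebesgue_measure f B).
apply/esym/lebesgue_measure_unique => //= _ [[a b]] _ <-.
have -> : pushforward lebesgue_measure f `]a, b]%classic =
    lebesgue_measure (`](a - c), (b - c)]%classic : set (measurableTypeR R)).
  rewrite /pushforward; congr lebesgue_measure; apply/seteqP; split=> x /=;
  by rewrite !in_itv /= /f ltrBlDr lerBrDr.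
rewrite !lebesgue_measure_itv /= !lte_fin ltrD2r.
by case: ifP => // _; rewrite -!EFinD; congr _%:E; ring.
Qed.

End Translation.

Lemma eq_probability (m1 m2 : probability (measurableTypeR R) R) :
  (forall x, m1 `]-oo, x]%classic = m2 `]-oo, x]%classic) ->
  forall B, measurable B -> m1 B = m2 B.
Proof.
move=> h B mB; apply: (@measure_unique _ R (measurableTypeR R) (@ocitv R)
  (fun n => `](- n%:R), n%:R]%classic) _ _ _ _ m1 m2) => //.
- by move=> ? ?; exact: ocitvI.
- by move=> k; exists (- k%:R, k%:R).
- apply/seteqP; split=> // x _; exists (Num.truncn `|x|).+1 => //=.
  have := truncnS_gt `|x|; rewrite in_itv /= ltr_norml => /andP[-> /ltW ->] //.
- move=> _ [[a b] _ <-] /=.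
  have E (m : probability (measurableTypeR R) R) : a <= b -> m `]a, b]%classic =
      (m `]-oo, b]%classic - m `]-oo, a]%classic)%E.
    move=> ab; have -> : `]a, b]%classic = `]-oo, b]%classic `\` `]-oo, a]%classic.
      apply/seteqP; split=> x /=; rewrite !in_itv /=.
        by move=> /andP[ax xb]; split=> //; apply/negP; rewrite -ltNge.
      by move=> [xb /negP]; rewrite -ltNge => ->.
    rewrite measureD //; last by rewrite -ge0_fin_numE // fin_num_measure.
    congr (_ - _)%E; congr (m _); apply: setIidr => x /=; rewrite !in_itv /=.
    by move=> /le_trans; apply.
  have [ab|ba] := leP a b; first by rewrite !E // !h.
  by rewrite set_itv_ge ?measure0 // bnd_simp -leNgt ltW.
- by move=> k; rewrite -ge0_fin_numE // fin_num_measure.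
Qed.

End MeasureLemmas.

Section Intervals.
Context {R : realType}.
Variables (P : gperm) (lam : nat -> R).
Hypotheses (hP : vertex P) (hl : pos_summable lam) (lam_gt0 : forall i, 0 < lam i).
Hypothesis lam1 : rsum lam = 1.

Local Notation I s a := (subinterval s P lam a : set (measurableTypeR R)).
Local Notation l s a := (left_end s P lam a).

Lemma subintervalE s a x : I s a x <-> l s a < x < l s a + lam a.
Proof. by rewrite /subinterval /= in_itv. Qed.

Lemma measurable_subinterval s a : measurable (I s a).
Proof. exact: measurable_itv. Qed.

Lemma subinterval_inj s a c x : I s a x -> I s c x -> a = c.
Proof.
move=> /subintervalE/andP[a1 a2] /subintervalE/andP[c1 c2]; apply: contrapT => ac.
have [h|h] := precedes_total hP s ac; have := left_end_next hP hl h; lra.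
Qed.

Lemma trivIset_subinterval s D : trivIset D (fun a => I s a).
Proof. by move=> a c _ _ [x [xa xc]]; exact: (subinterval_inj xa xc). Qed.

Lemma subinterval_itv01 s a : I s a `<=` `[0, 1].
Proof.
move=> x /subintervalE/andP[h1 h2] /=; rewrite in_itv /=.
have h3 : 0 <= l s a by exact: left_end_ge0.
by have := left_end_total hP s a hl; rewrite lam1; lra.
Qed.

Lemma subinterval_le s a c (x : R) : I s c x -> (x <= l s a <-> precedes s P c a).
Proof.
move=> /subintervalE/andP[cx xc]; split=> [xa|ca]; last first.
  by have := left_end_next hP hl ca; lra.
have [ac|ac] := pselect (c = a); first by exfalso; rewrite ac in cx; lra.
have [//|h] := precedes_total hP s ac.
by exfalso; have := left_end_next hP hl h; have := lam_gt0 a; lra.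
Qed.

Lemma ietE a x : I Top a x -> iet P lam x = x - l Top a + l Bot a.
Proof.
move=> xa; rewrite /iet.
have : [set y | exists2 a, subinterval Top P lam a x
    & y = x - left_end Top P lam a + left_end Bot P lam a] (iet P lam x).
  by apply: getPex; exists (x - l Top a + l Bot a); exists a.
by move=> [c xc]; rewrite -(subinterval_inj xa xc).
Qed.

Lemma iet_sub a x : I Top a x <-> I Bot a (x - l Top a + l Bot a).
Proof. by rewrite !subintervalE; split=> /andP[h1 h2]; apply/andP; split; lra. Qed.

Lemma iet_preimage (B : set R) : iet_dom P lam `&` iet P lam @^-1` B =
  \bigcup_a (I Top a `&` [set x | B (x + (l Bot a - l Top a))]).
Proof.
apply/seteqP; split=> [x [[a _ xa]] /= Bx|x [a _ [xa Bx]]].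
  exists a => //; split=> //=; move: Bx; rewrite (ietE xa).
  by congr (B _); ring.
split; first by exists a.
by rewrite /= (ietE xa); move: Bx => /=; congr (B _); ring.
Qed.

Lemma iet_preimage_sub a (B : set R) : B `<=` I Bot a ->
  iet_dom P lam `&` iet P lam @^-1` B =
  I Top a `&` [set x | B (x + (l Bot a - l Top a))].
Proof.
move=> Ba; rewrite iet_preimage; apply/seteqP; split=> [x [c _ [xc Bx]]|x [xa Bx]].
  have ac : a = c.
    apply: (@subinterval_inj Bot a c (x + (l Bot c - l Top c))); first exact: Ba.
    have := (iet_sub c x).1 xc; congr (I Bot c _); ring.
  by rewrite ac.
by exists a.
Qed.

Lemma measure_subintervals (m : {measure set (measurableTypeR R) -> \bar R}) s D B :
  measurable B ->
  m ((\bigcup_(a in D) I s a) `&` B) = (\sum_(a <oo | a \in D) m (I s a `&` B))%E.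
Proof.
move=> mB; rewrite setI_bigcupl measure_bigcup //.
  by move=> a _; apply: measurableI => //; exact: measurable_subinterval.
by apply: trivIset_setIr; exact: trivIset_subinterval.
Qed.

Local Notation leb := (@lebesgue_measure R).

Lemma lebesgue_subinterval s a : leb (I s a) = (lam a)%:E.
Proof.
rewrite /subinterval lebesgue_measure_itv /= lte_fin ltrDl lam_gt0 -EFinB.
by congr _%:E; ring.
Qed.

(** The lengths add up to 1, so the intervals leave out only a null set of the unit interval. *)
Lemma lebesgue_subintervals s (B : set (measurableTypeR R)) : measurable B ->
  leb ((\bigcup_a I s a) `&` B) = leb (B `&` `[0, 1]%classic).
Proof.
move=> mB; set U : set (measurableTypeR R) := \bigcup_a I s a.
pose J : set (measurableTypeR R) := `[0, 1]%classic.
have mU : measurable U by apply: bigcupT_measurable => a; exact: measurable_subinterval.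
have mJ : measurable J by exact: measurable_itv.
have UJ : U `<=` J by move=> x [a _ xa]; exact: subinterval_itv01 xa.
have leb1 : leb U = 1%E.
  have h : leb U = (\sum_(a <oo | a \in setT) leb (I s a `&` setT))%E.
    by rewrite -(@measure_subintervals leb) // setIT.
  rewrite h eseries_mkcond -lam1 -eseries_rsum; last by case: hl.
  by apply: eq_eseriesr => a _; rewrite in_setT setIT lebesgue_subinterval.
have lebJ : leb J = 1%E by rewrite /J lebesgue_measure_itv /= lte_fin ltr01 oppr0 adde0.
have JU0 : leb (J `\` U) = 0%E.
  have Joo : (leb J < +oo)%E by rewrite lebJ ltry.
  have -> : leb (J `\` U) = (leb J - leb (J `&` U))%E by exact: measureD.
  by rewrite (setIidr UJ) lebJ leb1 subee.
have -> : U `&` B = (B `&` J) `&` U.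
  apply/seteqP; split=> [x [xU xB]|x [[xB _] xU]] //.
  by split=> //; split=> //; exact: UJ.
have mBJ : measurable (B `&` J) by exact: measurableI.
have z : leb ((B `&` J) `\` U) = 0%E.
  apply: subset_measure0 JU0; [exact: measurableD|exact: measurableD|].
  by move=> x [[_ xJ] xU].
transitivity (leb ((B `&` J) `\` U) + leb ((B `&` J) `&` U))%E.
  by rewrite z add0e.
by apply/esym; exact: measureDI.
Qed.

(** The normalisation supplies the structure of a probability; the total mass is already 1, so
    nothing is rescaled and the default [point] is not reached. *)
Definition uniform01 : probability (measurableTypeR R) R :=
  mnormalize (mrestr leb (measurable_itv `[0, 1])) (point : probability (measurableTypeR R) R).

Lemma uniform01E B : uniform01 B = leb (B `&` `[0, 1]%classic).
Proof.
have T1 : mrestr leb (measurable_itv `[0, 1]) setT = 1%E.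
  by rewrite /mrestr setTI lebesgue_measure_itv /= lte_fin ltr01 oppr0 adde0.
rewrite /uniform01 /= /mnormalize /=. rewrite T1.
by rewrite onee_eq0 /= invr1 mule1.
Qed.

Lemma invariant_uniform01 : invariant_probability P lam uniform01.
Proof.
split; first by rewrite uniform01E setIid lebesgue_measure_itv /= lte_fin ltr01 oppr0 adde0.
move=> B mB; rewrite !uniform01E iet_preimage -(lebesgue_subintervals Bot mB).
rewrite (@measure_subintervals leb) // setIidl; last first.
  by move=> x [a _ [xa _]]; exact: subinterval_itv01 xa.
have mT a : measurable ([set x | B (x + (l Bot a - l Top a))] : set (measurableTypeR R)).
  exact: measurable_translate.
rewrite measure_bigcup; first last.
- by apply: trivIset_setIr; exact: trivIset_subinterval.
- by move=> a _; apply: measurableI => //; exact: measurable_subinterval.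
apply: eq_eseriesr => a _.
have mIB : measurable (I Bot a `&` B).
  by apply: measurableI => //; exact: measurable_subinterval.
apply: etrans (lebesgue_measure_translate (l Bot a - l Top a) mIB).
congr (leb _); apply/seteqP; split=> x [xa xB]; split=> //.
  by have := (iet_sub a x).1 xa; rewrite /= addrAC addrA.
by apply/iet_sub; move: xa; rewrite /= addrAC addrA.
Qed.

Section Invariant.
Variable nu : probability (measurableTypeR R) R.
Hypothesis hnu : invariant_probability P lam nu.

Let U s : set (measurableTypeR R) := \bigcup_a I s a.

Let mU s : measurable (U s).
Proof. by apply: bigcupT_measurable => a; exact: measurable_subinterval. Qed.

(** Invariance tested on the whole line gives full mass to the top intervals; tested on the union of
    the bottom intervals, it transfers this to them. *)
Lemma invariant_subintervals s : nu (U s) = 1%E.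
Proof.
have [_ hB] := hnu.
have dom1 : nu (U Top) = 1%E.
  have := hB setT measurableT; rewrite probability_setT => <-.
  by congr (nu _); rewrite preimage_setT setIT.
case: s => //; rewrite -(hB _ (mU Bot)) -dom1; congr (nu _).
apply/seteqP; split=> [x [] //|x xU]; split=> //.
have [a _ xa] := xU; exists a => //.
have /subintervalE h := (iet_sub a x).1 xa.
by apply/subintervalE; rewrite (ietE xa).
Qed.

Let fin_nu B : measurable B -> nu B \is a fin_num.
Proof. exact: fin_num_measure. Qed.

Lemma invariant_restrict s (B : set (measurableTypeR R)) : measurable B ->
  nu B = nu (U s `&` B).
Proof.
move=> mB; have nU : nu (~` U s) = 0%E.
  by rewrite probability_setC // invariant_subintervals subee.
have nD : nu (B `\` U s) = 0%E.
  apply: subset_measure0 nU; [exact: measurableD|exact: measurableC|].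
  by move=> x [].
transitivity (nu (B `\` U s) + nu (B `&` U s))%E; first exact: measureDI.
by rewrite nD add0e setIC.
Qed.

Definition mass a : R := fine (nu (I Top a)).

Lemma massE s a : nu (I s a) = (mass a)%:E.
Proof.
have ma := measurable_subinterval s a.
case: s ma => ma; first by rewrite /mass fineK // fin_nu.
have [_ hB] := hnu; rewrite /mass fineK; last exact: fin_nu (measurable_subinterval Top a).
rewrite -(hB _ ma) (@iet_preimage_sub a) //; congr (nu _).
apply: setIidl => x /iet_sub /=.
by congr (I Bot a _); ring.
Qed.

Lemma mass_series : (\sum_(a <oo) (mass a)%:E)%E = 1%E.
Proof.
have h : nu (U Top) = (\sum_(a <oo | a \in setT) nu (I Top a `&` setT))%E.
  by rewrite -measure_subintervals // setIT.
rewrite -(invariant_subintervals Top) h [RHS]eseries_mkcond; apply: eq_eseriesr => a _.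
by rewrite in_setT setIT (massE Top).
Qed.

Lemma mass_total : pos_summable mass /\ rsum mass = 1.
Proof.
have m0 a : 0 <= mass a by rewrite /mass fine_ge0.
have m1 : (\sum_(a <oo) (mass a)%:E <= 1%:E)%E by rewrite mass_series.
have [hm E] := eseries_real m0 m1; split=> //.
by apply: EFin_inj; rewrite -E mass_series.
Qed.

Lemma measure_part s (b : nat -> bool) (B : set (measurableTypeR R)) : measurable B ->
  U s `&` B = \bigcup_(a in [set a | b a]) I s a -> nu B = (part b mass)%:E.
Proof.
move=> mB E; rewrite (invariant_restrict s mB) E.
have := measure_subintervals nu s [set a | b a] measurableT; rewrite setIT => ->.
have [hm ms] := mass_total; have hb := pos_summable_if b hm.
rewrite eseries_mkcond.
have -> : (\sum_(a <oo) if a \in [set a | b a] then nu (I s a `&` setT) else 0)%E =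
    (\sum_(a <oo) ((if b a then mass a else 0)%:E))%E.
  apply: eq_eseriesr => a _; rewrite setIT massE.
  by case: (boolP (b a)) => ba; [rewrite mem_set | rewrite memNset //; apply/negP].
have h2 : (\sum_(a <oo) ((if b a then mass a else 0)%:E) <= 1%:E)%E.
  rewrite -mass_series; apply: lee_nneseries => [a *|a *]; rewrite lee_fin.
    by have [h _] := hb; exact: h.
  by case: ifP => // _; have [h _] := hm; exact: h.
by have [_ ->] := eseries_real hb.1 h2.
Qed.

Definition distribution_fun x : R := fine (nu `]-oo, x]%classic).

Lemma distribution_fun_sub x y : x <= y ->
  distribution_fun y - distribution_fun x = fine (nu `]x, y]%classic).
Proof.
move=> xy; have -> : `]x, y]%classic = `]-oo, y]%classic `\` `]-oo, x]%classic.
  apply/seteqP; split=> z /=; rewrite !in_itv /=.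
    by move=> /andP[xz zy]; split=> //; apply/negP; rewrite -ltNge.
  by move=> [zy /negP]; rewrite -ltNge => ->.
have E : `]-oo, y]%classic `&` `]-oo, x]%classic = `]-oo, x]%classic.
  by apply: setIidr => z /=; rewrite !in_itv /= => /le_trans; apply.
rewrite measureD //; last by rewrite -ge0_fin_numE // fin_nu.
by rewrite E fineB // fin_nu.
Qed.

(** The open intervals have full mass, so endpoints carry no atom and the ray may be replaced by the
    intervals it contains. *)
Lemma distribution_fun_left_end s a :
  distribution_fun (l s a) = left_end s P mass a.
Proof.
rewrite left_endE /distribution_fun (@measure_part s (fun c => `[< precedes s P c a >])) //.
apply/seteqP; split=> [x [[c _ xc] xa]|x [c /asboolP ca xc]].
  exists c => //; apply/asboolP; apply/(subinterval_le a xc).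
  by move: xa; rewrite /= in_itv.
split; first by exists c.
by rewrite /= in_itv /=; apply/(subinterval_le a xc).
Qed.

Lemma measure_shift a t : 0 <= t < lam a ->
  nu `](l Top a), (l Top a + t)]%classic = nu `](l Bot a), (l Bot a + t)]%classic.
Proof.
move=> /andP[t0 ta]; have [_ hB] := hnu.
have mB : measurable (`](l Bot a), (l Bot a + t)]%classic : set (measurableTypeR R)).
  exact: measurable_itv.
have key (x : R) : (l Top a < x <= l Top a + t) = (l Top a < x < l Top a + lam a) &&
    (l Bot a < x + (l Bot a - l Top a) <= l Bot a + t).
  apply/idP/idP => [/andP[h1 h2]|/andP[/andP[h1 h2] /andP[h3 h4]]].
    by apply/andP; split; apply/andP; split; lra.
  by apply/andP; split; lra.
have sub (x : R) : l Bot a < x <= l Bot a + t -> l Bot a < x < l Bot a + lam a.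
  by move=> /andP[h1 h2]; apply/andP; split; lra.
rewrite -[RHS](hB _ mB) (@iet_preimage_sub a).
  congr (nu _); apply/seteqP; split=> x; rewrite /subinterval /= !in_itv /= key.
    by move=> /andP[].
  by move=> [-> ->].
by move=> x; rewrite /subinterval /= !in_itv /=; exact: sub.
Qed.

Lemma invariant_compatible : compatible P lam mass distribution_fun.
Proof.
have nn s a : 0 <= l s a by exact: left_end_ge0.
split.
- by move=> x y x0 xy _; rewrite -subr_ge0 distribution_fun_sub // fine_ge0.
- move=> x _; rewrite mass_total.2 /distribution_fun fine_ge0 //=.
  have := @probability_le1 _ _ _ nu `]-oo, x]%classic (measurable_itv _).
  by rewrite -[X in (X <= _)%E]fineK ?fin_nu // lee_fin.
- exact: distribution_fun_left_end.
have shift a t : 0 <= t < lam a -> 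
    distribution_fun (l Top a + t) - distribution_fun (l Top a) =
    distribution_fun (l Bot a + t) - distribution_fun (l Bot a).
  move=> ht; have /andP[t0 _] := ht.
  by rewrite !distribution_fun_sub ?lerDl // measure_shift.
by move=> [] a t ht; rewrite /= shift.
Qed.

End Invariant.
End Intervals.

(** * Rays, and the deduction of uniqueness and unique ergodicity *)

Section Final.
Context {R : realType}.

Lemma invariant_ray (P : gperm) (lam : nat -> R) (nu : probability (measurableTypeR R) R) x :
  invariant_probability P lam nu ->
  (forall y, 0 <= y < 1 -> distribution_fun nu y = y) ->
  nu `]-oo, x]%classic = (if x < 0 then 0 else if x < 1 then x else 1)%:E.
Proof.
move=> [nu01 _] hF.
have mJ : measurable (`[0, 1]%classic : set (measurableTypeR R)) by exact: measurable_itv.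
have mX : measurable (`]-oo, x]%classic : set (measurableTypeR R)) by exact: measurable_itv.
case: ifPn => [x0|]; last rewrite -leNgt => x0.
  have nC : nu (~` `[0, 1]%classic) = 0%E by rewrite probability_setC // nu01 subee.
  apply: subset_measure0 nC => //; first exact: measurableC.
  move=> y /=; rewrite !in_itv /= => yx; apply/negP; rewrite negb_and.
  by rewrite -ltNge (le_lt_trans yx).
case: ifPn => [x1|]; last rewrite -leNgt => x1.
  transitivity (distribution_fun nu x)%:E; last by rewrite hF ?x0.
  by rewrite /distribution_fun fineK // fin_num_measure.
apply/eqP; rewrite eq_le probability_le1 //= -nu01; apply: le_measure; rewrite ?inE //.
by move=> y /=; rewrite !in_itv /= => /andP[_ y1]; exact: le_trans x1.
Qed.

Lemma simplexP (v : nat -> R) : simplex v <->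
  [/\ pos_summable v, forall i, 0 < v i & rsum v = 1].
Proof.
split=> [[v0 v1]|[[_ sv] v0 v1]].
  have [sv rv] := summable_sum v1; split=> //; split=> // i; exact: ltW.
by split=> //; have : series v @ \oo --> rsum v by []; rewrite v1.
Qed.

End Final.

Theorem theoremC (R : realType) (D : set gperm) (P : gperm)
    (gamma : infinite_path) (A : nat -> set nat) (cut : nat -> nat) (C : R)
    (hD : rauzy_diagram D)
    (hgamma : path_in D P gamma)
    (hAfin : forall n, (1 <= n)%N -> finite_set (A n))
    (hAinc : forall n, (1 <= n)%N -> A n `<=` A n.+1)
    (hAcov : \bigcup_(n in [set n | (1 <= n)%N]) A n = setT)
    (* the n-th factor consists of the edges of index cut n.-1, ..., cut n - 1 *)
    (hcut0 : cut 0%N = 0%N)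
    (hcut : forall n, (cut n < cut n.+1)%N)
    (hsupp : forall n, (1 <= n)%N ->
       strictly_supported (A n) (path_imx R gamma (cut n.-1) (cut n)))
    (hrev : forall n, (1 <= n)%N ->
       reveals gamma (cut n.-1) (cut n) n (A n))
    (hC : (ereal_sup [set diameter (A n) (path_imx R gamma (cut n.-1) (cut n))
             | n in [set n | (1 <= n)%N]] < C%:E)%E) :
  exists lam : nat -> R,
    unique (fun l => simplex l /\ limit_simplex R gamma l) lam /\
    uniquely_ergodic P lam.
Proof.
have hv n := path_vertex n hD hgamma.
have hs n : vtx gamma n.+1 = rauzy (won gamma n) (vtx gamma n).
  by have [_ /(_ n)[]] := hgamma.
have P0 : vtx gamma 0%N = P by have [] := hgamma.
have [lam [lam_s lam_gt0 lamE lam1]] :=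
  exists_weights hv hs hAfin hAinc hAcov hcut0 hcut hsupp hrev hC.
have sum_gt0 k : 0 < rsum (lam k).
  by apply: (lt_le_trans (lam_gt0 k 0%N)); apply: term_le_rsum; case: (lam_s k).
have lamP k n : (k <= n)%N -> lam k = path_col gamma k n (lam n) by exact: seq_path_col.
exists (lam 0%N); split; first split.
- split; first by apply/simplexP.
  move=> n _; have c0 : 0 < (rsum (lam n))^-1 by rewrite invr_gt0.
  (* The preimage in the simplex is the normalised length vector at stage n. *)
  exists (fun i => (rsum (lam n))^-1 * lam n i).
    apply/simplexP; split; first by apply: pos_summableZ => //; exact: ltW.
      by move=> i; rewrite mulr_gt0.
    by rewrite rsumZ ?mulVf ?gt_eqF //; case: (lam_s n).
  have hn : pos_summable (fun i => (rsum (lam n))^-1 * lam n i).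
    by apply: pos_summableZ => //; exact: ltW.
  apply/funext => i; rewrite /hat mul_path // path_colZ ?ltW // -lamP //.
  have -> : norm1 (fun i => (rsum (lam n))^-1 * lam 0%N i) = (rsum (lam n))^-1.
    rewrite /norm1 -[RHS]mulr1 -lam1 -rsumZ; last by case: (lam_s 0%N).
    by apply: eq_rsum => j; rewrite ger0_norm // mulr_ge0 // ltW.
  by rewrite mulrAC divff ?mul1r // gt_eqF.
- move=> l [/simplexP[l_s l_gt0 l1] hl].
  have ex n : exists w, simplex w /\ hat (path_imx R gamma 0 (cut n)) w = l.
    by have [w w1 w2] := hl (cut n) I; exists w.
  have [v hv'] := choice ex.
  apply: (@path_images_eq R gamma A cut C hv hs hAfin hAinc hcut0 hcut hsupp hrev hC
    0 (fun n => lam (cut n)) v) => //.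
  + move=> n; have [/simplexP[v1 v2 v3] _] := hv' n; split=> //.
    by rewrite v3.
  + by move=> n _; exists 1; rewrite {1}(lamP 0 (cut n)) //; apply/funext => i; rewrite mul1r.
  + move=> n _; have [/simplexP[v1 v2 v3] <-] := hv' n.
    exists (norm1 (mul_imv (path_imx R gamma 0 (cut n)) (v n)))^-1.
    by apply/funext => i; rewrite /hat mul_path // mulrC.
have vP : vertex P by rewrite -P0.
have ray nu : invariant_probability P (lam 0%N) nu ->
    forall y, 0 <= y < 1 -> distribution_fun nu y = y.
  move=> hnu; have [m_s m1] := mass_total vP (lam_s 0%N) hnu.
  have := invariant_compatible vP (lam_s 0%N) (lam_gt0 0%N) hnu.
  rewrite -{1}P0 => hc.
  by have [] := compatible_id hv hs hAfin hAinc hAcov hcut0 hcut hsupp hrev hC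
    lam_s lam_gt0 lamE lam1 m_s m1 hc.
have inv := invariant_uniform01 vP (lam_s 0%N) (lam_gt0 0%N) lam1.
exists uniform01 => // nu hnu; apply: eq_probability => x.
(* Lebesgue measure is itself an invariant measure, so the same computation of rays applies to it
   and to [nu]. *)
by rewrite (invariant_ray x hnu (ray _ hnu)) (invariant_ray x inv (ray _ inv)).
Qed.
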